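(* Let $k$ be an algebraically closed field of characteristic $0$, and let $R=k[x,y,z]$ be the polynomial ring in three variables, with the $\mathbb{N}$-grading $R=\bigoplus_{d\in\mathbb{N}}R_d$ as a $k$-algebra for which $x\in R_3$, $y\in R_2$, $z\in R_1$. Let $f\in R_9$ satisfy the following conditions: (C1) $f$ is irreducible; (C2) the curve $\operatorname{Proj}(R/fR)$ has at least two singular points; (C3) $f(x,y,0)=x(px^2+qy^3)$ for some $p,q\in k^*$. Let $R[W]$ be the polynomial ring in one variable over $R$. Then for every integer $n\ge 2$ with $n\notin 3\mathbb{Z}$, the quotient ring $R[W]/(W^n+f)$ is a rigid rational unique factorization domain.
   Context: A locally nilpotent derivation of a $k$-algebra domain $B$ is a $k$-derivation $D:B\to B$ such that for each $b\in B$ there is $n\in\mathbb{N}$ with $D^n b=0$. An integral domain $B$ of characteristic zero is rigid if its only locally nilpotent derivation is the zero derivation. A finitely generated $k$-algebra domain is rational if its field of fractions is a purely transcendental extension of $k$. *)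

(* Defs.v *)
From HB Require Import structures.
From mathcomp Require Import all_boot all_order all_algebra.
From mathcomp Require Import generic_quotient ring_quotient ring zify.
From mathcomp Require Import boolp.
From mathcomp Require Import mpoly.

Set Implicit Arguments.
Unset Strict Implicit.
Unset Printing Implicit Defensive.

Import GRing.Theory.
Local Open Scope ring_scope.
Local Open Scope quotient_scope.

Section CommutativeAlgebra.
Variable A : comNzRingType.
Implicit Types (a b x y z : A) (s t : seq A) (I J P : A -> Prop).

Definition is_domain := forall x y, x * y = 0 -> x = 0 \/ y = 0.

Definition invertible x := exists y, x * y = 1.

Definition irreducible_elt x :=
  [/\ x <> 0, ~ invertible x &
      forall y z, x = y * z -> invertible y \/ invertible z].

Definition associated x y := exists2 u, invertible u & y = u * x.

Definition is_ufd :=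
  [/\ is_domain,
      (forall x, x <> 0 -> ~ invertible x ->
         exists2 s, (forall y, y \in s -> irreducible_elt y) &
           x = \prod_(y <- s) y)
    & (forall s t, (forall y, y \in s -> irreducible_elt y) ->
         (forall y, y \in t -> irreducible_elt y) ->
         \prod_(y <- s) y = \prod_(y <- t) y ->
         exists t', [/\ perm_eq t t', size s = size t' &
           forall i, (i < size s)%N -> associated s`_i t'`_i])].

Definition is_ideal I :=
  [/\ I 0, (forall x y, I x -> I y -> I (x + y))
         & (forall a x, I x -> I (a * x))].

Definition prime_ideal P :=
  [/\ is_ideal P, ~ P 1 & forall x y, P (x * y) -> P x \/ P y].

Definition maximal_ideal I :=
  [/\ is_ideal I, ~ I 1 &
      forall J, is_ideal J -> ~ J 1 -> (forall x, I x -> J x) ->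
        forall x, J x -> I x].

Definition generates s I :=
  forall x, I x <-> exists c : nat -> A, x = \sum_(i < size s) c i * s`_i.

Definition noetherian := forall I, is_ideal I -> exists s, generates s I.

Definition prime_chain (d : nat) (Q : nat -> A -> Prop) :=
  (forall i, (i <= d)%N -> prime_ideal (Q i)) /\
  (forall i, (i < d)%N ->
     (forall x, Q i x -> Q i.+1 x) /\ exists2 x, Q i.+1 x & ~ Q i x).

Definition krull_dim (d : nat) :=
  (exists Q, prime_chain d Q) /\ ~ (exists Q, prime_chain d.+1 Q).

Definition regular_local_ring :=
  noetherian /\
  exists m, [/\ maximal_ideal m,
    (forall m', maximal_ideal m' -> forall x, m' x <-> m x) &
    exists2 s, generates s m & krull_dim (size s)].

End CommutativeAlgebra.

Record grading (A : comNzRingType) := Grading {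
  gpiece :> nat -> A -> Prop;
  gpiece0 : forall d, gpiece d 0;
  gpieceB : forall d a b, gpiece d a -> gpiece d b -> gpiece d (a - b);
  gpiece1 : gpiece 0%N 1;
  gpieceM : forall d e a b,
    gpiece d a -> gpiece e b -> gpiece (d + e)%N (a * b);
  gpiece_span : forall a, exists n (c : nat -> A),
    (forall i, gpiece i (c i)) /\ a = \sum_(i < n) c i;
  gpiece_direct : forall n (c : nat -> A), (forall i, gpiece i (c i)) ->
    \sum_(i < n) c i = 0 -> forall i, (i < n)%N -> c i = 0
}.

Definition homogeneous_ideal (A : comNzRingType) (G : grading A)
    (P : A -> Prop) :=
  forall a, P a -> exists2 s : seq A,
    (forall b, b \in s -> P b /\ exists d, G d b) & a = \sum_(b <- s) b.

Record proj_point (A : comNzRingType) (G : grading A) := ProjPoint {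
  proj_ideal :> A -> Prop;
  proj_prime : prime_ideal proj_ideal;
  proj_homogeneous : homogeneous_ideal G proj_ideal;
  proj_relevant : exists d a, [/\ (0 < d)%N, G d a & ~ proj_ideal a]
}.

(* The local ring of Proj A at p: classes of fractions a / s, where a and s   *)
(* are homogeneous of the same degree and s is not in p.                      *)
Section HomogeneousLocalization.
Variables (A : comNzRingType) (G : grading A) (p : proj_point G).

Definition hden (s : A) := (exists d, G d s) /\ ~ p s.

Record hfrac := HFrac {
  hfrac_val : nat * A * A;
  hfrac_valP : `[< [/\ G hfrac_val.1.1 hfrac_val.1.2,
                       G hfrac_val.1.1 hfrac_val.2 & ~ p hfrac_val.2] >]
}.
HB.instance Definition _ := [isSub for hfrac_val].
HB.instance Definition _ := [Choice of hfrac by <:].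

Definition hdeg (x : hfrac) : nat := (val x).1.1.
Definition hnum (x : hfrac) : A := (val x).1.2.
Definition hdnm (x : hfrac) : A := (val x).2.

Lemma hnumP x : G (hdeg x) (hnum x).
Proof. by case: x => v vP; move/asboolP: (vP) => []. Qed.
Lemma hdnmP x : G (hdeg x) (hdnm x).
Proof. by case: x => v vP; move/asboolP: (vP) => []. Qed.
Lemma hdnmN x : ~ p (hdnm x).
Proof. by case: x => v vP; move/asboolP: (vP) => []. Qed.
Lemma hdnm_hden x : hden (hdnm x).
Proof. by split; [exists (hdeg x); apply: hdnmP | apply: hdnmN]. Qed.

Lemma gpieceN d a : G d a -> G d (- a).
Proof.
by move=> Ga; rewrite -[- a]add0r; apply: gpieceB Ga; apply: gpiece0.
Qed.
Lemma gpieceD d a b : G d a -> G d b -> G d (a + b).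
Proof. by move=> Ga Gb; rewrite -[b]opprK; apply: gpieceB Ga (gpieceN Gb). Qed.

Lemma projM a b : ~ p a -> ~ p b -> ~ p (a * b).
Proof.
by move=> pa pb; case: (proj_prime p) => _ _ + /[dup] => /[apply] -[].
Qed.
Lemma proj1N : ~ p 1.
Proof. by case: (proj_prime p). Qed.
Lemma hdenM a b : hden a -> hden b -> hden (a * b).
Proof.
move=> [[d Ga] pa] [[e Gb] pb]; split; last exact: projM.
by exists (d + e)%N; apply: gpieceM.
Qed.

Definition mk_hfrac d a s (Ga : G d a) (Gs : G d s) (ps : ~ p s) : hfrac :=
  @HFrac (d, a, s) (asboolT (And3 Ga Gs ps)).

Definition hequiv (x y : hfrac) : bool :=
  `[< exists2 t, hden t & t * (hnum x * hdnm y - hnum y * hdnm x) = 0 >].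

Lemma hequiv_is_equiv : equiv_class_of hequiv.
Proof.
split=> [x|x y|y x z].
- apply/asboolP; exists 1; last by rewrite subrr mulr0.
  by split; [exists 0%N; apply: gpiece1 | exact: proj1N].
- by apply/asboolP/asboolP => -[t tP e]; exists t => //;
    rewrite -opprB mulrN e oppr0.
- move=> /asboolP[t tP e1] /asboolP[u uP e2]; apply/asboolP.
  exists (t * u * hdnm y); first by apply: hdenM (hdnm_hden y); apply: hdenM.
  have -> : t * u * hdnm y * (hnum x * hdnm z - hnum z * hdnm x) =
     u * hdnm z * (t * (hnum x * hdnm y - hnum y * hdnm x)) +
     t * hdnm x * (u * (hnum y * hdnm z - hnum z * hdnm y)) by ring.
  by rewrite e1 e2 !mulr0 addr0.
Qed.
Canonical hequiv_equiv := EquivRelPack hequiv_is_equiv.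
Canonical hequiv_encModRel := defaultEncModRel hequiv.

Definition hloc := {eq_quot hequiv}.
HB.instance Definition _ : EqQuotient hfrac hequiv hloc := EqQuotient.on hloc.
HB.instance Definition _ := Choice.on hloc.

Definition hfrac0 : hfrac := mk_hfrac (gpiece0 G 0) (gpiece1 G) proj1N.
Definition hfrac1 : hfrac := mk_hfrac (gpiece1 G) (gpiece1 G) proj1N.
Definition hfracN (x : hfrac) : hfrac :=
  mk_hfrac (gpieceN (hnumP x)) (hdnmP x) (@hdnmN x).
Definition hfracM (x y : hfrac) : hfrac :=
  mk_hfrac (gpieceM (hnumP x) (hnumP y)) (gpieceM (hdnmP x) (hdnmP y))
           (projM (@hdnmN x) (@hdnmN y)).
Definition hfracD (x y : hfrac) : hfrac :=
  mk_hfrac (gpieceD (gpieceM (hnumP x) (hdnmP y)) (gpieceM (hdnmP x) (hnumP y)))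
           (gpieceM (hdnmP x) (hdnmP y)) (projM (@hdnmN x) (@hdnmN y)).

Definition hloc0 : hloc := lift_cst hloc hfrac0.
Definition hloc1 : hloc := lift_cst hloc hfrac1.
Definition hlocN := lift_op1 hloc hfracN.
Definition hlocD := lift_op2 hloc hfracD.
Definition hlocM := lift_op2 hloc hfracM.
Canonical pi_hloc0_morph := PiConst hloc0.
Canonical pi_hloc1_morph := PiConst hloc1.

Lemma hequivP x y :
  reflect (exists2 t, hden t & t * (hnum x * hdnm y - hnum y * hdnm x) = 0)
          (x == y %[mod hloc]).
Proof. by rewrite piE; apply: asboolP. Qed.

Lemma hequiv_repr x :
  exists2 t, hden t & t * (hnum x * hdnm (repr (\pi_hloc x))
                            - hnum (repr (\pi_hloc x)) * hdnm x) = 0.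
Proof. by apply/hequivP; rewrite reprK. Qed.

Lemma hden1 : hden 1.
Proof. by split; [exists 0%N; apply: gpiece1 | exact: proj1N]. Qed.

Lemma hloc_eq x y : hnum x * hdnm y = hnum y * hdnm x -> x = y %[mod hloc].
Proof.
move=> e; apply/eqP/hequivP; exists 1; first exact: hden1.
by rewrite e subrr mulr0.
Qed.

Lemma pi_hlocN : {morph \pi : x / hfracN x >-> hlocN x}.
Proof.
move=> x; unlock hlocN; apply/eqP/hequivP; have [t tP e] := hequiv_repr x.
exists t => //; set x' := repr _ in e *.
change (t * (- hnum x * hdnm x' - - hnum x' * hdnm x) = 0).
by rewrite !mulNr -opprD mulrN e oppr0.
Qed.
Canonical pi_hlocN_morph := PiMorph1 pi_hlocN.

Lemma pi_hlocD : {morph \pi : x y / hfracD x y >-> hlocD x y}.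
Proof.
move=> x y; unlock hlocD; apply/eqP/hequivP.
have [t tP e] := hequiv_repr x; have [u uP f] := hequiv_repr y.
exists (t * u); first exact: hdenM.
set x' := repr _ in e *; set y' := repr _ in f *.
change (t * u * ((hnum x * hdnm y + hdnm x * hnum y) * (hdnm x' * hdnm y') -
  (hnum x' * hdnm y' + hdnm x' * hnum y') * (hdnm x * hdnm y)) = 0).
transitivity (u * hdnm y * hdnm y' * (t * (hnum x * hdnm x' - hnum x' * hdnm x))
  + t * hdnm x * hdnm x' * (u * (hnum y * hdnm y' - hnum y' * hdnm y))).
  by ring.
by rewrite e f !mulr0 addr0.
Qed.
Canonical pi_hlocD_morph := PiMorph2 pi_hlocD.

Lemma pi_hlocM : {morph \pi : x y / hfracM x y >-> hlocM x y}.
Proof.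
move=> x y; unlock hlocM; apply/eqP/hequivP.
have [t tP e] := hequiv_repr x; have [u uP f] := hequiv_repr y.
exists (t * u); first exact: hdenM.
set x' := repr _ in e *; set y' := repr _ in f *.
change (t * u * ((hnum x * hnum y) * (hdnm x' * hdnm y') -
  (hnum x' * hnum y') * (hdnm x * hdnm y)) = 0).
transitivity (u * hnum y * hdnm y' * (t * (hnum x * hdnm x' - hnum x' * hdnm x))
  + t * hnum x' * hdnm x * (u * (hnum y * hdnm y' - hnum y' * hdnm y))).
  by ring.
by rewrite e f !mulr0 addr0.
Qed.
Canonical pi_hlocM_morph := PiMorph2 pi_hlocM.

Let hfracE := (
  (fun x y => erefl : hnum (hfracD x y) = hnum x * hdnm y + hdnm x * hnum y),
  (fun x y => erefl : hdnm (hfracD x y) = hdnm x * hdnm y),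
  (fun x y => erefl : hnum (hfracM x y) = hnum x * hnum y),
  (fun x y => erefl : hdnm (hfracM x y) = hdnm x * hdnm y),
  (fun x => erefl : hnum (hfracN x) = - hnum x),
  (fun x => erefl : hdnm (hfracN x) = hdnm x),
  (erefl : hnum hfrac0 = 0), (erefl : hdnm hfrac0 = 1),
  (erefl : hnum hfrac1 = 1), (erefl : hdnm hfrac1 = 1)).

Local Ltac hloc_ring := apply: hloc_eq; rewrite !hfracE; ring.

Lemma hlocDA : associative hlocD.
Proof.
by move=> x y z; rewrite -[x]reprK -[y]reprK -[z]reprK !piE; hloc_ring.
Qed.
Lemma hlocDC : commutative hlocD.
Proof. by move=> x y; rewrite -[x]reprK -[y]reprK !piE; hloc_ring. Qed.
Lemma hloc0D : left_id hloc0 hlocD.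
Proof. by move=> x; rewrite -[x]reprK !piE; hloc_ring. Qed.
Lemma hlocND : left_inverse hloc0 hlocN hlocD.
Proof. by move=> x; rewrite -[x]reprK !piE; hloc_ring. Qed.
HB.instance Definition _ :=
  GRing.isZmodule.Build hloc hlocDA hlocDC hloc0D hlocND.

Lemma hlocMA : associative hlocM.
Proof.
by move=> x y z; rewrite -[x]reprK -[y]reprK -[z]reprK !piE; hloc_ring.
Qed.
Lemma hlocMC : commutative hlocM.
Proof. by move=> x y; rewrite -[x]reprK -[y]reprK !piE; hloc_ring. Qed.
Lemma hloc1M : left_id hloc1 hlocM.
Proof. by move=> x; rewrite -[x]reprK !piE; hloc_ring. Qed.
Lemma hlocMDl : left_distributive hlocM hlocD.
Proof.
by move=> x y z; rewrite -[x]reprK -[y]reprK -[z]reprK !piE; hloc_ring.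
Qed.
Lemma hloc1_neq0 : hloc1 != hloc0.
Proof.
rewrite !piE; apply/asboolP => -[t [_ pt]].
rewrite /hnum /hdnm /= mul0r subr0 !mulr1 => t0; apply: pt; rewrite t0.
by case: (proj_prime p) => -[].
Qed.
HB.instance Definition _ := GRing.Zmodule_isComNzRing.Build hloc
  hlocMA hlocMC hloc1M hlocMDl hloc1_neq0.

Definition singular_point := ~ regular_local_ring hloc.

End HomogeneousLocalization.

Definition at_least_two_singular_points (A : comNzRingType) (G : grading A) :=
  exists p q : proj_point G,
    [/\ ~ (forall a, p a <-> q a), singular_point p & singular_point q].

(* {ideal_quot I} requires a proper ideal: as for {poly %/ h}, which falls    *)
(* back on 'X, the generator is replaced by 0 when it is invertible.          *)
Section PrincipalQuotient.
Variables (R : comNzRingType) (g : R).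

Definition proper_gen : R := if `[< invertible g >] then 0 else g.

Definition principal_ideal : R -> bool :=
  fun a => `[< exists b, a = b * proper_gen >].

Lemma principal_idealr_closed : idealr_closed principal_ideal.
Proof.
split.
- by apply/asboolP; exists 0; rewrite mul0r.
- apply/asboolP; rewrite /proper_gen; case: asboolP => [_|ng] [b].
    by rewrite mulr0 => /eqP; rewrite oner_eq0.
  by move=> e; apply: ng; exists b; rewrite mulrC.
- move=> a u v /asboolP[b ->] /asboolP[c ->]; apply/asboolP.
  by exists (a * b + c); rewrite mulrA mulrDl.
Qed.
HB.instance Definition _ :=
  isIdealr.Build R principal_ideal principal_idealr_closed.

Definition principal_idealr : idealr R := principal_ideal.

Definition principal_quot : Type := {ideal_quot principal_idealr}.
HB.instance Definition _ := GRing.ComNzRing.on principal_quot.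

Definition to_principal_quot (r : R) : principal_quot :=
  \pi_({ideal_quot principal_idealr}) r.

Lemma to_principal_quot_is_zmod_morphism : zmod_morphism to_principal_quot.
Proof. exact: (raddfB (\pi_({ideal_quot principal_idealr}))). Qed.
Lemma to_principal_quot_is_monoid_morphism : monoid_morphism to_principal_quot.
Proof.
split; first exact: (rmorph1 (\pi_({ideal_quot principal_idealr}))).
exact: (rmorphM (\pi_({ideal_quot principal_idealr}))).
Qed.
HB.instance Definition _ := GRing.isZmodMorphism.Build R principal_quot
  to_principal_quot to_principal_quot_is_zmod_morphism.
HB.instance Definition _ := GRing.isMonoidMorphism.Build R principal_quot
  to_principal_quot to_principal_quot_is_monoid_morphism.

Lemma to_principal_quot_eq0 r :
  to_principal_quot r = 0 <-> exists b, r = b * proper_gen.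
Proof.
split=> [e|re]; last apply/eqP.
  have: \pi_({ideal_quot principal_idealr}) r == 0 by apply/eqP.
  by rewrite piE Quotient.equivE subr0 => /asboolP.
rewrite /to_principal_quot piE Quotient.equivE subr0.
exact/asboolP.
Qed.

Lemma to_principal_quot_surj a : exists r, a = to_principal_quot r.
Proof.
exists (repr (a : {ideal_quot principal_idealr})).
by rewrite /to_principal_quot reprK.
Qed.

End PrincipalQuotient.

Section Algebras.
Variables (k : fieldType) (B : comAlgType k).

Definition derivation (D : B -> B) :=
  linear D /\ forall a b, D (a * b) = D a * b + a * D b.

Definition locally_nilpotent (D : B -> B) :=
  forall b, exists n, iter n D b = 0.

Definition is_rigid :=
  [/\ is_domain B, [pchar B] =i pred0 &
      forall D, derivation D -> locally_nilpotent D -> forall b, D b = 0].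

Definition finitely_generated :=
  exists n (b : 'I_n -> B), forall a, exists q : {mpoly k[n]},
    a = mmap (in_alg B) b q.

End Algebras.

(* Only finite transcendence bases are considered, which is no restriction    *)
(* for the fraction field of a finitely generated algebra.                    *)
Definition purely_transcendental (k F : fieldType) (i : {rmorphism k -> F}) :=
  exists n (t : 'I_n -> F),
    (forall q : {mpoly k[n]}, mmap i t q = 0 -> q = 0) /\
    (forall z, exists q r : {mpoly k[n]},
       mmap i t r != 0 /\ z = mmap i t q / mmap i t r).

Definition fraction_field (B : comNzRingType) (F : fieldType)
    (j : {rmorphism B -> F}) :=
  injective j /\ forall z, exists a b, b != 0 /\ z = j a / j b.

Definition is_rational (k : fieldType) (B : comAlgType k) :=
  [/\ is_domain B, finitely_generated B &
    exists (F : fieldType) (j : {rmorphism B -> F}),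
      fraction_field j /\ purely_transcendental (j \o in_alg B)].

Section QuotientGrading.
Variables (k : fieldType) (n : nat) (mf : measure n).
Variables (e : nat) (f : {mpoly k[n]}).
Hypothesis f_homog : f \is e.-homog for mf.

Definition quot_piece (d : nat) (a : principal_quot f) : Prop :=
  exists2 r, r \is d.-homog for mf & a = to_principal_quot f r.

Lemma quot_piece0 d : quot_piece d 0.
Proof. by exists 0; rewrite ?rmorph0 ?rpred0. Qed.

Lemma quot_pieceB d a b :
  quot_piece d a -> quot_piece d b -> quot_piece d (a - b).
Proof.
move=> [r rd ->] [s sd ->]; exists (r - s); last by rewrite rmorphB.
exact: rpredB.
Qed.

Lemma quot_piece1 : quot_piece 0 1.
Proof. by exists 1; rewrite ?rmorph1 ?dhomog1. Qed.

Lemma quot_pieceM d d' a b :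
  quot_piece d a -> quot_piece d' b -> quot_piece (d + d')%N (a * b).
Proof.
move=> [r rd ->] [s sd ->]; exists (r * s); last by rewrite rmorphM.
exact: dhomogM.
Qed.

Lemma quot_piece_span a : exists m (c : nat -> principal_quot f),
  (forall i, quot_piece i (c i)) /\ a = \sum_(i < m) c i.
Proof.
have [r ->] := to_principal_quot_surj a.
exists (mmeasure mf r), (fun d => to_principal_quot f (pihomog mf d r)).
split=> [i|]; first by exists (pihomog mf i r) => //; apply: pihomogP.
by rewrite -rmorph_sum -(pihomog_partitionE (leqnn _)).
Qed.

Lemma quot_piece_direct m (c : nat -> principal_quot f) :
  (forall i, quot_piece i (c i)) -> \sum_(i < m) c i = 0 ->
  forall i, (i < m)%N -> c i = 0.
Proof.
move=> cP c0 i im.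
have [r rP] : {r : nat -> {mpoly k[n]} &
    forall j, r j \is j.-homog for mf /\ c j = to_principal_quot f (r j)}.
  apply: (@boolp.choice _ _ (fun j r =>
    r \is j.-homog for mf /\ c j = to_principal_quot f r)) => j.
  by have [r] := cP j; exists r.
have [b eb] : exists b, \sum_(j < m) r j = b * proper_gen f.
  apply/to_principal_quot_eq0; rewrite rmorph_sum -[RHS]c0.
  by apply: eq_bigr => j _; have [_ ->] := rP j.
have g_homog : proper_gen f \is e.-homog for mf.
  by rewrite /proper_gen; case: asboolP => // _; apply: rpred0.
have [_ ->] := rP i; apply/to_principal_quot_eq0.
have -> : r i = pihomog mf i (\sum_(j < m) r j).
  rewrite raddf_sum (bigD1 (Ordinal im)) //= pihomog_dE; last by case: (rP i).
  rewrite big1 ?addr0 // => j ji; apply: (@pihomog_ne0 _ _ _ (j : nat)).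
    by apply: contra ji => /eqP ji; apply/eqP/val_inj.
  by case: (rP j).
rewrite eb {1}(pihomog_partitionE (leqnn (mmeasure mf b))) mulr_suml raddf_sum.
exists (\sum_(j < mmeasure mf b | (j + e)%N == i) pihomog mf j b).
rewrite mulr_suml [RHS]big_mkcond /=; apply: eq_bigr => j _.
have h : pihomog mf j b * proper_gen f \is (j + e).-homog for mf.
  by apply: dhomogM => //; apply: pihomogP.
by case: eqP => [ji|/eqP ji]; [rewrite -ji pihomog_dE | apply: pihomog_ne0 h].
Qed.

Definition quot_grading : grading (principal_quot f) :=
  Grading quot_piece0 quot_pieceB quot_piece1 quot_pieceM quot_piece_span
    quot_piece_direct.

End QuotientGrading.

(* The variables x, y, z of degrees 3, 2, 1 are 'X_0, 'X_1, 'X_2.             *)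
Definition wt321 (m : 'X_{1..3}) : nat :=
  (3 * m 0%R + 2 * m 1%R + m 2%:R)%N.

Lemma wt321_0 : wt321 0%MM = 0%N.
Proof. by rewrite /wt321 !mnm0E. Qed.
Lemma wt321_D : {morph wt321 : m1 m2 / (m1 + m2)%MM >-> (m1 + m2)%N}.
Proof. by move=> m1 m2; rewrite /wt321 !mnmDE; lia. Qed.
HB.instance Definition _ := isMeasure.Build 3 wt321 wt321_0 wt321_D.

Section Cover.
Variables (k : fieldType) (n : nat) (f : {mpoly k[3]}).

Definition cyclic_cover : Type := {poly %/ 'X^n + f%:P}.
HB.instance Definition _ := GRing.ComNzRing.on cyclic_cover.

Lemma mk_monic_cyclic_cover : (0 < n)%N -> mk_monic ('X^n + f%:P) = 'X^n + f%:P.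
Proof.
move=> n0; have lt : (size f%:P < size ('X^n : {poly {mpoly k[3]}}))%N.
  by rewrite size_polyXn ltnS (leq_trans (size_polyC_leq1 f)).
rewrite /mk_monic size_polyDl // size_polyXn ltnS n0 /=.
by rewrite monicE lead_coefDl // lead_coefXn eqxx.
Qed.

(* The k-algebra structure, by restriction of scalars along k -> k[x,y,z].    *)
Definition cyclic_cover_scale (c : k) (b : cyclic_cover) : cyclic_cover :=
  c%:MP *: (b : {poly %/ 'X^n + f%:P}).

Lemma cyclic_cover_scaleA a b v :
  cyclic_cover_scale a (cyclic_cover_scale b v) = cyclic_cover_scale (a * b) v.
Proof. by rewrite /cyclic_cover_scale scalerA mpolyCM. Qed.
Lemma cyclic_cover_scale1 : left_id 1 cyclic_cover_scale.
Proof. by move=> v; rewrite /cyclic_cover_scale mpolyC1 scale1r. Qed.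
Lemma cyclic_cover_scaleDr : right_distributive cyclic_cover_scale +%R.
Proof. by move=> a u v; rewrite /cyclic_cover_scale scalerDr. Qed.
Lemma cyclic_cover_scaleDl v : {morph cyclic_cover_scale^~ v : a b / a + b}.
Proof. by move=> a b; rewrite /cyclic_cover_scale mpolyCD scalerDl. Qed.
HB.instance Definition _ := GRing.Zmodule_isLmodule.Build k cyclic_cover
  cyclic_cover_scaleA cyclic_cover_scale1
  cyclic_cover_scaleDr cyclic_cover_scaleDl.
Lemma cyclic_cover_scaleAl (a : k) (u v : cyclic_cover) :
  a *: (u * v) = (a *: u) * v.
Proof. exact: (@scalerAl _ {poly %/ 'X^n + f%:P}). Qed.
HB.instance Definition _ := GRing.Lmodule_isLalgebra.Build k cyclic_cover
  cyclic_cover_scaleAl.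
Lemma cyclic_cover_scaleAr (a : k) (u v : cyclic_cover) :
  a *: (u * v) = u * (a *: v).
Proof. by rewrite mulrC cyclic_cover_scaleAl mulrC. Qed.
HB.instance Definition _ := GRing.Lalgebra_isAlgebra.Build k cyclic_cover
  cyclic_cover_scaleAr.

End Cover.

(* Main.v *)
From HB Require Import structures.
Require Import Defs.
From mathcomp Require Import all_boot all_order all_algebra.
From mathcomp Require Import generic_quotient zify ring.
From mathcomp Require Import boolp.
From mathcomp Require Import mpoly.

Set Implicit Arguments.
Unset Strict Implicit.
Unset Printing Implicit Defensive.

Import GRing.Theory.
Local Open Scope ring_scope.

(** Let [B] be the cover. With [x / z ^ 3] and [y / z ^ 2] as coordinates its
    equation says that [W ^ n / z ^ 9] is minus the dehomogenization of [f]. As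
    [n] is prime to [9], both [z] and [W] become monomials in that polynomial and
    one new variable [U], which embeds [B] into a polynomial ring with the same
    localization at [z * W]. Hence [B] is rational ([cover_rational]). As [z] does
    not divide [f], both [z] and [W] are prime in [B], and Nagata's criterion makes
    [B] factorial ([cover_factorial]). The degree in [U] grades [B], and its
    homogeneous elements are the [r * W ^ i] with [r] homogeneous
    ([cover_homog]).

    For rigidity ([cover_lnd_eq0]), let [D] be a nonzero locally nilpotent
    derivation of [B]. Its highest component is again one ([top_derivation]), so
    [D] may be taken homogeneous. The degree of an element determines its exponent
    of [W], so [D r = W ^ i0 * der r] for all polynomials [r], with a fixed [i0]
    and a nonzero homogeneous locally nilpotent derivation [der] of [k[x,y,z]]
    ([lnd_restrict]). If [D W = 0] then [der f = 0]. Otherwise a homogeneous local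
    slice must be a multiple of [W], so that [W] has degree [1] for [D] and [f]
    has degree [n]; moreover [i0 = n - 1], which leaves degree [0] for [der f]. In
    all cases [der (der f) = 0] ([restriction_f]).

    This cannot happen when [Proj (R / f R)] has two singular points
    ([no_derivation_of_small_degree]). Write [D] for [der] now. A dimension count
    gives two independent kernel elements of the same degree ([kernel_pair]),
    whereas modulo a homogeneous prime element [H] of the kernel only one kernel
    function remains ([quot_kernel_line]), once the factors [H] of [D] have been
    removed ([divide_derivation]). Thus the curve [H = 0] without the zeros of a
    kernel element [h] is an affine line: division with remainder by means of a
    local slice shows that its points are regular ([regular_off_kernel]), and the
    quotient of the degree for [D] by the weighted degree shows that only one point
    is missing ([prime_over_unique]).

    If [D f = 0], this applies with [H = f]: the singular points of the curve are
    all at infinity, hence equal. If [D f <> 0], then [f] is itself a local slice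
    and every function on the curve is a quotient of kernel elements. At a point
    where some kernel element of positive degree does not vanish, the kernel
    elements that vanish are the multiples of a single prime, which is therefore a
    uniformizer up to powers and units ([singular_kernel]). So all kernel elements
    of positive degree vanish at the singular points; two coprime ones have only
    one common zero, again by [prime_over_unique] on the curve defined by a prime
    factor of one of them.

    Factoriality of [k[x,y,z]] is Gauss's lemma ([poly_factorial]); finiteness of
    factorizations always comes from a degree ([additive_norm]). *)

(** * Domains, divisibility and factoriality *)

Section Divisibility.
Variable A : comNzRingType.
Implicit Types a b c p x y : A.

Definition dvd a b := exists c, b = a * c.

Definition prime_elt p :=
  [/\ p != 0, ~ invertible p &
      forall a b, dvd p (a * b) -> dvd p a \/ dvd p b].

(** All finiteness arguments run through such a norm, which will be a degree. *)
Definition additive_norm (nu : A -> nat) :=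
  (forall a b, a != 0 -> b != 0 -> nu (a * b) = (nu a + nu b)%N) /\
  (forall a, a != 0 -> nu a = 0%N -> invertible a).

Definition factorial_domain :=
  [/\ is_domain A, exists nu, additive_norm nu
    & forall p, irreducible_elt p -> prime_elt p].

Lemma dvd_refl a : dvd a a. Proof. by exists 1; rewrite mulr1. Qed.
Lemma dvd0 a : dvd a 0. Proof. by exists 0; rewrite mulr0. Qed.
Lemma dvd_mulr a b c : dvd a b -> dvd a (b * c).
Proof. by case=> d ->; exists (d * c); rewrite mulrA. Qed.
Lemma dvd_mull a b c : dvd a b -> dvd a (c * b).
Proof. by rewrite mulrC; apply: dvd_mulr. Qed.
Lemma dvd_add a b c : dvd a b -> dvd a c -> dvd a (b + c).
Proof. by case=> d -> [e ->]; exists (d + e); rewrite mulrDr. Qed.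
Lemma dvd_opp a b : dvd a b -> dvd a (- b).
Proof. by case=> d ->; exists (- d); rewrite mulrN. Qed.
Lemma dvd_sub a b c : dvd a b -> dvd a c -> dvd a (b - c).
Proof. by move=> ab ac; apply: dvd_add => //; apply: dvd_opp. Qed.
Lemma dvd_trans a b c : dvd a b -> dvd b c -> dvd a c.
Proof. by case=> d -> [e ->]; exists (d * e); rewrite mulrA. Qed.
Lemma dvd_sum (I : Type) (r : seq I) (P : pred I) a (F : I -> A) :
  (forall i, P i -> dvd a (F i)) -> dvd a (\sum_(i <- r | P i) F i).
Proof. by move=> h; elim/big_rec: _ => [|i x Pi]; [exact: dvd0 | apply/dvd_add/h]. Qed.

Lemma invertible1 : invertible (1 : A). Proof. by exists 1; rewrite mulr1. Qed.
Lemma invertibleM a b : invertible a -> invertible b -> invertible (a * b).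
Proof. by case=> c ac [d bd]; exists (c * d); rewrite mulrACA ac bd mulr1. Qed.
Lemma invertible_mull a b : invertible (a * b) -> invertible a.
Proof. by case=> c e; exists (b * c); rewrite mulrA. Qed.
Lemma invertible_mulr a b : invertible (a * b) -> invertible b.
Proof. by rewrite mulrC; apply: invertible_mull. Qed.
Lemma invertible_neq0 a : invertible a -> a != 0.
Proof.
by case=> c e; apply/eqP => a0; move/eqP: e; rewrite a0 mul0r eq_sym oner_eq0.
Qed.
Hypothesis dom : is_domain A.

Lemma dom_mul_neq0 a b : a != 0 -> b != 0 -> a * b != 0.
Proof.
move=> a0 b0; apply/eqP => /dom[] e; first by rewrite e eqxx in a0.
by rewrite e eqxx in b0.
Qed.

Lemma dom_mulI a b c : a != 0 -> a * b = a * c -> b = c.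
Proof.
move=> a0 e; have : a * (b - c) = 0 by rewrite mulrBr e subrr.
by case/dom => [z|/eqP]; [rewrite z eqxx in a0 | rewrite subr_eq0 => /eqP].
Qed.

Lemma dom_exp_neq0 a n : a != 0 -> a ^+ n != 0.
Proof.
move=> a0; elim: n => [|n IHn]; first by rewrite expr0 oner_neq0.
by rewrite exprS dom_mul_neq0.
Qed.

Lemma prime_dvd_exp p a n : prime_elt p -> dvd p (a ^+ n) -> dvd p a.
Proof.
move=> [p0 pu pP]; elim: n => [|n IHn]; last by rewrite exprS => /pP[].
by rewrite expr0 => -[c e]; case: pu; exists c.
Qed.

Lemma prime_dvd_prod p s : prime_elt p -> dvd p (\prod_(x <- s) x) ->
  exists2 x, x \in s & dvd p x.
Proof.
move=> [p0 pu pP]; elim: s => [|x s IHs].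
  by rewrite big_nil => -[c e]; case: pu; exists c.
rewrite big_cons => /pP[px|/IHs[y ys py]]; first by exists x; rewrite ?mem_head.
by exists y; rewrite // inE ys orbT.
Qed.

Lemma dvd_irreducible p q : ~ invertible p -> irreducible_elt q -> dvd p q ->
  associated p q.
Proof.
move=> pu [_ _ qi] [c e]; have [//|cu] := qi _ _ e.
by exists c => //; rewrite mulrC.
Qed.

Section Norm.
Variable nu : A -> nat.
Hypothesis nuP : additive_norm nu.

Lemma norm_gt0 a : a != 0 -> ~ invertible a -> (0 < nu a)%N.
Proof. by move=> a0 au; rewrite lt0n; apply/eqP => /(nuP.2 _ a0). Qed.

Lemma norm_irreducible_dvd x : x != 0 -> ~ invertible x ->
  exists2 p, irreducible_elt p & dvd p x.
Proof.
have [n] := ubnP (nu x); elim: n x => // n IHn x; rewrite ltnS => xn x0 xu.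
have [xi|] := pselect (irreducible_elt x); first by exists x => //; apply: dvd_refl.
move=> nxi; have [[y z] [xyz yu zu]] : exists yz,
    [/\ x = yz.1 * yz.2, ~ invertible yz.1 & ~ invertible yz.2].
  apply/not_existsP => h; apply: nxi; split=> //; first exact/eqP.
  move=> y z e; apply/or_asboolP/negPn/negP; rewrite negb_or.
  by move=> /andP[/asboolPn yu /asboolPn zu]; apply: (h (y, z)).
move: xyz yu zu => /= xyz yu zu.
have y0 : y != 0 by apply: contraNneq x0 => e; rewrite xyz e mul0r.
have z0 : z != 0 by apply: contraNneq x0 => e; rewrite xyz e mulr0.
have [||//|p pi py] := IHn y; last by exists p => //; rewrite xyz; apply: dvd_mulr.
  by apply: leq_trans xn; rewrite xyz nuP.1 // -addn1 leq_add2l norm_gt0.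
by [].
Qed.

Lemma norm_factorization x : x != 0 -> exists u s,
  [/\ invertible u, forall y, y \in s -> irreducible_elt y
    & x = u * \prod_(y <- s) y].
Proof.
have [n] := ubnP (nu x); elim: n x => // n IHn x; rewrite ltnS => xn x0.
have [xu|xu] := pselect (invertible x).
  by exists x, [::]; split=> //; rewrite big_nil mulr1.
have [p pi [c xc]] := norm_irreducible_dvd x0 xu.
have p0 : p != 0 by case: pi => /eqP.
have pu : ~ invertible p by case: pi.
have c0 : c != 0 by apply: contraNneq x0 => e; rewrite xc e mulr0.
have [|//|u [s [uu si cs]]] := IHn c.
  by apply: leq_trans xn; rewrite xc nuP.1 // -add1n leq_add2r norm_gt0.
exists u, (p :: s); split=> //; first by move=> y; rewrite inE => /predU1P[->|/si].
by rewrite big_cons xc cs; ring.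
Qed.

Lemma norm_valuation p a : ~ invertible p -> p != 0 -> a != 0 ->
  exists m b, a = p ^+ m * b /\ ~ dvd p b.
Proof.
move=> pu p0; have [n] := ubnP (nu a); elim: n a => // n IHn a.
rewrite ltnS => an a0; have [[b e]|] := pselect (dvd p a); last first.
  by exists 0%N, a; rewrite expr0 mul1r.
have b0 : b != 0 by apply: contraNneq a0 => z; rewrite e z mulr0.
have [||m [c [bc pc]]] := IHn b => //.
  by apply: leq_trans an; rewrite e nuP.1 // -add1n leq_add2r norm_gt0.
by exists m.+1, c; rewrite e bc exprS mulrA.
Qed.

End Norm.

End Divisibility.

(** Once irreducible elements are prime, two factorizations are matched one
    factor at a time; the induction must allow a unit between the products. *)
Lemma factorial_is_ufd (A : comNzRingType) : factorial_domain A -> is_ufd A.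
Proof.
move=> [dom [nu nuP] ip]; split=> // [x /eqP x0 xu|s t].
  have [u [[|y s] [uu si e]]] := norm_factorization nuP x0.
    by case: xu; rewrite e big_nil mulr1.
  exists (u * y :: s); last by rewrite big_cons e big_cons mulrA.
  move=> z; rewrite inE => /predU1P[->|zs]; last by apply: si; rewrite inE zs orbT.
  have [y0 yu yP] := si y (mem_head _ _); have u0 := invertible_neq0 uu.
  split; first by apply/eqP/dom_mul_neq0 => //; apply/eqP.
    by move/invertible_mulr.
  case: uu => v uv w w' e'; have /yP[] : y = (v * w) * w'.
    by rewrite -mulrA -e' mulrA (mulrC v) uv mul1r.
  - by move/invertible_mulr; left.
  - by right.
move=> si ti est; have {est} : exists2 u, invertible u &
    \prod_(y <- s) y = u * \prod_(y <- t) y.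
  by exists 1; rewrite ?mul1r //; apply: invertible1.
elim: s t si ti => [|p s IHs] t si ti [u uu].
  rewrite big_nil; case: t ti => [|q t] ti; first by exists [::].
  rewrite big_cons mulrCA => e; have [_ qu _] := ti q (mem_head _ _).
  by case: qu; exists (u * \prod_(y <- t) y); rewrite -e.
have pi := si p (mem_head _ _); have pp := ip _ pi.
have [p0 pu _] := pp; rewrite big_cons => e.
have pt : dvd p (\prod_(y <- t) y).
  case: uu => v uv; exists (v * \prod_(y <- s) y).
  by rewrite mulrCA e mulrA (mulrC v) uv mul1r.
have [q qt pq] := prime_dvd_prod pp pt.
have [w wu qw] := dvd_irreducible pu (ti _ qt) pq.
have tq := perm_to_rem qt.
have [|||t' [t't st' at']] := IHs (rem q t).
- by move=> y ys; apply: si; rewrite inE ys orbT.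
- by move=> y /mem_rem; apply: ti.
- exists (u * w); first exact: invertibleM.
  apply: (dom_mulI dom p0); rewrite e (perm_big _ tq) big_cons {1}qw /=; ring.
exists (q :: t'); split.
- by rewrite (perm_trans tq) // perm_cons.
- by rewrite /= st'.
- by case=> [_|i]; [exists w | rewrite /= ltnS; apply: at'].
Qed.

(** For passing from univariate polynomials with polynomial coefficients to
    polynomials in one more variable. *)
Lemma factorial_transfer (A B : comNzRingType) (f : {rmorphism A -> B})
    (g : {rmorphism B -> A}) :
  cancel f g -> cancel g f -> factorial_domain A -> factorial_domain B.
Proof.
move=> fK gK [dom [nu nuP] ip].
have fI := can_inj fK; have gI := can_inj gK.
have g0 b : (g b != 0) = (b != 0) by rewrite -(inj_eq gI) rmorph0.
have gu b : invertible (g b) -> invertible b.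
  by case=> c e; exists (f c); rewrite -[b]gK -rmorphM e rmorph1.
have fu a : invertible a -> invertible (f a).
  by case=> c e; exists (f c); rewrite -rmorphM e rmorph1.
split.
- move=> x y e; have /dom[] : g x * g y = 0 by rewrite -rmorphM e rmorph0.
    by move=> h; left; apply: gI; rewrite rmorph0.
  by move=> h; right; apply: gI; rewrite rmorph0.
- exists (nu \o g); split=> [a b a0 b0|a a0 /= h] /=.
    by rewrite rmorphM nuP.1 ?g0.
  by apply/gu/nuP.2; rewrite ?g0.
- move=> p [/eqP p0 pu pi]; have /ip[_ _ gp] : irreducible_elt (g p).
    split; [by apply/eqP; rewrite g0 | by move/gu | move=> y z e].
    have /pi[] : p = f y * f z by rewrite -rmorphM -e gK.
      by case=> c h; left; exists (g c); apply: fI; rewrite rmorphM gK h rmorph1.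
    by case=> c h; right; exists (g c); apply: fI; rewrite rmorphM gK h rmorph1.
  split=> // a b [c e]; have /gp[] : dvd (g p) (g a * g b).
  + by exists (g c); rewrite -!rmorphM e.
  + by case=> d h; left; exists (f d); rewrite -[a]gK h rmorphM gK.
  + by case=> d h; right; exists (f d); rewrite -[b]gK h rmorphM gK.
Qed.

(** * Polynomial rings are factorial *)

Section PolyFactorial.
Variable A : idomainType.
Implicit Types (c p : A) (F G H : {poly A}).

Lemma idomain_is_domain : is_domain A.
Proof. by move=> x y /eqP; rewrite mulf_eq0 => /orP[] /eqP; [left|right]. Qed.

Lemma dvd_polyC c F : dvd c%:P F <-> forall i, dvd c F`_i.
Proof.
split=> [[G ->] i|h]; first by exists G`_i; rewrite coefCM.
have [g gP] := choice h; exists (\poly_(i < size F) g i).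
apply/polyP => i; rewrite coefCM coef_poly; case: ltnP => // Fi.
by rewrite mulr0 nth_default.
Qed.

(** Gauss: at the first coefficients not divisible by [p] in each factor, the
    convolution has exactly one term not divisible by [p]. *)
Lemma prime_polyC p : prime_elt p -> prime_elt p%:P.
Proof.
move=> [p0 pu pP]; split; first by rewrite polyC_eq0.
  case=> G /(congr1 (fun F : {poly A} => F`_0)).
  by rewrite coefCM coef1 => e; apply: pu; exists G`_0.
move=> F G /dvd_polyC FG.
have [pF|pF] := pselect (dvd p%:P F); first by left.
have [pG|pG] := pselect (dvd p%:P G); first by right.
have first_coef H : ~ dvd p%:P H ->
    exists2 i, ~ dvd p H`_i & forall j, (j < i)%N -> dvd p H`_j.
  move=> pH; have ex : exists i, `[< ~ dvd p H`_i >].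
    apply/not_existsP => h; apply: pH; apply/dvd_polyC => i.
    by apply: contrapT => pi; apply: (h i); apply/asboolP.
  case: (ex_minnP ex) => i /asboolP pi imin; exists i => // j ji.
  by apply: contrapT => pj; move: ji; rewrite ltnNge imin //; apply/asboolP.
have [i pi imin] := first_coef _ pF; have [j pj jmin] := first_coef _ pG.
have := FG (i + j)%N; have ij : (i < (i + j).+1)%N by rewrite ltnS leq_addr.
rewrite coefM (bigD1 (Ordinal ij)) //= addKn => h.
have : dvd p (F`_i * G`_j).
  rewrite -[X in dvd _ X](addrK (\sum_(l < (i + j).+1 | l != Ordinal ij)
    F`_l * G`_(i + j - l))); apply: dvd_sub => //.
  apply: dvd_sum => l; rewrite -val_eqE /= => li.
  have [lt|ge] := ltnP l i; first exact/dvd_mulr/imin.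
  by apply/dvd_mull/jmin; have := ltn_ord l; lia.
by case/pP.
Qed.

Hypothesis factA : factorial_domain A.

(** Clearing denominators without changing degrees: the prime factors of [c]
    are cancelled one at a time, each being prime in the polynomial ring. *)
Lemma clear_denominator c F G H : c != 0 -> c%:P * F = G * H ->
  exists a b G' H', [/\ G = a%:P * G', H = b%:P * H' & F = G' * H'].
Proof.
have [dom [nu nuP] ip] := factA; have [n] := ubnP (nu c).
elim: n c F G H => // n IHn c F G H; rewrite ltnS => cn c0 e.
have [[d cd]|cu] := pselect (invertible c).
  exists 1, c, G, (d%:P * H); rewrite polyC1 mul1r mulrA -polyCM cd polyC1 mul1r.
  by split=> //; rewrite mulrCA -e mulrA -polyCM mulrC (mulrC d) cd mulr1.
have [p pi [c' cc']] := norm_irreducible_dvd nuP c0 cu.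
have [p0 pu _] := ip _ pi; have [_ _ pP] := prime_polyC (ip _ pi).
have pP0 : p%:P != 0 by rewrite polyC_eq0.
have c'0 : c' != 0 by apply: contraNneq c0 => z; rewrite cc' z mulr0.
have lt : (nu c' < n)%N.
  by apply: leq_trans cn; rewrite cc' nuP.1 // -add1n leq_add2r (norm_gt0 nuP).
have /pP[] : dvd p%:P (G * H).
- by exists (c'%:P * F); rewrite -e cc' polyCM mulrA.
- case=> G1 eG; have [|a [b [G' [H' [eG1 eH eF]]]]] := IHn c' F G1 H lt c'0.
    by apply: (mulfI pP0); rewrite mulrA -polyCM -cc' e eG mulrA.
  by exists (p * a), b, G', H'; rewrite eG eG1 polyCM mulrA.
- case=> H1 eH; have [|a [b [G' [H' [eG eH1 eF]]]]] := IHn c' F G H1 lt c'0.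
    by apply: (mulfI pP0); rewrite mulrA -polyCM -cc' e eH; ring.
  by exists a, (p * b), G', H'; rewrite eH eH1 polyCM mulrA.
Qed.

Lemma size_polyCMl c F : c != 0 -> size (c%:P * F) = size F.
Proof. by move=> c0; rewrite mul_polyC size_scale. Qed.

Lemma invertible_size1 F : invertible F -> size F = 1%N.
Proof.
case=> G e; have FG : F * G != 0 by rewrite e oner_eq0.
have /norP[F0 G0] : ~~ ((F == 0) || (G == 0)) by rewrite -mulf_eq0.
have := size_mul F0 G0; rewrite e size_poly1.
by move: F0 G0; rewrite -!size_poly_gt0; set a := size F; set b := size G; lia.
Qed.

(** An irreducible [F] of positive degree has no nontrivial pseudo-divisor, since
    [clear_denominator] would turn it into a divisor; hence a gcd with [F] is
    constant or associated to [F]. *)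
Lemma poly_factorial : factorial_domain {poly A}.
Proof.
have [dom [nu nuP] ip] := factA; split.
- by move=> x y /eqP; rewrite mulf_eq0 => /orP[] /eqP; [left|right].
(* the degree alone would not see the constant factors *)
- exists (fun F => ((size F).-1 + nu (lead_coef F))%N); split=> [F G F0 G0|F F0].
    rewrite size_mul // lead_coefM nuP.1 ?lead_coef_eq0 //.
    move: F0 G0; rewrite -!size_poly_gt0; set a := size F; set b := size G.
    set c := nu _; set d := nu _; clearbody a b c d.
    by case: a => // a; case: b => // b _ _; rewrite addSn addnS /= addnACA.
  move/eqP; rewrite addn_eq0 => /andP[/eqP sF /eqP nF].
  have /size1_polyC e : (size F <= 1)%N by move: sF; case: (size F) => [|[]].
  case: (nuP.2 (lead_coef F)); rewrite ?lead_coef_eq0 // => d.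
  by rewrite e lead_coefC => cd; exists d%:P; rewrite -polyCM cd.
move=> F [/eqP F0 Fu Fi].
have [sF|sF] := leqP (size F) 1.
  have e := size1_polyC sF; rewrite e; apply: prime_polyC; apply: ip; split.
  - by apply/eqP; rewrite -polyC_eq0 -e.
  - by case=> d cd; apply: Fu; exists d%:P; rewrite e -polyCM cd.
  - move=> y z yz; have : F = y%:P * z%:P by rewrite -polyCM -yz.
    have inv c : invertible c%:P -> invertible c.
      case=> G /(congr1 (fun P : {poly A} => P`_0)).
      by rewrite coefCM coef1 => h; exists G`_0.
    by case/Fi => /inv; [left|right].
have dvdF G : F %| G -> dvd F G.
  move=> /Pdiv.Idomain.dvdpP[[c r] /= c0 e].
  have [|a [b [r' [F' [er eF eG]]]]] := @clear_denominator c G r F c0.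
    by rewrite mul_polyC.
  have b0 : b != 0 by apply: contraNneq F0 => z; rewrite eF z mul0r.
  case: (Fi _ _ eF) => [[d bd]|F'u]; last first.
    have := size_polyCMl F' b0; rewrite -eF (invertible_size1 F'u) => h.
    by rewrite h in sF.
  by exists (d * r'); rewrite eG eF; transitivity (r' * F' * (b%:P * d));
    [rewrite bd mulr1 | ring].
have irrF : irreducible_poly F.
  split=> // q sq /Pdiv.Idomain.dvdpP[[c r] /= c0 e].
  have [|a [b [r' [q' [er eq eF]]]]] := @clear_denominator c F r q c0.
    by rewrite mul_polyC.
  have F0' : r' * q' != 0 by rewrite -eF.
  have b0 : b != 0.
    apply: contra_neq F0 => z.
    have : c%:P * F = 0 by rewrite mul_polyC e eq z polyC0 mul0r mulr0.
    by move/eqP; rewrite mulf_eq0 polyC_eq0 (negbTE c0) => /eqP.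
  have sq' : size q = size q' by rewrite eq size_polyCMl.
  have q0' : q' != 0 by apply: contraNneq F0' => ->; rewrite mulr0.
  rewrite eq mul_polyC (eqp_trans (eqp_scale _ b0)) //.
  case: (Fi _ _ eF) => [r'u|q'u]; last by rewrite sq' (invertible_size1 q'u) in sq.
  have /eqP/size_poly1P[d d0 er'] := invertible_size1 r'u.
  by rewrite eF er' mul_polyC eqp_sym eqp_scale.
split=> // G H [C e].
have FGH : F %| G * H by rewrite e dvdp_mulr.
have [FG|nFG] := boolP (F %| G); first by left; apply: dvdF.
right; apply: dvdF; suff cFG : coprimep F G by rewrite -(Gauss_dvdpr _ cFG).
apply: contraNT nFG; rewrite coprimep_def => sg.
by rewrite -(eqp_dvdl _ (irrF _ sg (dvdp_gcdl _ _))) dvdp_gcdr.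
Qed.

End PolyFactorial.

Section MpolyFactorial.
Variable k : fieldType.

Lemma mpoly_rmorph_ext (A : pzRingType) n (f g : {rmorphism {mpoly k[n]} -> A}) :
  (forall c, f c%:MP = g c%:MP) -> (forall i, f 'X_i = g 'X_i) -> f =1 g.
Proof.
move=> fgC fgX p; rewrite (mpolyE p) !rmorph_sum; apply: eq_bigr => m _ /=.
rewrite -mul_mpolyC !rmorphM /= fgC; congr (_ * _).
by rewrite mpolyXE_id !rmorph_prod; apply: eq_bigr => i _; rewrite !rmorphXn fgX.
Qed.

Lemma mpoly_subring_ind n (T : {mpoly k[n]} -> Prop) :
  (forall c, T c%:MP) -> (forall i, T 'X_i) ->
  (forall p q, T p -> T q -> T (p + q)) -> (forall p q, T p -> T q -> T (p * q)) ->
  forall p, T p.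
Proof.
move=> TC TX TD TM p; rewrite (mpolyE p).
elim/big_rec: _ => [|m q _ Tq]; first by rewrite -(mpolyC0 n).
apply: TD Tq; rewrite -mul_mpolyC; apply: (TM) => //; rewrite mpolyXE_id.
elim/big_rec: _ => [|i q' _ Tq']; first exact: TC.
apply: (TM) Tq'; elim: (m i) => [|e IHe]; first by rewrite expr0; apply: TC.
by rewrite exprS; apply: TM.
Qed.

Let widen n := widen_ord (leqnSn n).

Lemma muni_XU_widen n (i : 'I_n) : muni ('X_(widen i) : {mpoly k[n.+1]}) = ('X_i)%:P.
Proof.
rewrite muniE msuppX big_seq1 mcoeffX eqxx scale1r /= mnm1E.
have -> : (widen i == ord_max) = false.
  by apply/negbTE; rewrite -val_eqE /= ltn_eqF.
rewrite expr0 alg_polyC; congr ('X_[_])%:P.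
by apply/mnmP => j; rewrite mnmE !mnm1E -!val_eqE.
Qed.

Lemma muni_XU_max n : muni ('X_ord_max : {mpoly k[n.+1]}) = 'X.
Proof.
rewrite muniE msuppX big_seq1 mcoeffX eqxx scale1r /= mnm1E eqxx expr1.
rewrite (_ : [multinom _ | i < n] = 0%MM) ?mpolyX0 ?scale1r //.
apply/mnmP => i; rewrite mnmE mnm1E mnm0E.
by apply/eqP; rewrite eqb0 -val_eqE /= eq_sym ltn_eqF.
Qed.

Lemma mwiden_XU n (i : 'I_n) : mwiden ('X_i : {mpoly k[n]}) = 'X_(widen i).
Proof. by rewrite mwidenX mnmwiden1. Qed.

Definition multi n : {poly {mpoly k[n]}} -> {mpoly k[n.+1]} :=
  horner_eval 'X_ord_max \o @mpwiden n k.
HB.instance Definition _ n := GRing.RMorphism.on (@multi n).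

Lemma muniK n : cancel (@muni n k) (@multi n).
Proof.
apply: (@mpoly_rmorph_ext _ _ (@multi n \o @muni n k) idfun) => [c|i] /=.
  by rewrite muniC /multi /= mpwidenC /horner_eval hornerC mwidenC.
rewrite /multi /=; case: (unliftP ord_max i) => [j|] ->; last first.
  by rewrite muni_XU_max mpwidenX /horner_eval hornerX.
have -> : lift ord_max j = widen j by apply: val_inj; rewrite /= /bump leqNgt ltn_ord.
by rewrite muni_XU_widen mpwidenC /horner_eval hornerC mwiden_XU.
Qed.

Lemma multiK n : cancel (@multi n) (@muni n k).
Proof.
have muniw (p : {mpoly k[n]}) : muni (mwiden p) = p%:P.
  apply: (@mpoly_rmorph_ext _ _ (@muni n k \o @mwiden n k) polyC) => [c|i] /=.
    by rewrite mwidenC muniC.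
  by rewrite mwiden_XU muni_XU_widen.
move=> p; elim/poly_ind: p => [|p c IHp]; first by rewrite !rmorph0.
rewrite !rmorphD !rmorphM /= IHp; congr (_ * _ + _).
  by rewrite /multi /= mpwidenX /horner_eval hornerX muni_XU_max.
by rewrite /multi /= mpwidenC /horner_eval hornerC muniw.
Qed.

Lemma mpoly_factorial n : factorial_domain {mpoly k[n]}.
Proof.
elim: n => [|n IHn]; last exact: factorial_transfer (@multiK n) (@muniK n) (poly_factorial IHn).
have unit (p : {mpoly k[0]}) : p != 0 -> invertible p.
  rewrite [p]nvar0_mpolyC mpolyC_eq0 => c0.
  by exists ((p@_0)^-1)%:MP; rewrite -mpolyCM divff.
split; first exact: idomain_is_domain.
- by exists (fun _ => 0%N); split=> // a a0 _; apply: unit.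
- by move=> p [/eqP p0 pu]; case: pu; apply: unit.
Qed.

End MpolyFactorial.

(** * Graded domains *)

Section GradedRing.
Variables (A : comNzRingType) (G : grading A).
Implicit Types (a b c : A) (d e m n : nat).

Lemma gpiece_sum d (I : Type) (r : seq I) (P : pred I) (F : I -> A) :
  (forall i, P i -> G d (F i)) -> G d (\sum_(i <- r | P i) F i).
Proof.
by move=> h; elim/big_rec: _ => [|i x Pi]; [exact: gpiece0 | apply/gpieceD/h].
Qed.

Lemma gpieceX d a n : G d a -> G (d * n)%N (a ^+ n).
Proof.
move=> Ga; elim: n => [|n IHn]; first by rewrite muln0 expr0; apply: gpiece1.
by rewrite exprS mulnS; apply: gpieceM.
Qed.

Lemma decomposition a : exists c : nat -> A, (forall i, G i (c i)) /\
  exists n, (forall i, (n <= i)%N -> c i = 0) /\ a = \sum_(i < n) c i.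
Proof.
have [n [c [cP ->]]] := gpiece_span G a.
exists (fun i => if (i < n)%N then c i else 0); split=> [i|].
  by case: ifP => _; [apply: cP | apply: gpiece0].
exists n; split=> [i ni|]; first by rewrite ltnNge ni.
by apply: eq_bigr => i _; rewrite ltn_ord.
Qed.

(** By [comp_unique] the components do not depend on this choice. *)
Definition comp a : nat -> A := projT1 (cid (decomposition a)).

Lemma comp_gpiece a d : G d (comp a d).
Proof. by rewrite /comp; case: cid => c []. Qed.

Lemma sum_widen (c : nat -> A) n m : (n <= m)%N ->
  (forall i, (n <= i)%N -> c i = 0) -> \sum_(i < n) c i = \sum_(i < m) c i.
Proof.
move=> nm c0; rewrite -(subnKC nm) big_split_ord /= [X in _ + X]big1 ?addr0 // => i _.
by rewrite c0 // leq_addr.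
Qed.

Lemma comp_bound a : exists n, forall m, (n <= m)%N ->
  comp a m = 0 /\ a = \sum_(i < m) comp a i.
Proof.
rewrite /comp; case: cid => c /= [cP [n [c0 e]]]; exists n => m nm.
by split; [apply: c0 | rewrite {1}e; apply: sum_widen].
Qed.

Lemma comp_unique a (c : nat -> A) n : (forall i, G i (c i)) ->
  (forall i, (n <= i)%N -> c i = 0) -> a = \sum_(i < n) c i ->
  forall d, comp a d = c d.
Proof.
move=> cP c0 e d; have [n' h] := comp_bound a.
pose m := (maxn d.+1 (maxn n n')).
have [_ e'] : comp a m = 0 /\ a = \sum_(i < m) comp a i by apply: h; rewrite /m; lia.
have /gpiece_direct z : forall i, G i (comp a i - c i).
  by move=> i; apply: gpieceB => //; apply: comp_gpiece.
apply/eqP; rewrite -subr_eq0; apply/eqP; apply: (z m); last by rewrite /m; lia.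
rewrite sumrB -e' e (@sum_widen c n m) ?subrr //; rewrite /m; lia.
Qed.

Lemma comp_homog d a e : G d a -> comp a e = if e == d then a else 0.
Proof.
move=> Ga; apply: (@comp_unique _ (fun e => if e == d then a else 0) d.+1).
- by move=> i; case: eqP => [->|_] //; apply: gpiece0.
- by move=> i id; rewrite gtn_eqF.
- rewrite big_ord_recr /= eqxx big1 ?add0r // => i _.
  by rewrite ltn_eqF.
Qed.

Lemma comp_gpieceE d a : G d a -> comp a d = a.
Proof. by move/(comp_homog d) ->; rewrite eqxx. Qed.

Lemma compB a b d : comp (a - b) d = comp a d - comp b d.
Proof.
have [n h] := comp_bound a; have [n' h'] := comp_bound b.
apply: (@comp_unique _ (fun d => comp a d - comp b d) (maxn n n')).
- by move=> i; apply: gpieceB; apply: comp_gpiece.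
- by move=> i ni; rewrite (h i _).1 ?(h' i _).1 ?subrr //; lia.
- by rewrite sumrB -(h _ _).2 ?leq_maxl // -(h' _ _).2 ?leq_maxr.
Qed.

Lemma comp0 d : comp 0 d = 0.
Proof. by rewrite (comp_homog _ (gpiece0 G 0%N)); case: ifP. Qed.

Lemma compD a b d : comp (a + b) d = comp a d + comp b d.
Proof.
have -> : a + b = a - (0 - b) by rewrite sub0r opprK.
by rewrite !compB comp0 sub0r opprK.
Qed.

Lemma comp_sum (I : Type) (r : seq I) (P : pred I) (F : I -> A) d :
  comp (\sum_(i <- r | P i) F i) d = \sum_(i <- r | P i) comp (F i) d.
Proof. by elim/big_rec2: _ => [|i x y _ <-]; rewrite ?comp0 ?compD. Qed.

Lemma comp_eq0 a : (forall d, comp a d = 0) -> a = 0.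
Proof.
by move=> h; have [n /(_ n (leqnn n))[_ ->]] := comp_bound a; rewrite big1.
Qed.

Lemma comp_eq a b : (forall d, comp a d = comp b d) -> a = b.
Proof.
by move=> h; apply/eqP; rewrite -subr_eq0; apply/eqP/comp_eq0 => d;
  rewrite compB h subrr.
Qed.

Lemma gpieceP d a : (forall e, e != d -> comp a e = 0) -> G d a.
Proof.
move=> h; suff -> : a = comp a d by apply: comp_gpiece.
apply: comp_eq => e; rewrite (comp_homog _ (comp_gpiece a d)).
by case: eqP => [->|/eqP /h].
Qed.

Lemma comp_homogM d a b e : G d a ->
  comp (a * b) e = if (d <= e)%N then a * comp b (e - d) else 0.
Proof.
move=> Ga; have [n h] := comp_bound b.
have [_ eb] := h _ (leq_maxr e.+1 n); rewrite {1}eb mulr_sumr comp_sum.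
have E (i : 'I_(maxn e.+1 n)) : comp (a * comp b i) e =
    if (d + i)%N == e then a * comp b i else 0.
  by rewrite (comp_homog _ (gpieceM Ga (comp_gpiece b i))) eq_sym.
rewrite (eq_bigr _ (fun i _ => E i)) -big_mkcond /=.
case: leqP => de; last by rewrite big1 // => i /eqP; lia.
have lt : (e - d < maxn e.+1 n)%N by lia.
rewrite (bigD1 (Ordinal lt)) /= ?subnKC // big1 ?addr0 // => i /andP[/eqP ie].
by rewrite -val_eqE /= => /eqP; lia.
Qed.

Lemma comp_mul a b d : comp (a * b) d = \sum_(i < d.+1) comp a i * comp b (d - i).
Proof.
have [n h] := comp_bound a.
have [_ ea] := h _ (leq_maxr d.+1 n); rewrite {1}ea mulr_suml comp_sum.
rewrite (eq_bigr (fun i : 'I__ => if (i < d.+1)%N then comp a i * comp b (d - i) else 0)).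
  by rewrite -big_mkcond /= (big_ord_widen _ (fun i => comp a i * comp b (d - i)) (leq_maxl d.+1 n)).
by move=> i _; rewrite (comp_homogM _ _ (comp_gpiece a i)) ltnS.
Qed.

Definition top a d := comp a d != 0 /\ forall e, (d < e)%N -> comp a e = 0.
Definition bottom a d := comp a d != 0 /\ forall e, (e < d)%N -> comp a e = 0.

Lemma last_comp (P : A -> Prop) a : P 0 -> (exists d, ~ P (comp a d)) ->
  exists d, ~ P (comp a d) /\ forall e, (d < e)%N -> P (comp a e).
Proof.
move=> P0 [d0 Pd0]; have [n h] := comp_bound a.
have ex : exists d, `[< ~ P (comp a d) >] by exists d0; apply/asboolP.
have ub d : `[< ~ P (comp a d) >] -> (d <= n)%N.
  move=> /asboolP Pd; rewrite leqNgt; apply/negP => /ltnW /h[e _].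
  by apply: Pd; rewrite e.
case: (ex_maxnP ex ub) => d /asboolP Pd dmax; exists d; split=> // e de.
by apply: contrapT => Pe; move: de; rewrite ltnNge dmax //; apply/asboolP.
Qed.

Lemma top_exists a : a != 0 -> exists d, top a d.
Proof.
move=> a0; have [|d [/eqP ad dmax]] := @last_comp (fun c => c = 0) a erefl.
  by apply/not_existsP => h; move/eqP: a0; apply; apply: comp_eq0 => d;
    apply: contrapT; apply: h.
by exists d.
Qed.

Lemma bottom_exists a : a != 0 -> exists d, bottom a d.
Proof.
move=> a0; have ex : exists d, comp a d != 0.
  apply/not_existsP => h; move/eqP: a0; apply; apply: comp_eq0 => d.
  by apply/eqP; apply: contrapT => /negP; apply: h.
case: (ex_minnP ex) => d ad dmin; exists d; split=> // e ed.
by apply/eqP; apply: contraLR ed => /dmin; rewrite -leqNgt.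
Qed.

Lemma top_unique a d e : top a d -> top a e -> d = e.
Proof.
move=> [ad dm] [ae em]; have [lt|lt|//] := ltngtP d e.
- by rewrite (dm _ lt) eqxx in ae.
- by rewrite (em _ lt) eqxx in ad.
Qed.

Lemma top_homog d a : G d a -> a != 0 -> top a d.
Proof.
move=> Ga a0; split; first by rewrite comp_gpieceE.
by move=> e de; rewrite (comp_homog _ Ga) gtn_eqF.
Qed.

Lemma gpiece_uniq d e a : a != 0 -> G d a -> G e a -> d = e.
Proof. by move=> a0 /top_homog/(_ a0) h /top_homog/(_ a0); apply: top_unique. Qed.

Hypothesis dom : is_domain A.

Lemma topM a b d e : top a d -> top b e -> top (a * b) (d + e).
Proof.
move=> [ad dm] [be em]; split.
  have lt : (d < (d + e).+1)%N by lia.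
  rewrite comp_mul (bigD1 (Ordinal lt)) //= addKn big1 ?addr0.
    exact: dom_mul_neq0.
  move=> i; rewrite -val_eqE /= => id; have [lt'|ge] := ltnP d i.
    by rewrite dm ?mul0r.
  by rewrite em ?mulr0 //; lia.
move=> m dem; rewrite comp_mul big1 // => i _.
have [lt'|ge] := ltnP d i; first by rewrite dm ?mul0r.
by rewrite em ?mulr0 //; lia.
Qed.

Lemma bottomM a b d e : bottom a d -> bottom b e -> bottom (a * b) (d + e).
Proof.
move=> [ad dm] [be em]; split.
  have lt : (d < (d + e).+1)%N by lia.
  rewrite comp_mul (bigD1 (Ordinal lt)) //= addKn big1 ?addr0.
    exact: dom_mul_neq0.
  move=> i; rewrite -val_eqE /= => id; have [lt'|ge] := ltnP i d.
    by rewrite dm ?mul0r.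
  by rewrite em ?mulr0 //; have := ltn_ord i; lia.
move=> m dem; rewrite comp_mul big1 // => i _.
have [lt'|ge] := ltnP i d; first by rewrite dm ?mul0r.
by rewrite em ?mulr0 //; have := ltn_ord i; lia.
Qed.

(** Lowest and highest degrees add up in a domain, so both factors of a
    homogeneous element have a single component. *)
Lemma homog_factor m a b : a * b != 0 -> G m (a * b) ->
  exists d e, [/\ (d + e)%N = m, G d a & G e b].
Proof.
move=> ab0 Gab.
have a0 : a != 0 by apply: contraNneq ab0 => ->; rewrite mul0r.
have b0 : b != 0 by apply: contraNneq ab0 => ->; rewrite mulr0.
have [d td] := top_exists a0; have [e te] := top_exists b0.
have [d' bd] := bottom_exists a0; have [e' be] := bottom_exists b0.
have [n1 _] := topM td te; have [n2 _] := bottomM bd be.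
have E (c : nat) : comp (a * b) c != 0 -> c = m.
  by rewrite (comp_homog _ Gab); case: (c =P m) => //; rewrite eqxx.
have le1 : (d' <= d)%N by rewrite leqNgt; apply/negP => /bd.2 z; case: td; rewrite z eqxx.
have le2 : (e' <= e)%N by rewrite leqNgt; apply/negP => /be.2 z; case: te; rewrite z eqxx.
move: (E _ n1) (E _ n2) => E1 E2; exists d, e; split=> //; apply: gpieceP => c cd.
  have [lt|ge] := ltnP d c; first exact: td.2.
  by apply: bd.2; lia.
have [lt|ge] := ltnP e c; first exact: te.2.
by apply: be.2; lia.
Qed.

Lemma homog_dvd m d p a : p != 0 -> G d p -> G m a -> a != 0 -> dvd p a ->
  exists c e, [/\ a = p * c, (d + e)%N = m & G e c].
Proof.
move=> p0 Gp Ga a0 [c e]; move: Ga a0; rewrite e => Ga a0.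
have [d' [e' [de Gp' Gc]]] := homog_factor a0 Ga; exists c, e'; split=> //.
by rewrite (gpiece_uniq p0 Gp Gp').
Qed.

(** When degree zero is a field, the highest degree is an additive norm; this
    gives all the finiteness needed for factorizations. *)
Lemma graded_norm : (forall a, a != 0 -> G 0%N a -> invertible a) ->
  exists2 nu, additive_norm nu & forall d a, a != 0 -> G d a -> nu a = d.
Proof.
move=> G0; have ex a : exists d, a != 0 -> top a d.
  by case: (eqVneq a 0) => [|/top_exists[d]]; [exists 0%N | exists d].
have [nu nuP] := choice ex; exists nu; last first.
  by move=> d a a0 Ga; apply: top_unique (nuP _ a0) _; apply: top_homog.
split=> [a b a0 b0|a a0 na].
  apply: top_unique (nuP _ (dom_mul_neq0 dom a0 b0)) _.
  by apply: topM; apply: nuP.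
have := nuP _ a0; rewrite na => -[_ h]; apply: G0 => //; apply: gpieceP => -[|e] //.
by move=> _; apply: h.
Qed.

(** Among the components not divisible by [p], the highest ones multiply to a
    component of the product modulo [p]. *)
Lemma homog_prime dp p : G dp p -> p != 0 -> ~ invertible p ->
  (forall d e a b, G d a -> G e b -> dvd p (a * b) -> dvd p a \/ dvd p b) ->
  prime_elt p.
Proof.
move=> Gp p0 pu hp; split=> // a b pab.
have dvd_comp c e : dvd p c -> dvd p (comp c e).
  case=> x ->; rewrite (comp_homogM _ _ Gp); case: ifP => _; last exact: dvd0.
  by exists (comp x (e - dp)).
have comp_dvd c : (forall e, dvd p (comp c e)) -> dvd p c.
  move=> h; have [n /(_ n (leqnn n))[_ ->]] := comp_bound c.
  by apply: dvd_sum => i _.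
have [pa|pa] := pselect (dvd p a); first by left.
have [pb|pb] := pselect (dvd p b); first by right.
have nd c : ~ dvd p c -> exists d, ~ dvd p (comp c d).
  move=> h; apply/not_existsP => h'; apply/h/comp_dvd => e.
  by apply: contrapT; apply: h'.
have [d [ad dm]] := last_comp (dvd0 p) (nd _ pa).
have [e [be em]] := last_comp (dvd0 p) (nd _ pb).
have lt : (d < (d + e).+1)%N by lia.
have := dvd_comp _ (d + e)%N pab; rewrite comp_mul (bigD1 (Ordinal lt)) //= addKn.
set S := \sum_(_ | _) _ => h; have pS : dvd p S.
  apply: dvd_sum => i; rewrite -val_eqE /= => id; have [lt'|ge] := ltnP d i.
    by apply/dvd_mulr/dm.
  by apply/dvd_mull/em; lia.
have := dvd_sub h pS; rewrite addrK.
by case/(hp _ _ _ _ (comp_gpiece a d) (comp_gpiece b e)) => z; [case: ad | case: be].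
Qed.

End GradedRing.

Section MpolyGrading.
Variables (k : fieldType) (n : nat) (mf : measure n).

Lemma mpoly_piece_span (a : {mpoly k[n]}) : exists m (c : nat -> {mpoly k[n]}),
  (forall i, c i \is i.-homog for mf) /\ a = \sum_(i < m) c i.
Proof.
exists (mmeasure mf a), (fun d => pihomog mf d a); split=> [i|].
  exact: pihomogP.
exact: pihomog_partitionE.
Qed.

Lemma mpoly_piece_direct m (c : nat -> {mpoly k[n]}) :
  (forall i, c i \is i.-homog for mf) -> \sum_(i < m) c i = 0 ->
  forall i, (i < m)%N -> c i = 0.
Proof.
move=> cP c0 i im; have := congr1 (pihomog mf i) c0.
rewrite raddf_sum (bigD1 (Ordinal im)) //= pihomog_dE // raddf0.
rewrite big1 ?addr0 // => j ji; apply: (@pihomog_ne0 _ _ _ (j : nat)) => //.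
Qed.

Lemma mpoly_piece1 : (1 : {mpoly k[n]}) \is 0.-homog for mf.
Proof. exact: dhomog1. Qed.

Lemma mpoly_pieceM d e (a b : {mpoly k[n]}) :
  a \is d.-homog for mf -> b \is e.-homog for mf -> a * b \is (d + e).-homog for mf.
Proof. exact: dhomogM. Qed.

Lemma mpoly_pieceB d (a b : {mpoly k[n]}) :
  a \is d.-homog for mf -> b \is d.-homog for mf -> a - b \is d.-homog for mf.
Proof. exact: rpredB. Qed.

Lemma mpoly_piece0 d : (0 : {mpoly k[n]}) \is d.-homog for mf.
Proof. exact: rpred0. Qed.

Definition mpoly_grading : grading {mpoly k[n]} :=
  Grading mpoly_piece0 mpoly_pieceB mpoly_piece1 mpoly_pieceM
    mpoly_piece_span mpoly_piece_direct.

End MpolyGrading.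

(** * Locally nilpotent derivations and their degree functions *)

Definition char_zero (A : pzRingType) := forall n, (n.+1)%:R != 0 :> A.

Definition lnd (A : comNzRingType) (D : A -> A) :=
  [/\ forall a b, D (a + b) = D a + D b,
      forall a b, D (a * b) = D a * b + a * D b
    & forall a, exists n, iter n D a = 0].

Section Lnd.
Variables (A : comNzRingType) (D : A -> A).
Hypotheses (dom : is_domain A) (char0 : char_zero A) (lndD : lnd D).
Implicit Types (a b c : A) (m n i j : nat).

Let DD : forall a b, D (a + b) = D a + D b. Proof. by case: lndD. Qed.
Let DM : forall a b, D (a * b) = D a * b + a * D b. Proof. by case: lndD. Qed.
Let Dnil : forall a, exists n, iter n D a == 0.
Proof. by move=> a; have [_ _ /(_ a)[n e]] := lndD; exists n; rewrite e. Qed.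

Lemma lnd0 : D 0 = 0.
Proof. by apply: (addrI (D 0)); rewrite -DD !addr0. Qed.

Lemma lndN a : D (- a) = - D a.
Proof. by apply: (addrI (D a)); rewrite -DD !subrr lnd0. Qed.

Lemma lndB a b : D (a - b) = D a - D b.
Proof. by rewrite DD lndN. Qed.

Lemma lnd1 : D 1 = 0.
Proof.
have := DM 1 1; rewrite !mulr1 mul1r => e.
by apply: (addrI (D 1)); rewrite addr0 -e.
Qed.

Lemma lndMn a n : D (a *+ n) = D a *+ n.
Proof. by elim: n => [|n IHn]; rewrite ?mulr0n ?lnd0 // !mulrS DD IHn. Qed.

Lemma lnd_sum (I : Type) (r : seq I) (P : pred I) (F : I -> A) :
  D (\sum_(i <- r | P i) F i) = \sum_(i <- r | P i) D (F i).
Proof. by elim/big_rec2: _ => [|i x y _ <-]; rewrite ?lnd0 ?DD. Qed.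

Lemma iter0 n : iter n D 0 = 0.
Proof. by elim: n => //= n ->; rewrite lnd0. Qed.

Lemma iter_add n a b : iter n D (a + b) = iter n D a + iter n D b.
Proof. by elim: n => //= n ->; rewrite DD. Qed.

Lemma iter_opp n a : iter n D (- a) = - iter n D a.
Proof. by elim: n => //= n ->; rewrite lndN. Qed.

Lemma iter_sub n a b : iter n D (a - b) = iter n D a - iter n D b.
Proof. by rewrite iter_add iter_opp. Qed.

Lemma iter_ker n c a : D c = 0 -> iter n D (c * a) = c * iter n D a.
Proof. by move=> c0; elim: n => //= n ->; rewrite DM c0 mul0r add0r. Qed.

Lemma iter_le0 m n a : (m <= n)%N -> iter m D a = 0 -> iter n D a = 0.
Proof. by move=> mn e; rewrite -(subnK mn) iterD e iter0. Qed.

(** The number of steps needed to kill [a] is one more than its degree; the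
    degree of [0] is [0] by convention. *)
Definition nil_index a := ex_minn (Dnil a).
Definition ddeg a := (nil_index a).-1.

Lemma iter_nil_index a : iter (nil_index a) D a = 0.
Proof. by rewrite /nil_index; case: ex_minnP => n /eqP. Qed.

Lemma nil_index_le a n : iter n D a = 0 -> (nil_index a <= n)%N.
Proof. by rewrite /nil_index; case: ex_minnP => m _ h /eqP /h. Qed.

Lemma nil_index_gt0 a : a != 0 -> (0 < nil_index a)%N.
Proof.
move=> a0; rewrite lt0n; apply/eqP => e.
by move: (iter_nil_index a); rewrite e /= => z; rewrite z eqxx in a0.
Qed.

Lemma nil_indexE a : a != 0 -> nil_index a = (ddeg a).+1.
Proof. by move=> a0; rewrite /ddeg prednK // nil_index_gt0. Qed.

Lemma iter_ddegS a : iter (ddeg a).+1 D a = 0.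
Proof.
have [->|a0] := eqVneq a 0; first exact: iter0.
by rewrite -nil_indexE // iter_nil_index.
Qed.

Lemma iter_ddeg_neq0 a : a != 0 -> iter (ddeg a) D a != 0.
Proof. by move=> a0; apply/eqP => /nil_index_le; rewrite nil_indexE // ltnn. Qed.

Lemma iter_gt_ddeg a n : (ddeg a < n)%N -> iter n D a = 0.
Proof. by move=> an; apply: iter_le0 an (iter_ddegS a). Qed.

Lemma ddeg_le a n : iter n.+1 D a = 0 -> (ddeg a <= n)%N.
Proof. by move/nil_index_le; rewrite /ddeg; case: nil_index. Qed.

Lemma ddeg_lt a n : a != 0 -> iter n D a = 0 -> (ddeg a < n)%N.
Proof. by move=> a0 /nil_index_le; rewrite nil_indexE. Qed.

Lemma ddeg_eq a n : iter n D a != 0 -> iter n.+1 D a = 0 -> ddeg a = n.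
Proof.
move=> an /ddeg_le le; apply/eqP; rewrite eqn_leq le leqNgt; apply/negP.
by move/iter_gt_ddeg => z; rewrite z eqxx in an.
Qed.

Lemma ddegD a b n : (ddeg a <= n)%N -> (ddeg b <= n)%N -> (ddeg (a + b) <= n)%N.
Proof. by move=> an bn; apply: ddeg_le; rewrite iter_add !iter_gt_ddeg ?addr0. Qed.

Lemma ddeg0 : ddeg 0 = 0%N.
Proof. by apply/eqP; rewrite -leqn0; apply: ddeg_le; rewrite iter0. Qed.

Lemma ker_iter_ddeg a : D (iter (ddeg a) D a) = 0.
Proof. exact: iter_ddegS. Qed.

Lemma ddeg_ker a : D a = 0 -> ddeg a = 0%N.
Proof. by move=> e; apply/eqP; rewrite -leqn0; apply: ddeg_le. Qed.

Lemma ddeg0_ker a : ddeg a = 0%N -> D a = 0.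
Proof. by move=> e; have := iter_ddegS a; rewrite e. Qed.

Lemma ddeg_lnd a : D a != 0 -> ddeg a = (ddeg (D a)).+1.
Proof.
move=> Da; apply: ddeg_eq; rewrite iterSr; last exact: iter_ddegS.
exact: iter_ddeg_neq0.
Qed.

Lemma leibniz n a b :
  iter n D (a * b) = \sum_(i < n.+1) iter i D a * iter (n - i) D b *+ 'C(n, i).
Proof.
elim: n => [|n IHn]; first by rewrite big_ord1 /= bin0 mulr1n.
rewrite iterS IHn lnd_sum.
rewrite (eq_bigr (fun i : 'I_n.+1 => iter i.+1 D a * iter (n - i) D b *+ 'C(n, i)
    + iter i D a * iter (n.+1 - i) D b *+ 'C(n, i))); last first.
  by move=> i _; rewrite lndMn DM mulrnDl /= subSn // -ltnS.
rewrite big_split /= addrC [X in X + _]big_ord_recl [X in _ + X]big_ord_recr /=.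
rewrite [RHS]big_ord_recl big_ord_recr /= /bump /= !bin0 !add1n !subnn !binn.
rewrite -addrA; congr (_ + _); rewrite addrA add0n -big_split /=; congr (_ + _).
by apply: eq_bigr => i _; rewrite add0n !add1n subSS binS mulrnDr.
Qed.

(** At the top only one term of the Leibniz formula survives, with a nonzero
    binomial coefficient; hence degrees are additive. *)
Lemma iter_top m n a b : (ddeg a <= m)%N -> (ddeg b <= n)%N ->
  iter (m + n) D (a * b) = iter m D a * iter n D b *+ 'C(m + n, m).
Proof.
move=> am bn; have lt : (m < (m + n).+1)%N by lia.
rewrite leibniz (bigD1 (Ordinal lt)) //= addKn big1 ?addr0 // => i.
rewrite -val_eqE /= => im; have [lt'|ge] := ltnP m i.
  by rewrite (@iter_gt_ddeg a) ?mul0r ?mul0rn //; lia.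
by rewrite (@iter_gt_ddeg b) ?mulr0 ?mul0rn //; lia.
Qed.

Lemma dom_mulrn_neq0 a n : (0 < n)%N -> a != 0 -> a *+ n != 0.
Proof. by case: n => // n _ a0; rewrite -mulr_natr dom_mul_neq0. Qed.

Lemma iter_top_neq0 a b : a != 0 -> b != 0 ->
  iter (ddeg a + ddeg b) D (a * b) != 0.
Proof.
move=> a0 b0; rewrite iter_top // dom_mulrn_neq0 ?bin_gt0 ?leq_addr //.
by rewrite dom_mul_neq0 ?iter_ddeg_neq0.
Qed.

Lemma ddegM a b : a != 0 -> b != 0 -> ddeg (a * b) = (ddeg a + ddeg b)%N.
Proof.
move=> a0 b0; apply: ddeg_eq; first exact: iter_top_neq0.
have := iter_top (leqnSn (ddeg a)) (leqnn (ddeg b)).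
by rewrite iter_ddegS mul0r mul0rn addSn.
Qed.

Lemma ddegX a n : a != 0 -> ddeg (a ^+ n) = (ddeg a * n)%N.
Proof.
move=> a0; elim: n => [|n IHn]; first by rewrite expr0 muln0 ddeg_ker // lnd1.
by rewrite exprS ddegM ?dom_exp_neq0 // IHn mulnS.
Qed.

(** Degrees are additive and nonnegative, so the kernel contains the factors of
    its nonzero elements. *)
Lemma ker_factor a b : a * b != 0 -> D (a * b) = 0 -> D a = 0.
Proof.
move=> ab0 /ddeg_ker.
have a0 : a != 0 by apply: contraNneq ab0 => ->; rewrite mul0r.
have b0 : b != 0 by apply: contraNneq ab0 => ->; rewrite mulr0.
by rewrite ddegM // => /eqP; rewrite addn_eq0 => /andP[/eqP /ddeg0_ker].
Qed.

Lemma ker_invertible a : invertible a -> D a = 0.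
Proof.
case=> b e; apply: (@ker_factor a b); first by rewrite e oner_neq0.
by rewrite e lnd1.
Qed.

Lemma ker_mul a b : D a = 0 -> D b = 0 -> D (a * b) = 0.
Proof. by move=> Da Db; rewrite DM Da Db mul0r mulr0 addr0. Qed.

Lemma ker_exp a n : D a = 0 -> D (a ^+ n) = 0.
Proof.
by move=> Da; elim: n => [|n IHn]; rewrite ?expr0 ?lnd1 // exprS ker_mul.
Qed.

(** Passing from [a] to [D a] lowers the degree, but nonzero multiples of [a] have
    at least its degree. *)
Lemma lnd_dvd a : dvd a (D a) -> D a = 0.
Proof.
case=> c e; apply/eqP; apply: contrapT => /negP Da.
have a0 : a != 0 by apply: contraNneq Da => ->; rewrite lnd0.
have c0 : c != 0 by apply: contraNneq Da => z; rewrite e z mulr0.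
by have := ddeg_lnd Da; rewrite e ddegM //; lia.
Qed.

(** A local slice is the last iterate outside the kernel. *)
Lemma local_slice_exists a : D a != 0 ->
  exists n, D (iter n D a) != 0 /\ D (D (iter n D a)) = 0.
Proof.
move=> Da; exists (ddeg (D a)); rewrite -!iterS; split; rewrite iterSr.
  exact: iter_ddeg_neq0.
exact: iter_ddegS.
Qed.

Section Homogeneous.
Variable G : grading A.

(** The degree of [D] is the integer [e1 - e2]. *)
Definition homog_der e1 e2 := forall m a, G m a -> D a != 0 ->
  exists2 m', (m' + e2 = m + e1)%N & G m' (D a).

Variables (e1 e2 : nat).
Hypothesis homD : homog_der e1 e2.

Lemma homog_iter n m a : G m a -> iter n D a != 0 ->
  exists2 m', (m' + n * e2 = m + n * e1)%N & G m' (iter n D a).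
Proof.
move=> Ga; elim: n => [|n IHn] /= h; first by exists m; rewrite ?mul0n ?addn0.
have [|m' em Gm] := IHn; first by apply: contraNneq h => ->; rewrite lnd0.
by have [m'' em' Gm'] := homD Gm h; exists m''; rewrite // !mulSn; lia.
Qed.

(** Division with remainder for the degree of [D]. The leading terms are
    matched by a power of the local slice [s]; [e] collects denominators. *)
Lemma graded_division s ds p dp m a : G ds s -> D s != 0 -> D (D s) = 0 ->
    G dp p -> p != 0 -> G m a ->
  exists e de q r, [/\ D e = 0, e != 0 /\ G de e, e * a = q * p + r,
    G (de + m)%N r & r = 0 \/ (ddeg r < ddeg p)%N].
Proof.
move=> Gs Ds DDs Gp p0; have s0 : s != 0 by apply: contraNneq Ds => ->; rewrite lnd0.
have ds1 : ddeg s = 1%N by apply: ddeg_eq.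
have [n] := ubnP (nil_index a); elim: n m a => // n IHn m a; rewrite ltnS => an Ga.
have [->|a0] := eqVneq a 0.
  exists 1, 0%N, 0, 0; rewrite lnd1 oner_neq0 mulr0 mul0r addr0.
  by split=> //; [split=> //; apply: gpiece1 | apply: gpiece0 | left].
have [lt|ge] := ltnP (ddeg a) (ddeg p).
  exists 1, 0%N, 0, a; rewrite lnd1 oner_neq0 mul0r mul1r add0r.
  by split=> //; [split=> //; apply: gpiece1 | right].
pose i := ddeg a; pose t := s ^+ (i - ddeg p) * p.
have t0 : t != 0 by rewrite dom_mul_neq0 ?dom_exp_neq0.
have dt : ddeg t = i by rewrite ddegM ?dom_exp_neq0 // ddegX // ds1 mul1n subnK.
have lt0 : iter i D t != 0 by rewrite -dt iter_ddeg_neq0.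
have la0 : iter i D a != 0 by rewrite iter_ddeg_neq0.
have Gt : G (ds * (i - ddeg p) + dp)%N t by apply: gpieceM => //; apply: gpieceX.
have [n1 en1 Glt] := homog_iter Gt lt0; have [m1 em1 Gla] := homog_iter Ga la0.
have klt : D (iter i D t) = 0 by rewrite -{1}dt ker_iter_ddeg.
have kla : D (iter i D a) = 0 by rewrite ker_iter_ddeg.
pose a' := iter i D t * a - iter i D a * t.
have Ga' : G (n1 + m)%N a'.
  apply: gpieceB; first exact: gpieceM.
  have -> : (n1 + m = m1 + (ds * (i - ddeg p) + dp))%N by lia.
  exact: gpieceM.
have a'n : (nil_index a' < n)%N.
  apply: leq_trans an; rewrite (nil_indexE a0) ltnS; apply: nil_index_le.
  by rewrite iter_sub (iter_ker _ _ klt) (iter_ker _ _ kla) mulrC subrr.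
have [e [de [q [r [De [e0 Ge] eq Gr hr]]]]] := IHn _ _ a'n Ga'.
exists (e * iter i D t), (de + n1)%N, (q + e * iter i D a * s ^+ (i - ddeg p)), r.
split=> //.
- exact: ker_mul.
- by split; [apply: dom_mul_neq0 | apply: gpieceM].
- have -> : r = e * a' - q * p by rewrite eq; ring.
  by rewrite /a' /t; ring.
- by rewrite -addnA.
Qed.

End Homogeneous.
End Lnd.

(** * Graded kernels of dimension one *)

Section PrimeIdeal.
Variables (A : comNzRingType) (P : A -> Prop).
Hypothesis primeP : prime_ideal P.

Lemma prime_ideal0 : P 0. Proof. by case: primeP => -[]. Qed.
Lemma prime_idealD a b : P a -> P b -> P (a + b).
Proof. by case: primeP => -[_ h _] _ _; apply: h. Qed.
Lemma prime_ideal_mull a b : P b -> P (a * b).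
Proof. by case: primeP => -[_ _ h] _ _; apply: h. Qed.
Lemma prime_ideal_mulr a b : P a -> P (a * b).
Proof. by rewrite mulrC; apply: prime_ideal_mull. Qed.
Lemma prime_idealM a b : P (a * b) -> P a \/ P b.
Proof. by case: primeP => _ _; apply. Qed.
Lemma prime_ideal_dvd a b : dvd a b -> P a -> P b.
Proof. by case=> c -> Pa; apply: prime_ideal_mulr. Qed.
Lemma prime_idealN a : P a -> P (- a).
Proof. by rewrite -mulN1r; apply: prime_ideal_mull. Qed.
Lemma prime_idealB a b : P a -> P b -> P (a - b).
Proof. by move=> Pa Pb; apply: prime_idealD => //; apply: prime_idealN. Qed.
Lemma prime_ideal_exp a n : P (a ^+ n) -> P a.
Proof.
elim: n => [|n IHn]; first by rewrite expr0; case: primeP.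
by rewrite exprS => /prime_idealM[].
Qed.
Lemma prime_ideal_inv a : invertible a -> ~ P a.
Proof. by case=> b e /(prime_ideal_mulr b); rewrite e; case: primeP. Qed.
Lemma prime_ideal_neq0 a : ~ P a -> a != 0.
Proof. by move=> Pa; apply/eqP => a0; apply: Pa; rewrite a0; apply: prime_ideal0. Qed.

End PrimeIdeal.

Section Binary.
Variables (k : closedFieldType) (A : comNzRingType) (iota : {rmorphism k -> A}).
Hypothesis dom : is_domain A.

Lemma iota_inv c : c != 0 -> invertible (iota c).
Proof. by move=> c0; exists (iota c^-1); rewrite -rmorphM divff ?rmorph1. Qed.

Variables (g h : A).

(** The homogenization of [p] in degree [n], evaluated at [g] and [h]. *)
Definition binary_form n (p : {poly k}) :=
  \sum_(i < n.+1) iota p`_i * (g ^+ i * h ^+ (n - i)).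

Lemma binary_formD n p q : binary_form n (p + q) = binary_form n p + binary_form n q.
Proof.
by rewrite -big_split; apply: eq_bigr => i _; rewrite /= coefD rmorphD mulrDl.
Qed.

Lemma binary_form_sum n (I : Type) (r : seq I) (F : I -> {poly k}) :
  binary_form n (\sum_(i <- r) F i) = \sum_(i <- r) binary_form n (F i).
Proof.
elim/big_rec2: _ => [|i x y _ <-]; last by rewrite binary_formD.
by rewrite /binary_form big1 // => i _; rewrite coef0 rmorph0 mul0r.
Qed.

Lemma binary_formZX n c j : (j <= n)%N ->
  binary_form n (c *: 'X^j) = iota c * (g ^+ j * h ^+ (n - j)).
Proof.
rewrite -ltnS => jn; rewrite /binary_form (bigD1 (Ordinal jn)) //=.
rewrite coefZ coefXn eqxx mulr1 big1 ?addr0 // => i; rewrite -val_eqE /= => ij.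
by rewrite coefZ coefXn (negbTE ij) mulr0 rmorph0 mul0r.
Qed.

Lemma binary_form_XsubC n c (q : {poly k}) : (size q <= n.+1)%N ->
  binary_form n.+1 (q * ('X - c%:P)) = (g - iota c * h) * binary_form n q.
Proof.
move=> sq; have -> : q * ('X - c%:P) = q * 'X + (- c) *: q.
  by rewrite mulrBr scaleNr -mul_polyC (mulrC c%:P).
rewrite binary_formD mulrBl; congr (_ + _).
  rewrite /binary_form big_ord_recl /= coefMX /= rmorph0 mul0r add0r mulr_sumr.
  apply: eq_bigr => i _; rewrite coefMX /bump /= add1n subSS exprS; ring.
rewrite /binary_form big_ord_recr /= coefZ [q`_n.+1]nth_default //.
rewrite mulr0 rmorph0 mul0r addr0 mulr_sumr -sumrN; apply: eq_bigr => i _.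
by rewrite coefZ rmorphM rmorphN subSn -1?ltnS // exprS; ring.
Qed.

(** Over an algebraically closed field a form splits into linear factors, one of
    which must vanish in a domain. *)
Lemma binary_form_eq0 n (p : {poly k}) : h != 0 -> p != 0 -> (size p <= n.+1)%N ->
  binary_form n p = 0 -> exists c, g = iota c * h.
Proof.
move=> h0; elim: n p => [|n IHn] p p0 sp e; have [s1|s1] := eqVneq (size p) 1%N.
- have /size1_polyC ep : (size p <= 1)%N by rewrite s1.
  move: e; rewrite /binary_form big_ord1 expr0 mul1r subnn expr0 mulr1 => e.
  have : p`_0 != 0 by rewrite -polyC_eq0 -ep.
  by move/iota_inv/invertible_neq0; rewrite e eqxx.
- by move: s1 sp p0; rewrite -size_poly_gt0; case: (size p) => [|[]].
- have /size1_polyC : (size p <= 1)%N by rewrite s1.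
  move: p`_0 => c ep; have c0 : c != 0 by rewrite -polyC_eq0 -ep.
  have ec : c%:P = c *: 'X^0 by rewrite expr0 alg_polyC.
  move: e; rewrite ep ec binary_formZX // expr0 mul1r subn0 => e.
  have := dom_mul_neq0 dom (invertible_neq0 (iota_inv c0)) (dom_exp_neq0 dom n.+1 h0).
  by rewrite e eqxx.
have [c /factor_theorem[q eq]] := closed_rootP p s1.
have q0 : q != 0 by apply: contraNneq p0 => z; rewrite eq z mul0r.
have sq : (size q <= n.+1)%N.
  by move: sp; rewrite eq size_mul ?polyXsubC_eq0 // size_XsubC addn2.
move: e; rewrite eq binary_form_XsubC // => /dom[/eqP|]; last exact: IHn.
by rewrite subr_eq0 => /eqP e; exists c.
Qed.

End Binary.

Section KernelLine.
Variables (k : closedFieldType) (A : comNzRingType) (iota : {rmorphism k -> A}).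
Variables (D : A -> A) (G : grading A).
Hypotheses (dom : is_domain A) (char0 : char_zero A) (lndD : lnd D).
Hypothesis G0 : forall a, G 0%N a -> exists c, a = iota c.
Hypothesis Giota : forall c, G 0%N (iota c).

(** Transcendence degree at most two, in graded form: elements of equal
    positive degree satisfy a homogeneous relation. The condition on [M] keeps
    the exponents of [v] from being truncated. *)
Definition thin := forall L u v w, (0 < L)%N -> G L u -> G L v -> G L w ->
  exists N M (c : 'I_N -> 'I_N -> k), [/\ (N.*2 <= M)%N, exists r i, c r i != 0
    & \sum_(r < N) \sum_(i < N)
        iota (c r i) * (w ^+ r * u ^+ i * v ^+ (M - r - i)) = 0].

(** The kernel has dimension at most one. *)
Definition kernel_line := forall m a b, G m a -> G m b -> D a = 0 -> D b = 0 ->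
  b != 0 -> exists c, a = iota c * b.

Lemma ker_iota c : D (iota c) = 0.
Proof.
have [->|c0] := eqVneq c 0; first by rewrite rmorph0 (lnd0 lndD).
exact/(ker_invertible dom char0 lndD)/iota_inv.
Qed.

(** An element outside the kernel is transcendental over it, because its powers
    have distinct degrees. *)
Lemma ker_free w N (P : 'I_N -> A) : D w != 0 -> (forall r, D (P r) = 0) ->
  \sum_(r < N) P r * w ^+ r = 0 -> forall r, P r = 0.
Proof.
move=> Dw; have w0 : w != 0 by apply: contraNneq Dw => ->; rewrite (lnd0 lndD).
have dw : (0 < ddeg lndD w)%N.
  by rewrite lt0n; apply: contraNneq Dw => /ddeg0_ker ->.
elim: N P => [|N IHN] P kP; first by move=> _ [].
rewrite big_ord_recr /= => e; have PN : P ord_max = 0.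
  have := congr1 (iter (ddeg lndD w * N) D) e.
  rewrite (iter0 lndD) (iter_add lndD) (iter_ker lndD _ _ (kP _)).
  rewrite (_ : iter _ D (\sum_(i < N) _) = 0) ?add0r => [/dom[//|z]|].
    have := iter_ddeg_neq0 lndD (dom_exp_neq0 dom N w0).
    by rewrite (ddegX dom char0 lndD) // z eqxx.
  elim/big_ind: _ => [|x y ex ey|i _]; first exact: iter0.
    by rewrite (iter_add lndD) ex ey addr0.
  rewrite (iter_ker lndD _ _ (kP _)) (iter_gt_ddeg (lndD := lndD)) ?mulr0 //.
  by rewrite (ddegX dom char0 lndD) // ltn_pmul2l.
move: e; rewrite PN mul0r addr0 => /(IHN (fun r => P (widen_ord (leqnSn N) r))) h r.
case: (unliftP ord_max r) => [j|] -> //; rewrite -(h (fun r => kP _) j).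
by congr P; apply: val_inj; rewrite /= /bump leqNgt ltn_ord.
Qed.

(** Two independent elements of the kernel and one element outside it would
    have algebraically independent powers of the same degree. *)
Lemma thin_kernel_line w dw : thin -> (0 < dw)%N -> G dw w -> D w != 0 ->
  kernel_line.
Proof.
move=> th dw0 Gw Dw m a b Ga Gb Da Db b0; have [m0|m0] := posnP m.
  rewrite {m}m0 in Ga Gb; have [c ->] := G0 Ga; have [d eb] := G0 Gb.
  have d0 : d != 0 by apply: contraNneq b0 => z; rewrite eb z rmorph0.
  by exists (c / d); rewrite eb -rmorphM divfK.
have L0 : (0 < m * dw)%N by rewrite muln_gt0 m0.
have Gwm : G (m * dw)%N (w ^+ m) by rewrite mulnC; apply: gpieceX.
have [N [M [c [NM [r [i cri]] e]]]] := th _ _ _ _ L0 (gpieceX dw Ga) (gpieceX dw Gb) Gwm.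
have w0 : w != 0 by apply: contraNneq Dw => ->; rewrite (lnd0 lndD).
have Dwm : D (w ^+ m) != 0.
  apply/eqP => /(ddeg_ker lndD); rewrite (ddegX dom char0 lndD) // => /eqP.
  rewrite muln_eq0 [m == _]gtn_eqF // orbF => /eqP /ddeg0_ker z.
  by rewrite z eqxx in Dw.
pose Q (r : 'I_N) := \sum_(i < N)
  iota (c r i) * ((a ^+ dw) ^+ i * (b ^+ dw) ^+ (M - r - i)).
have kQ s : D (Q s) = 0.
  rewrite (lnd_sum lndD) big1 // => j _; apply: (ker_mul lndD); first exact: ker_iota.
  by rewrite -!exprM; apply: (ker_mul lndD); apply: (ker_exp lndD).
have Q0 : Q r = 0.
  apply: (ker_free Dwm kQ); rewrite -[RHS]e; apply: eq_bigr => s _.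
  by rewrite mulr_suml; apply: eq_bigr => j _; ring.
pose p := \sum_(i < N) c r i *: 'X^(i * dw).
apply: (@binary_form_eq0 k A iota dom a b ((M - r) * dw) p b0).
- apply: contra_neq cri => p0; have := congr1 (fun p : {poly k} => p`_(i * dw)) p0.
  rewrite /p coef_sum coef0 (bigD1 i) //= coefZ coefXn eqxx mulr1 big1 ?addr0 // => j ji.
  by rewrite coefZ coefXn eqn_pmul2r // val_eqE eq_sym (negbTE ji) mulr0.
- apply: (leq_trans (size_sum _ _ _)); apply/bigmax_leqP => j _.
  apply: (leq_trans (size_scale_leq _ _)); rewrite size_polyXn ltnS leq_mul2r.
  by have := ltn_ord j; have := ltn_ord r; lia.
rewrite binary_form_sum -[RHS]Q0; apply: eq_bigr => j _.
rewrite binary_formZX; last first.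
  by rewrite leq_mul2r; have := ltn_ord j; have := ltn_ord r; lia.
by rewrite -mulnBl -!exprM; congr (_ * (_ ^+ _ * _ ^+ _)); rewrite mulnC.
Qed.

Hypothesis line : kernel_line.

Lemma kernel_powers d h m a : G d h -> D h = 0 -> h != 0 -> G m a -> D a = 0 ->
  exists c, a ^+ d = iota c * h ^+ m.
Proof.
move=> Gh Dh h0 Ga Da; apply: line (dom_exp_neq0 dom _ h0).
- exact: gpieceX Ga.
- by rewrite mulnC; apply: gpieceX.
- exact: (ker_exp lndD).
- exact: (ker_exp lndD).
Qed.

Variables (e1 e2 : nat).
Hypothesis homD : homog_der D G e1 e2.

(** The leading iterates of [q] and [g] are kernel elements of equal degree, so
    they are proportional and a multiple of [g] lowers the degree of [q]. *)
Lemma lead_reduce m q g : G m q -> G m g -> q != 0 -> g != 0 ->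
  ddeg lndD q = ddeg lndD g ->
  exists2 c, c != 0 & iter (ddeg lndD q) D (q - iota c * g) = 0.
Proof.
move=> Gq Gg q0 g0 dqg; have Dq := iter_ddeg_neq0 lndD q0.
have Dg := iter_ddeg_neq0 lndD g0; rewrite -dqg in Dg.
have [m1 em1 Gm1] := homog_iter lndD homD Gq Dq.
have [m2 em2 Gm2] := homog_iter lndD homD Gg Dg.
have em : m2 = m1 by lia.
rewrite em in Gm2; have kq := ker_iter_ddeg lndD q.
have kg := ker_iter_ddeg lndD g; rewrite -dqg in kg.
have [c ec] := line Gm1 Gm2 kq kg Dg; exists c.
  by apply: contraNneq Dq => c0; rewrite ec c0 rmorph0 mul0r.
by rewrite (iter_sub lndD) (iter_ker lndD _ _ (ker_iota c)) -ec subrr.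
Qed.

(** Elements of bounded degree for [D] form a space filtered by lines. *)
Lemma filtered_dependent n m (F : 'I_n.+1 -> A) : (forall i, G m (F i)) ->
  (forall i, iter n D (F i) = 0) ->
  exists c : 'I_n.+1 -> k, (exists i, c i != 0) /\ \sum_i iota (c i) * F i = 0.
Proof.
elim: n F => [|n IHn] F GF nilF.
  exists (fun _ => 1); split; first by exists ord0; apply: oner_neq0.
  by rewrite big1 // => i _; rewrite [F i]nilF mulr0.
have [i0 elimF] : exists i0, forall i, exists c, iter n D (F i - iota c * F i0) = 0.
  have [[i0 /eqP F0]|h] := pselect (exists i, iter n D (F i) <> 0); last first.
    exists ord0 => i; exists 0; rewrite rmorph0 mul0r subr0.
    by apply: contrapT => e; apply: h; exists i.
  exists i0 => i; have [Fi|Fi] := eqVneq (iter n D (F i)) 0.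
    by exists 0; rewrite rmorph0 mul0r subr0.
  have [m1 em1 G1] := homog_iter lndD homD (GF i) Fi.
  have [m2 em2 G2] := homog_iter lndD homD (GF i0) F0.
  have em : m2 = m1 by lia.
  rewrite em in G2; have [c ec] := line G1 G2 (nilF i) (nilF i0) F0; exists c.
  by rewrite (iter_sub lndD) (iter_ker lndD _ _ (ker_iota c)) -ec subrr.
have [c cP] := choice elimF.
have [||c' [[j0 c'j0] e]] := IHn (fun j => F (lift i0 j) - iota (c (lift i0 j)) * F i0).
- by move=> j; apply: gpieceB => //; rewrite -[X in G X]add0n; apply: gpieceM.
- by move=> j; apply: cP.
exists (fun i => if unlift i0 i is Some j then c' j
                 else - \sum_j c' j * c (lift i0 j)); split.
  by exists (lift i0 j0); rewrite liftK.
rewrite (bigD1_ord i0) //= unlift_none rmorphN rmorph_sum mulNr mulr_suml -sumrN.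
rewrite -[RHS]e -big_split; apply: eq_bigr => j _ /=; rewrite liftK rmorphM; ring.
Qed.

(** [b] has the greatest possible quotient of the degree of [D] by the degree
    of the grading. *)
Definition max_slope db b := [/\ (0 < db)%N, G db b, b != 0
  & forall m a, G m a -> a != 0 -> (ddeg lndD a * db <= ddeg lndD b * m)%N].

Variables (db : nat) (b : A).
Hypothesis slope : max_slope db b.

Section AtInfinity.
Variables (d : nat) (h : A).
Hypotheses (d0 : (0 < d)%N) (Gh : G d h) (Dh : D h = 0) (h0 : h != 0).

(** The open set where [h] does not vanish is an affine line in the projective
    curve; the functions of non-maximal slope vanish at the remaining point. *)
Lemma small_slope_nilpotent m a : G m a -> (ddeg lndD a * db < ddeg lndD b * m)%N ->
  exists M, dvd h (a ^+ M).
Proof.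
(* After passing to powers, a, b and h have the same degree L, and i < j are
   the degrees of a and b for D. Leading terms of degree n in the piece of degree
   L * M are removed by q0 * b ^ v * h ^ _ where q0 has the least degree in the
   residue class of n modulo j; the power of h is positive as soon as j * M - n
   is large. *)
have [db0 Gb b0 bmax] := slope.
move=> Ga lt; have [->|a0] := eqVneq a 0; first by exists 1%N; apply: dvd0.
have m0 : (0 < m)%N by lia.
pose L := (m * d * db)%N.
pose i := (ddeg lndD a * (d * db))%N; pose j := (ddeg lndD b * (m * d))%N.
have ij : (i < j)%N.
  rewrite /i /j (mulnC d) mulnA [X in (_ < X)%N]mulnA ltn_pmul2r //.
have j0 : (0 < j)%N by lia.
have Ga1 : G L (a ^+ (d * db)) by rewrite /L -mulnA; apply: gpieceX.
have Gb1 : G L (b ^+ (m * d)) by rewrite /L mulnC; apply: gpieceX.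
have Gh1 : G L (h ^+ (m * db)).
  by rewrite (_ : L = (d * (m * db))%N) /L; [apply: gpieceX | lia].
set a1 := a ^+ _ in Ga1; set b1 := b ^+ _ in Gb1; set h1 := h ^+ _ in Gh1.
have db1 : ddeg lndD b1 = j by rewrite (ddegX dom char0 lndD).
have b10 : b1 != 0 by apply: dom_exp_neq0.
have h10 : h1 != 0 by apply: dom_exp_neq0.
have dh1 n : ddeg lndD (h1 ^+ n) = 0%N.
  by apply: (ddeg_ker lndD); rewrite -exprM; apply: (ker_exp lndD).
have lead rho : exists C, forall M q, G (L * M)%N q -> q != 0 ->
    (ddeg lndD q %% j)%N = rho -> (C + ddeg lndD q <= j * M)%N ->
    exists g, [/\ dvd h1 g, G (L * M)%N g, g != 0 & ddeg lndD q = ddeg lndD g].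
  pose S n := `[< exists M q, [/\ G (L * M)%N q, q != 0, ddeg lndD q = n
                                & (n %% j)%N = rho] >].
  have [ex|nex] := pselect (exists n, S n); last first.
    by exists 0%N => M q Gq q0 qr _; case: nex; exists (ddeg lndD q);
      apply/asboolP; exists M, q.
  case: (ex_minnP ex) => n0 /asboolP[M0 [q0 [Gq0 q00 dq0 n0r]]] n0min.
  exists (j * M0 + j)%N => M q Gq qn0 qr le.
  have n0q : (n0 <= ddeg lndD q)%N by apply: n0min; apply/asboolP; exists M, q.
  have /dvdnP[v ev] : (j %| ddeg lndD q - n0)%N.
    by rewrite -eqn_mod_dvd // qr n0r.
  have leM : (M0 + v < M)%N by rewrite -(ltn_pmul2l j0); lia.
  exists (q0 * b1 ^+ v * h1 ^+ (M - M0 - v)); split.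
  - have -> : (M - M0 - v)%N = (M - M0 - v).-1.+1 by lia.
    by rewrite exprS mulrCA; apply: dvd_mulr; apply: dvd_refl.
  - have -> : (L * M = L * M0 + L * v + L * (M - M0 - v))%N.
      by rewrite -!mulnDr; congr (_ * _)%N; lia.
    by apply: gpieceM; [apply: gpieceM | ]; rewrite // ; apply: gpieceX.
  - by rewrite !dom_mul_neq0 ?dom_exp_neq0.
  rewrite !(ddegM dom char0 lndD) ?dom_mul_neq0 ?dom_exp_neq0 //.
  by rewrite dh1 (ddegX dom char0 lndD) // db1 dq0 mulnC; lia.
have [C CP] := choice lead.
pose C' := (\sum_(rho < j) C rho)%N.
have reduce M q : G (L * M)%N q -> (C' + ddeg lndD q <= j * M)%N -> dvd h1 q.
  have [n] := ubnP (nil_index lndD q); elim: n q => // n IHn q.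
  rewrite ltnS => qn Gq le; have [->|q0] := eqVneq q 0; first exact: dvd0.
  have rlt : (ddeg lndD q %% j < j)%N by rewrite ltn_mod.
  have [|g [hg Gg g0 dqg]] := CP _ M q Gq q0 erefl.
    apply: leq_trans le; rewrite leq_add2r /C' (bigD1 (Ordinal rlt)) //=.
    exact: leq_addr.
  have [c c0 ec] := lead_reduce Gq Gg q0 g0 dqg.
  rewrite -[q](subrK (iota c * g)); apply: dvd_add; last exact: dvd_mull.
  apply: IHn.
  - apply: leq_trans qn; rewrite (nil_indexE lndD q0) ltnS.
    exact: nil_index_le.
  - by apply: gpieceB => //; rewrite -[X in G X]add0n; apply: gpieceM.
  - apply: leq_trans le; rewrite leq_add2l; apply: ddegD => //.
    rewrite -mulNr -rmorphN; have [->|n0] := eqVneq (- c) 0.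
      by rewrite rmorph0 mul0r (ddeg0 lndD).
    rewrite (ddegM dom char0 lndD) ?(invertible_neq0 (iota_inv _ n0)) //.
    by rewrite (ddeg_ker lndD (ker_iota _)) dqg.
exists (d * db * C'.+1)%N; rewrite exprM.
have hh1 : dvd h h1.
  have mdb : (0 < m * db)%N by rewrite muln_gt0 m0.
  by rewrite /h1 -(prednK mdb) exprS; apply: dvd_mulr; apply: dvd_refl.
apply: dvd_trans hh1 _; apply: (reduce C'.+1); first exact: gpieceX.
rewrite (ddegX dom char0 lndD) ?dom_exp_neq0 // (ddegX dom char0 lndD) // -/i.
have : (i.+1 * C'.+1 <= j * C'.+1)%N by rewrite leq_mul2r ij.
by rewrite mulSn; lia.
Qed.

Definition relevant (P : A -> Prop) := exists d a, [/\ (0 < d)%N, G d a & ~ P a].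

(** Elements of smaller slope are nilpotent modulo [h], hence in [P]; those of
    maximal slope agree, after passing to powers, with a multiple of a power of
    [b] up to smaller slope, and [b] is not in [P] since otherwise [P] would
    contain everything of positive degree. *)
Lemma mem_prime_at_infinity P m a : prime_ideal P -> relevant P -> P h ->
  (0 < m)%N -> G m a -> a != 0 -> P a <-> (ddeg lndD a * db < ddeg lndD b * m)%N.
Proof.
move=> primeP [d' [x [d'0 Gx nPx]]] Ph; have [db0 Gb b0 bmax] := slope.
have small n y : G n y -> (ddeg lndD y * db < ddeg lndD b * n)%N -> P y.
  move=> Gy /(small_slope_nilpotent Gy)[M /(prime_ideal_dvd primeP)/(_ Ph)].
  exact: prime_ideal_exp.
have equal n y : (0 < n)%N -> G n y -> y != 0 ->
    (ddeg lndD y * db)%N = (ddeg lndD b * n)%N -> (P y <-> P b).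
  move=> n0 Gy y0 e; have Gq := gpieceX db Gy; have Gg := gpieceX n Gb.
  rewrite mulnC in Gg; have q0 := dom_exp_neq0 dom db y0.
  have g0 := dom_exp_neq0 dom n b0.
  have [|c c0 /= er] := lead_reduce Gq Gg q0 g0.
    by rewrite !(ddegX dom char0 lndD).
  set r := _ - _ in er; have Gr : G (n * db)%N r.
    apply: gpieceB => //; rewrite -[X in G X]add0n; exact: gpieceM.
  have Pr : P r.
    have [->|r0] := eqVneq r 0; first exact: prime_ideal0.
    apply: (small _ _ Gr); have := ddeg_lt lndD r0 er; rewrite (ddegX dom char0 lndD) //.
    by rewrite e mulnA ltn_pmul2r.
  split=> [Py|Pb].
    have : P (iota c * b ^+ n).
      rewrite (_ : _ * _ = y ^+ db - r); last by rewrite /r; ring.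
      apply: prime_idealB => //; rewrite -(prednK db0) exprS.
      exact: prime_ideal_mulr.
    case/(prime_idealM primeP) => [|/(prime_ideal_exp primeP)] //.
    by move/(prime_ideal_inv primeP (iota_inv iota c0)).
  apply: (prime_ideal_exp primeP (n := db)); rewrite -(subrK (iota c * b ^+ n) (_ ^+ _)).
  apply: prime_idealD => //; apply: prime_ideal_mull => //.
  by rewrite -(prednK n0) exprS; apply: prime_ideal_mulr.
have nPb : ~ P b.
  move=> Pb; have x0 := prime_ideal_neq0 primeP nPx; apply: (nPx).
  have := bmax _ _ Gx x0; rewrite leq_eqVlt => /predU1P[e|/(small _ _ Gx)] //.
  by apply/(equal _ _ d'0 Gx x0 e).
move=> m0 Ga a0; split; last exact: small.
move=> Pa; rewrite ltn_neqAle bmax // andbT; apply/eqP => e.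
by apply/nPb/(equal _ _ m0 Ga a0 e).
Qed.

Lemma prime_at_infinity_unique P1 P2 :
  prime_ideal P1 -> homogeneous_ideal G P1 -> relevant P1 -> P1 h ->
  prime_ideal P2 -> relevant P2 -> P2 h -> forall a, P1 a -> P2 a.
Proof.
move=> prime1 hom1 rel1 P1h prime2 rel2 P2h a /hom1[s sP ->].
rewrite big_seq; elim/big_rec: _ => [|x y xs P2y]; first exact: prime_ideal0.
apply: prime_idealD => //; have [P1x [n Gx]] := sP _ xs.
have [->|x0] := eqVneq x 0; first exact: prime_ideal0.
have [n0|n0] := posnP n; last first.
  have [to_slope _] := mem_prime_at_infinity prime1 rel1 P1h n0 Gx x0.
  by have [_ of_slope] := mem_prime_at_infinity prime2 rel2 P2h n0 Gx x0; auto.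
rewrite n0 in Gx; have [c ex] := G0 Gx.
have c0 : c != 0 by apply: contraNneq x0 => c0; rewrite ex c0 rmorph0.
by move: P1x; rewrite ex => /(prime_ideal_inv prime1 (iota_inv iota c0)).
Qed.

End AtInfinity.
End KernelLine.

(** * Discrete valuation rings and regular points *)

Section RegularLocal.
Variable O : comNzRingType.
Hypothesis dom : is_domain O.

Lemma zero_ideal_prime : prime_ideal (fun x : O => x = 0).
Proof.
split=> [||x y]; last exact: dom.
  split=> [//|x y -> ->|a x ->]; by rewrite ?addr0 ?mulr0.
by move/eqP; rewrite oner_eq0.
Qed.

Lemma ideal_unit (I : O -> Prop) x : is_ideal I -> I x -> invertible x -> I 1.
Proof. by case=> _ _ IM Ix [y e]; rewrite -e mulrC; apply: IM. Qed.

Lemma field_regular : (forall x : O, x != 0 -> invertible x) -> regular_local_ring O.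
Proof.
move=> inv; have idealP (I : O -> Prop) : is_ideal I -> ~ I 1 -> forall x, I x -> x = 0.
  move=> idI I1 x Ix; apply/eqP; apply: contrapT => /negP /inv /(ideal_unit idI Ix) //.
split.
  move=> I idI; have [I1|I1] := pselect (I 1).
    exists [:: 1] => x; split=> [_|_]; last by rewrite -[x]mulr1; case: idI => _ _; apply.
    by exists (fun _ => x); rewrite big_ord1 /= mulr1.
  exists [::] => x; split=> [/(idealP _ idI I1) ->|[c ->]].
    by exists (fun _ => 0); rewrite big_ord0.
  by rewrite big_ord0; case: idI.
have [id0 n01 pr0] := zero_ideal_prime.
exists (fun x => x = 0); split.
- split=> // J idJ J1 _; exact: idealP.
- move=> m [idm m1 mmax] x; split; first exact: idealP.
  by move->; case: idm.
exists [::].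
  move=> x; split=> [->|[c ->]]; last by rewrite big_ord0.
  by exists (fun _ => 0); rewrite big_ord0.
split; first by exists (fun _ x => x = 0); split.
case=> Q [Qp /(_ 0%N isT)[_ [x Qx nQx]]].
have [idQ Q1 _] := Qp 1%N isT; have [[Q00 _ _] _ _] := Qp 0%N isT.
by apply: nQx; rewrite (idealP _ idQ Q1 x Qx).
Qed.

(** All nonzero elements are units times powers of [t]: the ideals are zero and
    the powers of [t]. *)
Lemma dvr_regular (t : O) : t != 0 -> ~ invertible t ->
  (forall x : O, x != 0 -> exists u n, invertible u /\ x = u * t ^+ n) ->
  regular_local_ring O.
Proof.
move=> t0 tu val.
have mem_t (P : O -> Prop) : prime_ideal P -> forall x, P x -> x != 0 -> P t.
  move=> primeP x Px x0; have [u [n [uu ex]]] := val _ x0.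
  move: Px; rewrite ex => /(prime_idealM primeP)[/(prime_ideal_inv primeP uu) //|].
  exact: prime_ideal_exp.
have dvd_t (I : O -> Prop) : is_ideal I -> ~ I 1 -> forall x, I x -> dvd t x.
  move=> idI I1 x Ix; have [->|x0] := eqVneq x 0; first exact: dvd0.
  have [u [[|n] [uu ex]]] := val _ x0.
    by case: I1; apply: ideal_unit idI Ix _; rewrite ex expr0 mulr1.
  by exists (u * t ^+ n); rewrite ex exprS mulrCA.
have id_t : is_ideal (dvd t).
  by split; [exact: dvd0 | exact: dvd_add | move=> a x; apply: dvd_mull].
have nt1 : ~ dvd t 1 by case=> c e; apply: tu; exists c.
split.
  move=> I idI; have [I0 ID IM] := idI.
  pose S n := `[< I (t ^+ n) >].
  have [ex|nex] := pselect (exists n, S n); last first.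
    exists [::] => x; split=> [Ix|[c ->]]; last by rewrite big_ord0.
    exists (fun _ => 0); rewrite big_ord0; apply/eqP; apply: contrapT => /negP x0.
    have [u [n [[v uv] exu]]] := val _ x0; apply: nex; exists n; apply/asboolP.
    by rewrite -[t ^+ n]mul1r -uv (mulrC u) -mulrA -exu; apply: IM.
  case: (ex_minnP ex) => n /asboolP In nmin; exists [:: t ^+ n] => x; split.
    move=> Ix; have [->|x0] := eqVneq x 0.
      by exists (fun _ => 0); rewrite big_ord1 mul0r.
    have [u [m [[v uv] exu]]] := val _ x0.
    have nm : (n <= m)%N.
      apply: nmin; apply/asboolP.
      by rewrite -[t ^+ m]mul1r -uv (mulrC u) -mulrA -exu; apply: IM.
    exists (fun _ => u * t ^+ (m - n)); rewrite big_ord1 /= -mulrA -exprD.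
    by rewrite subnK.
  by case=> c ->; rewrite big_ord1; apply: IM.
have max_t : maximal_ideal (dvd t).
  by split=> // J idJ J1 _ x Jx; apply: dvd_t Jx.
exists (dvd t); split=> //.
  move=> m [idm m1 mmax] x; split; first exact: dvd_t.
  by apply: mmax => //; apply: dvd_t.
exists [:: t].
  move=> x; split=> [[c ->]|[c ->]].
    by exists (fun _ => c); rewrite big_ord1 mulrC.
  by rewrite big_ord1; apply/dvd_mull/dvd_refl.
have prime_t : prime_ideal (dvd t).
  split=> // x y [c e].
  have [->|x0] := eqVneq x 0; first by left; apply: dvd0.
  have [->|y0] := eqVneq y 0; first by right; apply: dvd0.
  have [u [[|n] [uu ex]]] := val _ x0; last first.
    by left; exists (u * t ^+ n); rewrite ex exprS mulrCA.
  have [v [[|m] [vu ey]]] := val _ y0; last first.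
    by right; exists (v * t ^+ m); rewrite ey exprS mulrCA.
  case: tu; apply: (@invertible_mull _ t c); rewrite -e ex ey !expr0 !mulr1.
  exact: invertibleM.
split.
  exists (fun i => if i is 0%N then (fun x => x = 0) else dvd t); split.
    by case=> [|i] _; [exact: zero_ideal_prime | exact: prime_t].
  case=> // _; split=> [x ->|]; first exact: dvd0.
  by exists t; [exact: dvd_refl | apply/eqP].
case=> Q [Qp Qs]; have [id2 Q21 _] := Qp 2%N isT.
have [_ [y Q2y nQ1y]] := Qs 1%N isT; have [_ [x Q1x nQ0x]] := Qs 0%N isT.
have x0 : x != 0 by apply: (prime_ideal_neq0 (Qp 0%N isT)) nQ0x.
have [c ey] := dvd_t _ id2 Q21 y Q2y; apply: nQ1y; rewrite ey.
by apply: (prime_ideal_mulr (Qp 1%N isT)); apply: mem_t (Qp 1%N isT) _ Q1x x0.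
Qed.

End RegularLocal.

Section RegularPoint.
Variables (A : comNzRingType) (G : grading A) (p : proj_point G).
Hypothesis dom : is_domain A.
Local Open Scope quotient_scope.

Let frac (x : hfrac p) : hloc p := \pi_(hloc p) x.

Lemma hden_neq0 s : hden p s -> s != 0.
Proof. by case=> _; apply: (prime_ideal_neq0 (proj_prime p)). Qed.

Lemma hloc_pi_eq x y : frac x = frac y <-> hnum x * hdnm y = hnum y * hdnm x.
Proof.
split=> [/eqP/hequivP[t /hden_neq0 t0 /dom[]/eqP]|]; last exact: hloc_eq.
  by rewrite (negbTE t0).
by rewrite subr_eq0 => /eqP.
Qed.

Lemma hloc_piM x y : frac x * frac y = frac (hfracM x y).
Proof. exact: esym (pi_hlocM x y). Qed.

Lemma hloc_pi1 : frac (hfrac1 p) = 1.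
Proof. by rewrite /frac piE. Qed.

Lemma hloc_pi0 : frac (hfrac0 p) = 0.
Proof. by rewrite /frac piE. Qed.

Lemma hloc_pi_eq0 x : frac x = 0 <-> hnum x = 0.
Proof.
rewrite -hloc_pi0 hloc_pi_eq [hnum (hfrac0 p)]/(0 : A) [hdnm (hfrac0 p)]/(1 : A).
by rewrite mulr1 mul0r.
Qed.

Lemma hloc_piP (z : hloc p) : exists x, z = frac x.
Proof. by exists (repr z); rewrite /frac reprK. Qed.

Lemma hloc_domain : is_domain (hloc p).
Proof.
move=> z w; have [x ->] := hloc_piP z; have [y ->] := hloc_piP w.
rewrite hloc_piM => /hloc_pi_eq0; rewrite [hnum _]/(hnum x * hnum y).
by case/dom => e; [left | right]; apply/hloc_pi_eq0.
Qed.

Lemma hloc_invertible x : ~ p (hnum x) -> invertible (frac x).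
Proof.
move=> px; exists (frac (mk_hfrac (hdnmP x) (hnumP x) px)).
rewrite hloc_piM -hloc_pi1; apply/hloc_pi_eq.
change (hnum x * hdnm x * 1 = 1 * (hdnm x * hnum x)); ring.
Qed.

Lemma hloc_noninvertible x : p (hnum x) -> ~ invertible (frac x).
Proof.
move=> px [w]; have [y ->] := hloc_piP w; rewrite hloc_piM -hloc_pi1 => /hloc_pi_eq.
change (hnum x * hnum y * 1 = 1 * (hdnm x * hdnm y) -> False).
rewrite mulr1 mul1r => e.
have : p (hdnm x * hdnm y) by rewrite -e; apply: prime_ideal_mulr px; apply: proj_prime.
by case/(prime_idealM (proj_prime p)); apply: hdnmN.
Qed.

Lemma hloc_piX x n : exists y, [/\ frac x ^+ n = frac y, hnum y = hnum x ^+ n,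
  hdnm y = hdnm x ^+ n & hdeg y = (hdeg x * n)%N].
Proof.
elim: n => [|n [y [ey ny dy gy]]].
  by exists (hfrac1 p); rewrite !expr0 muln0 hloc_pi1.
exists (hfracM x y); rewrite !exprS ey hloc_piM mulnS -gy -ny -dy.
by split.
Qed.

Lemma hdenX s n : hden p s -> hden p (s ^+ n).
Proof.
move=> hs; elim: n => [|n IHn]; first by rewrite expr0; apply: hden1.
by rewrite exprS; apply: hdenM.
Qed.

(** If every homogeneous element is a power of [t] up to homogeneous elements
    outside [p], the valuation counting factors [t] makes the local ring a field
    or a discrete valuation ring. A uniformizer is [t ^ e] times a unit, where
    [e] is the least exponent for which this can have degree zero. *)
Lemma regular_point dt t : G dt t ->
  (forall m a, G m a -> a != 0 -> exists n c c',
     [/\ hden p c, hden p c' & a * c = t ^+ n * c']) ->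
  regular_local_ring (hloc p).
Proof.
move=> Gt val; have primep := proj_prime p.
have [pt|npt] := pselect (p t); last first.
  apply: (field_regular hloc_domain) => z; have [x ->] := hloc_piP z => x0.
  have nx0 : hnum x != 0 by apply: contra_neq x0 => /hloc_pi_eq0.
  have [n [c [c' [[_ pc] [_ pc'] e]]]] := val _ _ (hnumP x) nx0.
  apply: hloc_invertible => px; have : p (t ^+ n * c').
    by rewrite -e; apply: prime_ideal_mulr.
  by case/(prime_idealM primep) => [/(prime_ideal_exp primep)|].
have [t0|t0] := eqVneq t 0.
  apply: (field_regular hloc_domain) => z; have [x ->] := hloc_piP z => x0.
  have nx0 : hnum x != 0 by apply: contra_neq x0 => /hloc_pi_eq0.
  have [n [c [c' [hc [_ pc'] e]]]] := val _ _ (hnumP x) nx0.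
  apply: hloc_invertible => px; have n0 : n = 0%N.
    case: n e => // n /eqP; rewrite t0 exprS !mul0r => /eqP /dom[] z0.
      by rewrite z0 eqxx in nx0.
    by have := hden_neq0 hc; rewrite z0 eqxx.
  by apply: pc'; rewrite -[c']mul1r -(expr0 t) -n0 -e; apply: prime_ideal_mulr.
pose V n := `[< exists u v du, [/\ hden p u, ~ p v, G du u, (0 < n)%N &
                  G du (t ^+ n * v) /\ exists dv, G dv v] >].
have exV : exists n, V n.
  have [d [h [d0 Gh ph]]] := proj_relevant p.
  exists d; apply/asboolP; exists (h ^+ dt), 1, (d * dt)%N; split=> //.
  - by apply: hdenX; split=> //; exists d.
  - exact: proj1N.
  - exact: gpieceX.
  - by split; [rewrite mulr1 mulnC; apply: gpieceX | exists 0%N; apply: gpiece1].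
case: (ex_minnP exV) => e /asboolP[u [v [du [hu pv Gu e0 [Gtv [dv Gv]]]]]] emin.
have [[_ pu] hv] : hden p u /\ hden p v by split=> //; split=> //; exists dv.
pose tau := mk_hfrac Gtv Gu pu.
have ntau : hnum tau = t ^+ e * v by [].
have dtau : hdnm tau = u by [].
have tv0 : t ^+ e * v != 0 by apply: dom_mul_neq0; rewrite ?dom_exp_neq0 ?(hden_neq0 hv).
apply: (@dvr_regular _ hloc_domain (frac tau)).
- by apply/eqP => /hloc_pi_eq0/eqP; apply/negP.
- apply: hloc_noninvertible; apply: prime_ideal_mulr => //.
  by rewrite -(prednK e0) exprS; apply: prime_ideal_mulr.
move=> z; have [x ->] := hloc_piP z => {z} x0.
have nx0 : hnum x != 0 by apply: contra_neq x0 => /hloc_pi_eq0.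
have [n [c [c' [hc hc' ec]]]] := val _ _ (hnumP x) nx0.
have [[dc Gc] pc] := hc; have [[dc' Gc'] pc'] := hc'.
have Gs := hdnmP x; have ps := @hdnmN _ _ _ x.
have Gtc : G (hdeg x + dc)%N (t ^+ n * c') by rewrite -ec; apply: gpieceM => //; apply: hnumP.
have GX q : G (dt * q)%N (t ^+ q) by apply: gpieceX.
have tq q : t ^+ q != 0 by apply: dom_exp_neq0.
have deg1 : (dt * n + dc' = hdeg x + dc)%N.
  apply: (gpiece_uniq _ (gpieceM (GX n) Gc') Gtc).
  by rewrite dom_mul_neq0 // (hden_neq0 hc').
have deg2 : (dt * e + dv = du)%N by apply: (gpiece_uniq tv0 (gpieceM (GX e) Gv) Gtv).
(* minimality of e makes it divide n *)
have en : (e %| n)%N.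
  rewrite /dvdn; apply: contraT; rewrite -lt0n => r0.
  have ne := divn_eq n e; set q := (n %/ e)%N in ne; set r := (n %% e)%N in ne r0 *.
  suff /emin : V r by rewrite leqNgt ltn_pmod.
  have hc2 : hden p (c * hdnm x * v ^+ q).
    by apply: hdenM; [apply: hdenM => //; apply: hdnm_hden | apply: hdenX].
  have hv2 : hden p (c' * u ^+ q) by apply: hdenM => //; apply: hdenX.
  apply/asboolP; exists (c * hdnm x * v ^+ q), (c' * u ^+ q), (dc + hdeg x + dv * q)%N.
  split=> //; first by case: hv2.
    by apply: gpieceM; [apply: gpieceM | apply: gpieceX].
  split; last by exists (dc' + du * q)%N; apply: gpieceM => //; apply: gpieceX.
  have -> : (dc + hdeg x + dv * q = dt * r + (dc' + du * q))%N.
    by move: deg1; rewrite -deg2 ne; lia.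
  by apply: gpieceM => //; apply: gpieceM => //; apply: gpieceX.
have [q nq] := dvdnP en; have [y [ey ny dy gy]] := hloc_piX tau q.
have degw : (hdeg x + dc + dv * q)%N = (dc' + du * q)%N.
  by move: deg1; rewrite -deg2 nq; lia.
have hw : hden p (hdnm x * c * v ^+ q).
  by apply: hdenM; [apply: hdenM => //; apply: hdnm_hden | apply: hdenX].
have hw' : hden p (c' * u ^+ q) by apply: hdenM => //; apply: hdenX.
have Gw : G (dc' + du * q)%N (hdnm x * c * v ^+ q).
  by rewrite -degw; apply: gpieceM; [apply: gpieceM | apply: gpieceX].
have Gw' : G (dc' + du * q)%N (c' * u ^+ q) by apply: gpieceM => //; apply: gpieceX.
exists (frac (mk_hfrac Gw' Gw hw.2)), q; split.
  by apply: hloc_invertible; case: hw'.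
rewrite ey hloc_piM; apply/hloc_pi_eq.
change (hnum x * (hdnm x * c * v ^+ q * hdnm y) = c' * u ^+ q * hnum y * hdnm x).
rewrite ny dy ntau dtau.
apply: (dom_mulI dom (hden_neq0 hc)).
transitivity (hnum x * c * (hdnm x * c * v ^+ q * u ^+ q)); first by ring.
by rewrite ec nq mulnC exprM exprMn; ring.
Qed.

End RegularPoint.

(** * The weighted polynomial ring and its graded quotients *)

Section WeightedRing.
Variable k : closedFieldType.
Hypothesis k_char0 : [pchar k] =i pred0.
Local Notation R := {mpoly k[3]}.

Definition weighted : grading R := mpoly_grading k wt321.
Definition wtX (i : 'I_3) : nat := (3 - i)%N.

Lemma wt321E m : wt321 m = (\sum_(i < 3) m i * wtX i)%N.
Proof.
rewrite !big_ord_recl big_ord0 /wt321 /wtX /= !mnm_tnth addn0.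
have -> : lift ord0 ord0 = 1%R :> 'I_3 by apply: val_inj.
have -> : lift ord0 (lift ord0 ord0) = 2%:R :> 'I_3 by apply: val_inj.
by rewrite /bump /= subn0; lia.
Qed.

Lemma weighted_X (m : 'X_{1..3}) : weighted (wt321 m) ('X_[m] : R).
Proof. by apply/dhomogP => m'; rewrite msuppX inE => /eqP ->. Qed.

Lemma weighted_XU i : weighted (wtX i) ('X_i : R).
Proof.
rewrite (_ : wtX i = wt321 U_(i)%MM); first exact: weighted_X.
rewrite wt321E (bigD1 i) //= mnm1E eqxx mul1n big1 ?addn0 // => j ji.
by rewrite mnm1E eq_sym (negbTE ji).
Qed.

Lemma weighted_coeff d (a : R) m : weighted d a -> wt321 m != d -> a@_m = 0.
Proof. exact: dhomog_nemf_coeff. Qed.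

Lemma weightedC c : weighted 0%N (c%:MP : R).
Proof.
apply/dhomogP => m; rewrite msuppC; case: ifP => // _.
by rewrite inE => /eqP ->; apply: wt321_0.
Qed.

Lemma weighted0 (a : R) : weighted 0%N a -> exists c, a = c%:MP.
Proof.
move=> Ga; exists a@_0%MM; apply/mpolyP => m; rewrite mcoeffC.
have [->|m0] := eqVneq m 0%MM; first by rewrite mulr1.
rewrite mulr0 (weighted_coeff Ga) //.
apply: contra m0 => /eqP; rewrite /wt321 => e; apply/eqP/mnmP => i.
rewrite mnm0E; case: i => [[|[|[|//]]] lt].
- by rewrite (_ : Ordinal lt = 0%R); [lia | apply: val_inj].
- by rewrite (_ : Ordinal lt = 1%R); [lia | apply: val_inj].
- by rewrite (_ : Ordinal lt = 2%:R); [lia | apply: val_inj].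
Qed.

Lemma char_zero_ext (A : comNzRingType) (iota : {rmorphism k -> A}) : char_zero A.
Proof.
move=> n; rewrite -(rmorph_nat iota); apply/invertible_neq0/iota_inv.
by rewrite (iffLR (pcharf0P k) k_char0).
Qed.

Lemma domR : is_domain R. Proof. exact: idomain_is_domain. Qed.

Lemma char0R : char_zero R. Proof. exact: (@char_zero_ext _ (@mpolyC 3 k)). Qed.

Lemma weighted_norm :
  exists2 nu, additive_norm nu & forall d (a : R), a != 0 -> weighted d a -> nu a = d.
Proof.
apply: (graded_norm domR) => a a0 /weighted0[c e].
have c0 : c != 0 by rewrite -(mpolyC_eq0 3) -e.
by rewrite e; exists (c^-1)%:MP; rewrite -mpolyCM divff.
Qed.

(** Homogeneous elements of degree [N] have at most [(N + 1) ^ 2] coefficients,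
    indexed by the exponents of the first two variables. *)
Lemma weighted_dependent N (T : finType) (F : T -> R) :
  (forall t, weighted N (F t)) -> (N.+1 * N.+1 < #|T|)%N ->
  exists c : T -> k, (exists t, c t != 0) /\ \sum_t c t *: F t = 0.
Proof.
move=> GF card; pose I := ('I_N.+1 * 'I_N.+1)%type.
pose mon (p : I) : 'X_{1..3} :=
  [multinom nth 0%N [:: p.1 : nat; p.2 : nat; (N - 3 * p.1 - 2 * p.2)%N] i | i < 3].
pose M := \matrix_(i < #|T|, j < #|{: I}|) (F (enum_val i))@_(mon (enum_val j)).
have : kermx M != 0.
  rewrite kermx_eq0 /row_free neq_ltn; apply/orP; left.
  by apply: leq_ltn_trans (rank_leq_col _) _; rewrite card_prod !card_ord.
case/rowV0Pn => v /sub_kermxP vM v0; exists (fun t => v 0 (enum_rank t)); split.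
  have /rV0Pn[j vj] := v0; exists (enum_val j); by rewrite enum_valK.
apply/mpolyP => m; rewrite mcoeff0 raddf_sum /=.
have [wm|wm] := eqVneq (wt321 m) N; last first.
  by apply: big1 => t _; rewrite mcoeffZ (weighted_coeff (GF t) wm) mulr0.
have le0 : (m 0%R < N.+1)%N by rewrite -wm /wt321; lia.
have le1 : (m 1%R < N.+1)%N by rewrite -wm /wt321; lia.
pose p : I := (Ordinal le0, Ordinal le1).
have em : m = mon p.
  apply/mnmP => i; rewrite mnmE; case: i => [[|[|[|//]]] lt] /=.
  - by congr (m _); apply: val_inj.
  - by congr (m _); apply: val_inj.
  - rewrite (_ : Ordinal lt = 2%:R); last exact: val_inj.
    by rewrite -wm /wt321; lia.
have := congr1 (fun A : 'rV_#|{: I}| => A 0 (enum_rank p)) vM.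
rewrite !mxE /= => e; rewrite -[RHS]e (reindex_onto enum_val enum_rank) /=; last first.
  by move=> t _; rewrite enum_rankK.
apply: eq_big => [j|j _]; first by rewrite enum_valK eqxx.
by rewrite mcoeffZ !mxE enum_valK enum_rankK -em.
Qed.

End WeightedRing.

Section GradedQuotient.
Variable k : closedFieldType.
Hypothesis k_char0 : [pchar k] =i pred0.
Local Notation R := {mpoly k[3]}.
Variables (Q : comNzRingType) (phi : {rmorphism R -> Q}) (G : grading Q).
Hypothesis phi_piece : forall m a,
  G m a <-> exists2 r, weighted k m r & a = phi r.
Hypothesis dom : is_domain Q.

Definition scalars : {rmorphism k -> Q} := phi \o @mpolyC 3 k.

Lemma scalars_piece c : G 0%N (scalars c).
Proof. by apply/phi_piece; exists c%:MP => //; apply: weightedC. Qed.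

Lemma piece0_scalars a : G 0%N a -> exists c, a = scalars c.
Proof. by move/phi_piece => [r /weighted0[c ->] ->]; exists c. Qed.

Lemma phi_surj a : exists r, a = phi r.
Proof.
have [n [c [cP ->]]] := gpiece_span G a.
have ex i : exists r, c i = phi r by have /phi_piece[r _ ->] := cP i; exists r.
by have [r rP] := choice ex; exists (\sum_(i < n) r i);
  rewrite rmorph_sum; apply: eq_bigr => i _.
Qed.

Lemma phi_XU i : G (wtX i) (phi 'X_i).
Proof. by apply/phi_piece; exists 'X_i => //; apply: weighted_XU. Qed.

Let char0 : char_zero Q := char_zero_ext k_char0 scalars.

Section Derivation.
Variables (D : Q -> Q) (lndD : lnd D).

Lemma derivation_moves_variable a : D a != 0 ->
  exists i, D (phi 'X_i) != 0.
Proof.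
move=> Da; apply/not_existsP => h; move/eqP: Da; apply; have [r ->] := phi_surj a.
have kX i : D (phi 'X_i) = 0 by apply/eqP; apply: contrapT => /negP; apply: h.
rewrite (mpolyE r) rmorph_sum (lnd_sum lndD) big1 // => m _.
rewrite -mul_mpolyC rmorphM; apply: (ker_mul lndD).
  exact: (ker_iota scalars dom char0 lndD).
rewrite mpolyXE_id rmorph_prod; elim/big_ind: _ => [|x y|i _].
- exact: (lnd1 lndD).
- exact: (ker_mul lndD).
- by rewrite rmorphXn; apply: (ker_exp lndD).
Qed.

(** The slope of a homogeneous element is bounded by the largest slope of the
    variables; as [6] is a common multiple of their weights, six times the slopes
    of the variables are natural numbers. *)
Lemma slope_bound s m a :
  (forall i, phi 'X_i != 0 -> (6 * ddeg lndD (phi 'X_i) <= s * wtX i)%N) ->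
  G m a -> (6 * ddeg lndD a <= s * m)%N.
Proof.
move=> sX /phi_piece[r Gr ->].
pose ok n b := (6 * ddeg lndD b <= s * n)%N.
have ok0 n : ok n 0 by rewrite /ok (ddeg0 lndD).
have okM n n' b b' : ok n b -> ok n' b' -> ok (n + n')%N (b * b').
  have [-> _ _|b0] := eqVneq b 0; first by rewrite mul0r.
  have [-> _ _|b'0] := eqVneq b' 0; first by rewrite mulr0.
  by rewrite /ok (ddegM dom char0) // !mulnDr; lia.
have ok_ker b : D b = 0 -> ok 0%N b by rewrite /ok => /(ddeg_ker lndD) ->.
have okX i : ok (wtX i) (phi 'X_i).
  by have [->|/sX] := eqVneq (phi 'X_i) 0; first exact: ok0.
have okXn i n : ok (n * wtX i)%N (phi 'X_i ^+ n).
  elim: n => [|n IHn]; first by rewrite expr0; apply/ok_ker/(lnd1 lndD).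
  by rewrite exprS mulSn; apply: okM.
have okXm (u : 'X_{1..3}) : ok (wt321 u) (phi 'X_[u]).
  rewrite wt321E mpolyXE_id rmorph_prod; elim/big_rec2: _ => [|i n b _ okb].
    exact/ok_ker/(lnd1 lndD).
  by rewrite rmorphXn; apply: okM.
rewrite -/(ok m _) (mpolyE r) rmorph_sum; apply: (@big_ind _ (ok m)) => //.
  move=> b b'; rewrite /ok !(mulnC 6) -!(leq_divRL _ _ (isT : (0 < 6)%N)).
  exact: ddegD.
move=> u _; have [wu|wu] := eqVneq (wt321 u) m; last first.
  by rewrite (weighted_coeff Gr wu) scale0r rmorph0.
rewrite -mul_mpolyC rmorphM -[X in ok X]add0n; apply: okM; last by rewrite -wu.
exact/ok_ker/(ker_iota scalars dom char0 lndD).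
Qed.

Lemma max_slope_exists m a : (0 < m)%N -> G m a -> a != 0 ->
  exists db b, max_slope G lndD db b.
Proof.
move=> m0 Ga a0; have [i0 Xi0] : exists i, phi 'X_i != 0.
  apply/not_existsP => h; move/eqP: a0; apply; have /phi_piece[r Gr ->] := Ga.
  have X0 i : phi 'X_i = 0 by apply/eqP; apply: contrapT => /negP; apply: h.
  rewrite (mpolyE r) rmorph_sum big1 // => u _; have [wu|wu] := eqVneq (wt321 u) m.
    have [i ui] : exists i, (0 < u i)%N.
      apply/not_existsP => u0; move: m0; rewrite -wu wt321E big1 // => i _.
      by have := u0 i; case: (u i).
    rewrite -mul_mpolyC rmorphM mpolyXE_id rmorph_prod (bigD1 i) //= rmorphXn.
    by rewrite X0 expr0n -leqn0 leqNgt ui mul0r mulr0.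
  by rewrite (weighted_coeff Gr wu) scale0r rmorph0.
pose s i := (ddeg lndD (phi 'X_i) * (6 %/ wtX i))%N.
have sw i : (s i * wtX i = 6 * ddeg lndD (phi 'X_i))%N.
  by rewrite /s -mulnA [X in (_ * X)%N](_ : _ = 6)%N 1?mulnC //; case: i => [[|[|[|]]]].
have [i Xi imax] : exists2 i, phi 'X_i != 0 &
    forall j, phi 'X_j != 0 -> (s j <= s i)%N.
  by case: (@arg_maxnP _ i0 (fun i => phi 'X_i != 0) s Xi0) => i; exists i.
exists (wtX i), (phi 'X_i); split=> //.
- by case: i {Xi imax} => [[|[|[|]]]].
- exact: phi_XU.
move=> n c Gc c0; rewrite -(leq_pmul2l (isT : 0 < 6)%N).
have := @slope_bound (s i) n c _ Gc; rewrite -(leq_pmul2r (_ : 0 < wtX i)%N); last first.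
  by case: i {Xi imax} => [[|[|[|]]]].
rewrite mulnA => h; apply: (leq_trans (h _)).
  move=> j Xj; apply: (@leq_trans (s j * wtX j)%N); last by rewrite leq_mul2r imax ?orbT.
  by rewrite sw.
by rewrite mulnAC sw mulnA.
Qed.

End Derivation.

(** Cutting out [H] from the three-dimensional ring leaves transcendence degree
    two: the [N ^ 3] monomials below outnumber the coefficients available in
    their degree, and the relation found is divided by its power of [H]. *)
Lemma quotient_thin dH H : weighted k dH H -> H != 0 -> phi H = 0 -> thin scalars G.
Proof.
move=> GH H0 phiH L _ _ _ L0 /phi_piece[u Gu ->] /phi_piece[v Gv ->] /phi_piece[w Gw ->].
(* N ^ 3 must exceed (L * K + 1) ^ 2, which is at most (B * N) ^ 2 *)
pose B := (L * (dH + 2) + 1)%N; pose N := (B * B + 1)%N.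
pose K := ((dH + 2) * N)%N.
pose F (t : 'I_N * 'I_N * 'I_N) : R := (H ^+ L) ^+ t.1.1 *
  (w ^+ t.1.2 * u ^+ t.2 * v ^+ (K - dH * t.1.1 - t.1.2 - t.2)).
have GF t : weighted k (L * K)%N (F t).
  rewrite /F; move: t.1.1 t.1.2 t.2 => a r i.
  have le : (dH * a + r + i <= K)%N.
    rewrite /K mulnDl; have := ltn_ord a; have := ltn_ord r; have := ltn_ord i.
    move=> iN rN aN; have : (dH * a <= dH * N)%N by rewrite leq_mul2l ltnW ?orbT.
    by lia.
  have -> : (L * K = dH * L * a + (L * r + L * i + L * (K - dH * a - r - i)))%N.
    have -> : (dH * L * a = L * (dH * a))%N by lia.
    by rewrite -!mulnDr; congr (_ * _)%N; lia.
  apply: gpieceM; first by apply/gpieceX/gpieceX.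
  by apply: gpieceM; [apply: gpieceM |]; apply: gpieceX.
have card : ((L * K).+1 * (L * K).+1 < #|{: 'I_N * 'I_N * 'I_N}|)%N.
  rewrite !card_prod !card_ord /K mulnA.
  have le : ((L * (dH + 2) * N).+1 <= B * N)%N by rewrite /B mulnDl mul1n; lia.
  apply: (leq_ltn_trans (leq_mul le le)).
  have -> : (B * N * (B * N) = N * N * (B * B))%N by lia.
  by rewrite ltn_pmul2l ?muln_gt0 /N; lia.
have [c [[t0 ct0] e]] := weighted_dependent GF card.
have exa : exists a, [exists r : 'I_N, [exists i : 'I_N, [exists a' : 'I_N,
    (a == a' :> nat) && (c (a', r, i) != 0)]]].
  case: t0 ct0 => [[a r] i] ct0; exists (a : nat).
  by do 3!(apply/existsP; eexists); apply/andP; split; first exact: eqxx; exact: ct0.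
case: (ex_minnP exa) => a0 /existsP[r0 /existsP[i0 /existsP[a1 /andP[/eqP ea c0]]]] amin.
pose Psi (a : 'I_N) := \sum_(r < N) \sum_(i < N)
  c (a, r, i) *: (w ^+ r * u ^+ i * v ^+ (K - dH * a - r - i)).
have Psi0 (a : 'I_N) : (a < a1)%N -> Psi a = 0.
  move=> lt; rewrite /Psi big1 // => r _; rewrite big1 // => i _.
  have [->|ca] := eqVneq (c (a, r, i)) 0; first by rewrite scale0r.
  suff /amin : [exists r : 'I_N, [exists i : 'I_N, [exists a' : 'I_N,
      (a == a' :> nat) && (c (a', r, i) != 0)]]] by rewrite ea leqNgt lt.
  by apply/existsP; exists r; apply/existsP; exists i; apply/existsP; exists a; rewrite eqxx.
have {e} e : \sum_(a < N) (H ^+ L) ^+ a * Psi a = 0.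
  transitivity (\sum_a \sum_r \sum_i c (a, r, i) *: F (a, r, i)).
    apply: eq_bigr => a _; rewrite /Psi mulr_sumr; apply: eq_bigr => r _.
    by rewrite mulr_sumr; apply: eq_bigr => i _; rewrite -scalerAr.
  rewrite pair_bigA /= pair_bigA /= -[RHS]e.
  by apply: eq_bigr => -[[a r] i].
have PsiH : phi (Psi a1) = 0.
  suff -> : Psi a1 = - H ^+ L * \sum_(a < N | (a1 < a)%N) (H ^+ L) ^+ (a - a1).-1 * Psi a.
    by rewrite rmorphM rmorphN rmorphXn phiH expr0n -leqn0 leqNgt L0 oppr0 mul0r.
  have HL0 : (H ^+ L) ^+ a1 != 0 by rewrite !expf_neq0.
  apply: (mulfI HL0); apply/eqP; rewrite mulNr mulrN -addr_eq0 -[X in _ == X]e; apply/eqP.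
  rewrite [RHS](bigD1 a1) //=; congr (_ + _).
  rewrite [RHS](bigID (fun a : 'I_N => (a1 < a)%N)) /= [X in _ = _ + X]big1 ?addr0; last first.
    move=> a /andP[ne]; rewrite -leqNgt => le; rewrite Psi0 ?mulr0 //.
    by rewrite ltn_neqAle le andbT.
  rewrite !mulr_sumr; apply: eq_big => [a|a lt].
    by rewrite andb_idl // => lt; rewrite -val_eqE /= gtn_eqF.
  rewrite !mulrA -exprSr -exprD; congr (_ ^+ _ * _); lia.
exists N, (K - dH * a1)%N, (fun r i => c (a1, r, i)); split.
- rewrite /K mulnDl; have := ltn_ord a1 => lt.
  have : (dH * a1 <= dH * N)%N by rewrite leq_mul2l ltnW ?orbT.
  lia.
- by exists r0, i0.
rewrite -[RHS]PsiH rmorph_sum; apply: eq_bigr => r _.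
rewrite rmorph_sum; apply: eq_bigr => i _.
by rewrite -mul_mpolyC !rmorphM !rmorphXn.
Qed.

End GradedQuotient.

(** * Homogeneous derivations of the weighted polynomial ring *)

Section QuotientByPrime.
Variable k : closedFieldType.
Hypothesis k_char0 : [pchar k] =i pred0.
Local Notation R := {mpoly k[3]}.
Local Notation weighted := (weighted k).

Variables (H : R) (dH : nat).
Hypotheses (GH : H \is dH.-homog for wt321) (primeH : prime_elt H).

Local Notation Q := (principal_quot H).
Local Notation phi := (to_principal_quot H).
Local Notation GQ := (quot_grading GH).

Lemma quot_eq0 r : phi r = 0 <-> dvd H r.
Proof.
have [_ Hu _] := primeH; have eH : proper_gen H = H.
  by rewrite /proper_gen; case: asboolP.
rewrite to_principal_quot_eq0 eH.
by split=> -[c ->]; exists c; rewrite mulrC.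
Qed.

Lemma quot_domain : is_domain Q.
Proof.
move=> x y; have [a ->] := to_principal_quot_surj x.
have [b ->] := to_principal_quot_surj y; rewrite -rmorphM => /quot_eq0.
by case: primeH => _ _ /[apply] -[] /quot_eq0; [left | right].
Qed.

Lemma quot_pieceP m a : GQ m a <-> exists2 r, weighted m r & a = phi r.
Proof. by []. Qed.

Local Notation scal := (scalars phi).

Variables (D : R -> R) (e1 e2 : nat).
Hypotheses (lndD : lnd D) (homD : homog_der D weighted e1 e2).
Hypotheses (DH : D H = 0) (D_mod : exists r, ~ dvd H (D r)).

(** Well defined because [D] preserves the ideal generated by [H]. *)
Definition quot_der (a : Q) : Q := phi (D (projT1 (cid (to_principal_quot_surj a)))).

Lemma quot_derE r : quot_der (phi r) = phi (D r).
Proof.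
rewrite /quot_der; case: cid => r' /= e; apply/eqP; rewrite -subr_eq0 -rmorphB; apply/eqP.
rewrite quot_eq0 -(lndB lndD); have : phi (r' - r) = 0 by rewrite rmorphB /= -e subrr.
move/quot_eq0 => [c ->]; have [_ DM _] := lndD.
by rewrite DM DH mul0r add0r; exists (D c).
Qed.

Lemma iter_quot_der n r : iter n quot_der (phi r) = phi (iter n D r).
Proof. by elim: n => //= n ->; rewrite quot_derE. Qed.

Lemma quot_lnd : lnd quot_der.
Proof.
have [DD DM Dn] := lndD; split.
- move=> x y; have [a ->] := to_principal_quot_surj x.
  have [b ->] := to_principal_quot_surj y.
  by rewrite -rmorphD !quot_derE DD rmorphD.
- move=> x y; have [a ->] := to_principal_quot_surj x.
  have [b ->] := to_principal_quot_surj y.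
  by rewrite -rmorphM !quot_derE DM rmorphD !rmorphM.
- move=> x; have [a ->] := to_principal_quot_surj x; have [n e] := Dn a.
  by exists n; rewrite iter_quot_der e rmorph0.
Qed.

Lemma quot_homog_der : homog_der quot_der GQ e1 e2.
Proof.
move=> m a /quot_pieceP[r Gr ->]; rewrite quot_derE => n0.
have Dr : D r != 0 by apply: contraNneq n0 => ->; rewrite rmorph0.
have [m' em Gm] := homD Gr Dr; exists m' => //; apply/quot_pieceP.
by exists (D r).
Qed.

Let char0Q : char_zero Q := char_zero_ext k_char0 scal.

(** Cutting by [H] leaves transcendence degree two, and the kernel loses one more
    since the induced derivation is not zero. *)
Lemma quot_kernel_line : kernel_line scal quot_der GQ.
Proof.
have [r Dr] := D_mod; have [H0 _ _] := primeH.
have Dr0 : quot_der (phi r) != 0 by rewrite quot_derE; apply/eqP => /quot_eq0.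
have [i DXi] := derivation_moves_variable k_char0 quot_pieceP quot_domain quot_lnd Dr0.
apply: (thin_kernel_line quot_domain char0Q quot_lnd (piece0_scalars quot_pieceP)
  _ _ (phi_XU quot_pieceP i) DXi).
  apply: (quotient_thin quot_pieceP GH H0).
  by apply/quot_eq0; apply: dvd_refl.
by case: i {DXi} => [[|[|[|]]]].
Qed.

(** In the curve [H = 0] the kernel has only one function up to powers. *)
Lemma kernel_proportional dg dh g h : weighted dg g -> weighted dh h ->
  D g = 0 -> D h = 0 -> ~ dvd H g -> ~ dvd H h ->
  exists2 c, c != 0 & dvd H (g ^+ dh - c%:MP * h ^+ dg).
Proof.
move=> Gg Gh Dg Dh Hg Hh.
have Kg : quot_der (phi g) = 0 by rewrite quot_derE Dg rmorph0.
have Kh : quot_der (phi h) = 0 by rewrite quot_derE Dh rmorph0.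
have h0 : phi h != 0 by apply/eqP => /quot_eq0.
have g0 : phi g != 0 by apply/eqP => /quot_eq0.
have QGg : GQ dg (phi g) by exists g.
have QGh : GQ dh (phi h) by exists h.
have [c e] := kernel_powers quot_domain quot_lnd quot_kernel_line QGh Kh h0 QGg Kg.
exists c.
  apply: contraTneq (dom_exp_neq0 quot_domain dh g0) => c0.
  by rewrite e c0 rmorph0 mul0r eqxx.
apply/quot_eq0; have -> : phi (g ^+ dh - c%:MP * h ^+ dg) =
    phi g ^+ dh - scal c * phi h ^+ dg by rewrite rmorphB rmorphM !rmorphXn.
by rewrite e subrr.
Qed.

Section Pushforward.
Variable P : R -> Prop.
Hypotheses (primeP : prime_ideal P) (PH : P H).

Definition push_ideal (a : Q) := exists2 r, P r & a = phi r.

Lemma push_idealE r : push_ideal (phi r) <-> P r.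
Proof.
split=> [[r' Pr' e]|Pr]; last by exists r.
have : phi (r - r') = 0 by rewrite rmorphB /= e subrr.
move/quot_eq0/(prime_ideal_dvd primeP)/(_ PH) => Prr.
by rewrite -(subrK r' r); apply: prime_idealD.
Qed.

Lemma push_ideal_prime : prime_ideal push_ideal.
Proof.
split.
- split.
  + by exists 0; rewrite ?rmorph0 //; apply: prime_ideal0.
  + move=> x y [a Pa ->] [b Pb ->]; exists (a + b); rewrite ?rmorphD //.
    exact: prime_idealD.
  + move=> x y [b Pb ->]; have [a ->] := to_principal_quot_surj x.
    by exists (a * b); rewrite ?rmorphM //; apply: prime_ideal_mull.
- by rewrite -(rmorph1 phi) => /push_idealE; case: primeP.
- move=> x y; have [a ->] := to_principal_quot_surj x.
  have [b ->] := to_principal_quot_surj y; rewrite -rmorphM => /push_idealE.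
  by case/(prime_idealM primeP) => ?; [left | right]; apply/push_idealE.
Qed.

Lemma push_ideal_homogeneous : homogeneous_ideal weighted P ->
  homogeneous_ideal GQ push_ideal.
Proof.
move=> homP x [a /homP[s sP ->] ->]; exists (map phi s); last first.
  by rewrite rmorph_sum big_map.
move=> _ /mapP[b /sP[Pb [d Gb]] ->]; split; first exact/push_idealE.
by exists d; exists b.
Qed.

Lemma push_ideal_relevant : relevant weighted P -> relevant GQ push_ideal.
Proof.
move=> [d [a [d0 Ga nPa]]]; exists d, (phi a); split=> //; first by exists a.
by move/push_idealE.
Qed.

End Pushforward.

(** The curve [H = 0] minus the zeros of the kernel element [h] is an affine
    line, and only one point is missing. *)
Lemma prime_over_unique dh h P1 P2 : (0 < dh)%N -> weighted dh h -> D h = 0 ->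
  ~ dvd H h ->
  prime_ideal P1 -> homogeneous_ideal weighted P1 -> relevant weighted P1 ->
  P1 H -> P1 h ->
  prime_ideal P2 -> relevant weighted P2 -> P2 H -> P2 h ->
  forall a, P1 a -> P2 a.
Proof.
move=> dh0 Gh Dh Hh prime1 hom1 rel1 P1H P1h prime2 rel2 P2H P2h a P1a.
have Kh : quot_der (phi h) = 0 by rewrite quot_derE Dh rmorph0.
have h0 : phi h != 0 by apply/eqP => /quot_eq0.
have QGh : GQ dh (phi h) by exists h.
have [db [b slope]] := max_slope_exists k_char0 quot_pieceP quot_domain quot_lnd dh0 QGh h0.
apply/(push_idealE prime2 P2H).
apply: (prime_at_infinity_unique quot_domain char0Q
  (piece0_scalars quot_pieceP) (scalars_piece quot_pieceP) quot_kernel_line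
  quot_homog_der slope dh0 QGh Kh h0 (push_ideal_prime prime1 P1H)
  (push_ideal_homogeneous prime1 P1H hom1) (push_ideal_relevant prime1 P1H rel1) _
  (push_ideal_prime prime2 P2H) (push_ideal_relevant prime2 P2H rel2)).
- by apply/push_idealE.
- by apply/push_idealE.
- by apply/push_idealE.
Qed.

(** On that affine line division with remainder makes a homogeneous element of
    least degree a generator of the ideal of a point. *)
Lemma regular_off_kernel (p : proj_point GQ) dh h : (0 < dh)%N -> weighted dh h ->
  D h = 0 -> ~ p (phi h) -> regular_local_ring (hloc p).
Proof.
move=> dh0 Gh Dh ph; have primep := proj_prime p.
have Kh : quot_der (phi h) = 0 by rewrite quot_derE Dh rmorph0.
have h0 : phi h != 0 by apply: prime_ideal_neq0 primep _ ph.
have QGh : GQ dh (phi h) by exists h.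
have ker_unit m e : GQ m e -> quot_der e = 0 -> e != 0 -> hden p e.
  move=> Ge Ke e0; split; first by exists m.
  have [c ec] := kernel_powers quot_domain quot_lnd quot_kernel_line QGh Kh h0 Ge Ke.
  have c0 : c != 0.
    apply: contraTneq (dom_exp_neq0 quot_domain dh e0) => c0.
    by rewrite ec c0 rmorph0 mul0r eqxx.
  move=> pe; apply: ph; have : p (scal c * phi h ^+ m).
    by rewrite -ec -(prednK dh0) exprS; apply: prime_ideal_mulr.
  case/(prime_idealM primep) => [|/(prime_ideal_exp primep)] //.
  by move/(prime_ideal_inv primep (iota_inv scal c0)).
have [r Dr] := D_mod.
have Dr0 : quot_der (phi r) != 0 by rewrite quot_derE; apply/eqP => /quot_eq0.
have [i DXi] := derivation_moves_variable k_char0 quot_pieceP quot_domain quot_lnd Dr0.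
have [n [Ds DDs]] := local_slice_exists quot_lnd DXi.
set s := iter n _ _ in Ds DDs.
have s0 : s != 0 by apply: contraNneq Ds => ->; rewrite (lnd0 quot_lnd).
have [ds _ Gs] := homog_iter quot_lnd quot_homog_der (phi_XU quot_pieceP i) s0.
pose S j := `[< exists m a, [/\ GQ m a, a != 0, p a & ddeg quot_lnd a = j] >].
have [ex|nex] := pselect (exists j, S j); last first.
  apply: (regular_point quot_domain (gpiece1 GQ)) => m a Ga a0.
  exists 0%N, 1, a; split; [exact: hden1| |by rewrite expr0 mul1r mulr1].
  split; first by exists m.
  by move=> pa; apply: nex; exists (ddeg quot_lnd a); apply/asboolP; exists m, a.
case: (ex_minnP ex) => j /asboolP[dt [t [Gt t0 pt dtj]]] jmin.
apply: (regular_point quot_domain Gt) => m a.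
have [N] := ubnP (nil_index quot_lnd a); elim: N m a => // N IHN m a.
rewrite ltnS => aN Ga a0; have [pa|pa] := pselect (p a); last first.
  exists 0%N, 1, a; split; [exact: hden1| |by rewrite expr0 mul1r mulr1].
  by split=> //; exists m.
have [e [de [q [u [Ke [e0 Ge] eq Gu hu]]]]] := graded_division quot_domain char0Q quot_lnd
  quot_homog_der Gs Ds DDs Gt t0 Ga.
have he := ker_unit _ _ Ge Ke e0.
have u0 : u = 0.
  case: hu => // lt; apply/eqP; apply: contrapT => /negP u0.
  have : p u.
    have -> : u = e * a - q * t by rewrite eq; ring.
    by apply: prime_idealB => //; apply: prime_ideal_mull.
  move=> pu; suff /jmin : S (ddeg quot_lnd u) by rewrite -dtj leqNgt lt.
  by apply/asboolP; exists (de + m)%N, u.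
rewrite u0 addr0 in eq; have ea0 : e * a != 0 := dom_mul_neq0 quot_domain e0 a0.
have q0 : q != 0 by apply: contraNneq ea0 => z; rewrite eq z mul0r.
have Gqt : GQ (de + m)%N (q * t) by rewrite -eq; apply: gpieceM.
have qt0 : q * t != 0 by rewrite -eq.
have [dq [_ [_ Gq _]]] := homog_factor quot_domain qt0 Gqt.
have dt0 : (0 < j)%N.
  rewrite -dtj lt0n; apply/eqP => /ddeg0_ker Kt.
  by have [_ []] := ker_unit _ _ Gt Kt t0.
have [|n' [c [c' [hc hc' ec]]]] := IHN dq q _ Gq q0.
  apply: leq_trans aN; rewrite !(nil_indexE quot_lnd) // ltnS.
  have := ddegM quot_domain char0Q quot_lnd e0 a0.
  rewrite (ddeg_ker quot_lnd Ke) eq (ddegM quot_domain char0Q quot_lnd q0 t0) dtj.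
  by rewrite add0n => <-; rewrite -[X in (X < _)%N]addn0 ltn_add2l.
exists n'.+1, (e * c), c'; split=> //; first exact: hdenM.
by rewrite mulrCA mulrA eq mulrAC ec exprS; ring.
Qed.

End QuotientByPrime.

(** * Derivations of degree at most one along a curve with two singular points *)

Section DivideDerivation.
Variable k : closedFieldType.
Hypothesis k_char0 : [pchar k] =i pred0.
Local Notation R := {mpoly k[3]}.
Local Notation weighted := (weighted k).

Variables (D : R -> R) (e1 e2 : nat).
Hypotheses (lndD : lnd D) (homD : homog_der D weighted e1 e2).
Hypothesis D_neq0 : exists a, D a != 0.

Lemma moved_homog : exists m a, weighted m a /\ D a != 0.
Proof.
have [a Da] := D_neq0; apply/not_existsP => h; move/eqP: Da; apply.
have [n /(_ n (leqnn n))[_ ->]] := comp_bound weighted a.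
rewrite (lnd_sum lndD) big1 // => i _; apply/eqP; apply: contrapT => /negP Dc.
by apply: (h i); exists (comp weighted a i); split=> //; apply: comp_gpiece.
Qed.

(** Removing from [D] all the factors [H] keeps the kernel and makes [D]
    nonzero modulo [H]. *)
Lemma divide_derivation H dH : weighted dH H -> prime_elt H -> D H = 0 ->
  exists D' e, [/\ lnd D', homog_der D' weighted e1 e,
    forall r, D r = 0 -> D' r = 0 & exists r, ~ dvd H (D' r)].
Proof.
move=> GH primeH DH; have [H0 Hu _] := primeH.
have [nu nuP nu_homog] := weighted_norm k.
have [m0 [a0 [Ga0 Da0]]] := moved_homog.
pose S n := `[< forall r, dvd (H ^+ n) (D r) >].
have S0 : exists n, S n.
  by exists 0%N; apply/asboolP => r; rewrite expr0; exists (D r); rewrite mul1r.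
have ub n : S n -> (n <= nu (D a0))%N.
  move/asboolP/(_ a0) => [c e].
  have c0 : c != 0 by apply: contraNneq Da0 => z; rewrite e z mulr0.
  rewrite e nuP.1 ?dom_exp_neq0 //; last exact: domR.
  suff : (n <= nu (H ^+ n))%N by lia.
  elim: n {e} => // n IHn; rewrite exprS nuP.1 ?dom_exp_neq0 //; last exact: domR.
  by have := norm_gt0 nuP H0 Hu; lia.
case: (ex_maxnP S0 ub) => n /asboolP Sn nmax; have [D' D'E] := choice Sn.
have Hn0 : H ^+ n != 0 by rewrite dom_exp_neq0 //; exact: domR.
have KHn : D (H ^+ n) = 0 by apply: (ker_exp lndD).
have [DD DM Dn] := lndD.
have inj x y : H ^+ n * x = H ^+ n * y -> x = y by apply: dom_mulI => //; exact: domR.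
have D'_ker r : D r = 0 -> D' r = 0.
  by move=> Dr; apply: inj; rewrite -D'E Dr mulr0.
have D'iter j r : iter j D r = H ^+ (n * j) * iter j D' r.
  elim: j => [|j IHj]; first by rewrite muln0 expr0 mul1r.
  rewrite iterS IHj DM (ker_exp lndD) // mul0r add0r D'E mulrA -exprD.
  by rewrite addnC -mulnS.
exists D', (e2 + n * dH)%N; split=> //.
- split=> [a b|a b|a].
  + by apply: inj; rewrite mulrDr -!D'E.
  + by apply: inj; rewrite -D'E DM !D'E; ring.
  + have [j e] := Dn a; exists j; move: e; rewrite D'iter => /domR[] // /eqP.
    by rewrite (negbTE (dom_exp_neq0 (@domR k) _ H0)).
- move=> m a Ga D'a; have Da : D a != 0 by rewrite D'E dom_mul_neq0 //; exact: domR.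
  have [m' em Gm] := homD Ga Da.
  have [c [e [eD ee Gc]]] := homog_dvd (@domR k) Hn0 (gpieceX n GH) Gm Da
    (Sn a).
  exists e; last by rewrite -(inj _ _ (etrans (esym eD) (D'E a))).
  by rewrite -em -ee (mulnC n) addnAC [RHS]addnAC; lia.
- apply/not_existsP => h; suff /nmax : S n.+1 by rewrite ltnn.
  apply/asboolP => r; have [c e] : dvd H (D' r) by apply: contrapT; apply: h.
  by exists c; rewrite D'E e exprSr mulrA.
Qed.

(** The kernel is not a family of lines: the degree of [D] is bounded linearly
    on the pieces of [R], whose dimensions grow quadratically. *)
Lemma kernel_pair : exists m g h, [/\ weighted m g, weighted m h, D g = 0, D h = 0
  & h != 0 /\ forall c, g <> c%:MP * h].
Proof.
apply: contrapT => npair.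
have line : kernel_line (@mpolyC 3 k) D weighted.
  move=> m a b Ga Gb Da Db b0; apply: contrapT => nc; apply: npair.
  exists m, a, b; split=> //; split=> // c e; apply: nc; by exists c.
have idP m a : weighted m a <-> exists2 r, weighted m r & a = @idfun R r.
  by split=> [Ga|[r Gr ->]] //; exists a.
have X2 : 'X_ord_max != 0 :> R.
  apply/eqP => /(congr1 (mcoeff U_(ord_max))); rewrite mcoeffXU eqxx mcoeff0.
  by move/eqP; rewrite oner_eq0.
have [db [b [db0 _ _ bmax]]] := max_slope_exists k_char0 idP (@domR k) lndD
  (isT : 0 < wtX ord_max)%N (weighted_XU k ord_max) X2.
(* M ^ 2 monomials of degree 12 * M, on which the degree of D is below M ^ 2 *)
have [M eM] : exists M, M = (12 * ddeg lndD b + 2)%N by eexists.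
have M0 : (0 < M)%N by rewrite eM addn2.
have [n en] : exists n, n.+1 = (M * M)%N.
  by exists (M * M).-1; rewrite prednK // muln_gt0 M0.
pose mon (i : nat) : 'X_{1..3} := [multinom nth 0%N
  [:: (2 * (i %/ M))%N; (3 * (i %% M))%N; (12 * M - 6 * (i %/ M) - 6 * (i %% M))%N] j | j < 3].
have monw (i : 'I_n.+1) : wt321 (mon i) = (12 * M)%N.
  have iM : (i < M * M)%N by rewrite -en.
  have := ltn_pmod i M0; have : (i %/ M < M)%N by rewrite ltn_divLR.
  by rewrite wt321E !big_ord_recl big_ord0 !mnmE /wtX /= /bump /= !addn0; lia.
have mon_inj (i j : 'I_n.+1) : mon i = mon j -> i = j.
  move=> e; apply: val_inj; rewrite /= (divn_eq i M) (divn_eq j M).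
  have := congr1 (fun m : 'X_{1..3} => m ord0) e.
  have := congr1 (fun m : 'X_{1..3} => m (lift ord0 ord0)) e.
  by rewrite !mnmE /= => e3 e2'; congr (_ * _ + _)%N; lia.
pose F (i : 'I_n.+1) : R := 'X_[mon i].
have GF i : weighted (12 * M)%N (F i) by rewrite -(monw i); apply: weighted_X.
have nilF i : iter n D (F i) = 0.
  have [->|Fi0] := eqVneq (F i) 0; first exact: iter0.
  apply: (iter_gt_ddeg (lndD := lndD)); have := bmax _ _ (GF i) Fi0.
  have eMM : (M * M = ddeg lndD b * (12 * M) + 2 * M)%N.
    by rewrite {1}eM mulnDl -mulnA mulnCA.
  have := leq_pmulr (ddeg lndD (F i)) db0; move: en; rewrite eMM.
  have arith (x y z t : nat) : (0 < t)%N -> n.+1 = (x + 2 * t)%N -> (z <= y)%N ->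
    (y <= x)%N -> (z < n)%N by clear; lia.
  exact: arith.
have [c [[i ci] e]] := filtered_dependent (@domR k) (char0R k_char0) lndD
  (@weightedC k) line homD GF nilF.
have := congr1 (mcoeff (mon i)) e; rewrite mcoeff0 raddf_sum /= (bigD1 i) //=.
rewrite mul_mpolyC mcoeffZ mcoeffX eqxx mulr1 big1 ?addr0 => [z|j ji].
  by rewrite z eqxx in ci.
rewrite mul_mpolyC mcoeffZ mcoeffX; case: eqP => [/mon_inj z|]; last by rewrite mulr0.
by rewrite z eqxx in ji.
Qed.

(** A pair of independent kernel elements of least degree has no common
    factor. *)
Lemma kernel_pair_coprime : exists m g h, [/\ (0 < m)%N, weighted m g /\ weighted m h,
  D g = 0 /\ D h = 0, g != 0 /\ h != 0
  & forall H, ~ invertible H -> dvd H g -> ~ dvd H h].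
Proof.
pose S m := `[< exists g h, [/\ weighted m g, weighted m h, D g = 0, D h = 0
  & h != 0 /\ forall c, g <> c%:MP * h] >].
have ex : exists m, S m.
  by have [m [g [h gh]]] := kernel_pair; exists m; apply/asboolP; exists g, h.
case: (ex_minnP ex) => m /asboolP[g [h [Gg Gh Dg Dh [h0 gh]]]] mmin.
have g0 : g != 0 by apply/eqP => g0; apply: (gh 0); rewrite g0 mpolyC0 mul0r.
exists m, g, h; split=> //.
  rewrite lt0n; apply/eqP => m0; rewrite m0 in Gg Gh.
  have [c ec] := weighted0 Gg; have [d ed] := weighted0 Gh.
  have d0 : d != 0 by rewrite -(mpolyC_eq0 3) -ed.
  by apply: (gh (c / d)); rewrite ec ed -mpolyCM divfK.
move=> H Hu [g' eg] [h' eh].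
have H0 : H != 0 by apply: contraNneq h0 => z; rewrite eh z mul0r.
have gn0 : H * g' != 0 by rewrite -eg.
have hn0 : H * h' != 0 by rewrite -eh.
have Ghg : weighted m (H * g') by rewrite -eg.
have Ghh : weighted m (H * h') by rewrite -eh.
have [dH [dg [edg GH Gg']]] := homog_factor (@domR k) gn0 Ghg.
have [dH' [dh [edh GH' Gh']]] := homog_factor (@domR k) hn0 Ghh.
have edH := gpiece_uniq H0 GH GH'.
have dH0 : (0 < dH)%N.
  rewrite lt0n; apply/eqP => dH0; rewrite dH0 in GH; have [c ec] := weighted0 GH.
  by apply: Hu; rewrite ec; apply: (iota_inv (@mpolyC 3 k)); rewrite -(mpolyC_eq0 3) -ec.
suff /mmin : S dg by lia.
have -> : dg = dh by lia.
have ker a : H * a != 0 -> D (H * a) = 0 -> D a = 0.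
  by rewrite mulrC; apply: (ker_factor (@domR k) (char0R k_char0) lndD).
apply/asboolP; exists g', h'; split=> //.
- by rewrite (_ : dh = dg) //; lia.
- by apply: ker; rewrite -?eg.
- by apply: ker; rewrite -?eh.
- split=> [|c ec]; first by apply: contraNneq h0 => z; rewrite eh z mulr0.
  by apply: (gh c); rewrite eg eh ec; ring.
Qed.

End DivideDerivation.

Section Pullback.
Variable k : closedFieldType.
Local Notation R := {mpoly k[3]}.
Local Notation weighted := (weighted k).
Variables (H : R) (dH : nat) (GH : H \is dH.-homog for wt321).
Local Notation phi := (to_principal_quot H).
Variable p : proj_point (quot_grading GH).

Definition pull_ideal (r : R) := p (phi r).

Lemma pull_ideal_prime : prime_ideal pull_ideal.
Proof.
have primep := proj_prime p; split.
- split.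
  + by rewrite /pull_ideal rmorph0; apply: prime_ideal0.
  + by move=> x y; rewrite /pull_ideal rmorphD; apply: prime_idealD.
  + by move=> x y; rewrite /pull_ideal rmorphM; apply: prime_ideal_mull.
- by rewrite /pull_ideal rmorph1; case: primep.
- by move=> x y; rewrite /pull_ideal rmorphM; apply: prime_idealM.
Qed.

Lemma comp_homogeneous_ideal (A : comNzRingType) (G : grading A) (P : A -> Prop) :
  prime_ideal P -> homogeneous_ideal G P -> forall a d, P a -> P (comp G a d).
Proof.
move=> primeP homP a d /homP[s sP ->]; rewrite comp_sum big_seq.
elim/big_rec: _ => [|x y xs Py]; first exact: prime_ideal0.
apply: prime_idealD => //; have [Px [e Ge]] := sP _ xs; rewrite (comp_homog _ Ge).
by case: ifP => _ //; apply: prime_ideal0.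
Qed.

Lemma comp_to_quot r d : comp (quot_grading GH) (phi r) d = phi (comp weighted r d).
Proof.
have [n h] := comp_bound weighted r; have [_ er] := h _ (leqnn n).
apply: (@comp_unique _ _ _ (fun d => phi (comp weighted r d)) n).
- by move=> i; exists (comp weighted r i) => //; exact: (comp_gpiece weighted r i).
- by move=> i ni; rewrite (h _ ni).1 rmorph0.
- by rewrite {1}er rmorph_sum.
Qed.

Lemma pull_ideal_homogeneous : homogeneous_ideal weighted pull_ideal.
Proof.
move=> r pr; have [n /(_ n (leqnn n))[_ er]] := comp_bound weighted r.
exists [seq comp weighted r i | i <- iota 0 n]; last first.
  by rewrite big_map -[in RHS](subn0 n) -/(index_iota 0 n) big_mkord.
move=> _ /mapP[i _ ->]; split; last by exists i; apply: comp_gpiece.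
rewrite /pull_ideal -comp_to_quot.
exact: comp_homogeneous_ideal (proj_prime p) (@proj_homogeneous _ _ p) _ _ _.
Qed.

Lemma pull_ideal_relevant : relevant weighted pull_ideal.
Proof.
have [d [_ [d0 [r Gr ->] pa]]] := proj_relevant p.
by exists d, r.
Qed.

End Pullback.

Lemma sub_on_quotient (k : closedFieldType) (H : {mpoly k[3]}) (P1 P2 : principal_quot H -> Prop) :
  (forall r, P1 (to_principal_quot H r) -> P2 (to_principal_quot H r)) ->
  forall a, P1 a -> P2 a.
Proof. by move=> h a; have [r ->] := to_principal_quot_surj a; apply: h. Qed.

Section NoSmallDegree.
Variable k : closedFieldType.
Hypothesis k_char0 : [pchar k] =i pred0.
Local Notation R := {mpoly k[3]}.
Local Notation weighted := (weighted k).

Variables (f : R) (df : nat) (f_homog : f \is df.-homog for wt321).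
Hypothesis irr_f : irreducible_elt f.
Local Notation phi := (to_principal_quot f).
Local Notation curve := (quot_grading f_homog).

Variables (D : R -> R) (e1 e2 : nat).
Hypotheses (lndD : lnd D) (homD : homog_der D weighted e1 e2).
Hypothesis D_neq0 : exists a, D a != 0.

Let prime_f : prime_elt f.
Proof. by have [_ _] := mpoly_factorial k 3; apply. Qed.

(** If [D] kills [f] then it acts on the curve, whose affine lines are
    regular. *)
Lemma singular_unique_ker : D f = 0 -> forall p q : proj_point curve,
  singular_point p -> singular_point q -> forall a, p a -> q a.
Proof.
move=> Df p q sp sq; have [f0 fu _] := prime_f.
have [D' [e [lndD' homD' ker' mod']]] := divide_derivation lndD homD D_neq0 f_homog prime_f Df.
have [m [g [h [m0 [Gg Gh] [Dg Dh] _ cop]]]] := kernel_pair_coprime k_char0 lndD homD.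
have [h1 [Gh1 Dh1 fh1]] : exists h1, [/\ weighted m h1, D h1 = 0 & ~ dvd f h1].
  have [fg|fg] := pselect (dvd f g); last by exists g.
  by exists h; split=> //; apply: cop fg.
have mem (p' : proj_point curve) : singular_point p' -> p' (phi h1).
  move=> sp'; apply: contrapT => nh; apply: sp'.
  exact: (regular_off_kernel k_char0 prime_f lndD' homD' (ker' _ Df) mod' m0 Gh1 (ker' _ Dh1)).
have memf (p' : proj_point curve) : p' (phi f).
  rewrite (_ : phi f = 0); first exact: prime_ideal0 (proj_prime p').
  by apply/(quot_eq0 prime_f)/dvd_refl.
apply: sub_on_quotient.
apply: (prime_over_unique k_char0 f_homog prime_f lndD' homD' (ker' _ Df) mod'
  m0 Gh1 (ker' _ Dh1) fh1 (pull_ideal_prime p) (pull_ideal_homogeneous (p := p))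
  (pull_ideal_relevant p) _ _ (pull_ideal_prime q) (pull_ideal_relevant q)).
- exact: memf.
- exact: mem.
- exact: memf.
- exact: mem.
Qed.

Section Slice.
Hypotheses (Df : D f != 0) (DDf : D (D f) = 0).

Lemma kernel_not_dvd e : D e = 0 -> e != 0 -> ~ dvd f e.
Proof.
move=> De e0 [c ec]; move/eqP: Df; apply; rewrite ec in De e0.
exact: (ker_factor (@domR k) (char0R k_char0) lndD e0 De).
Qed.

(** Here [f] is a local slice, so up to the kernel of [D] every function on the
    curve is an element of the kernel. The kernel is factorially closed, and
    where [h] does not vanish its elements vanishing at [p] are the multiples of
    one prime element. *)
Lemma singular_kernel (p : proj_point curve) m h : singular_point p ->
  (0 < m)%N -> weighted m h -> D h = 0 -> p (phi h).
Proof.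
move=> sp m0 Gh Dh; apply: contrapT => ph; apply: sp.
have [f0 fu f_prime] := prime_f; have primep := proj_prime p.
have primeP := pull_ideal_prime p; pose P := pull_ideal p; rewrite -/P in primeP.
have [nu nuP nu_homog] := weighted_norm k.
have dom := @domR k; have char0 := char0R k_char0.
have ker_l a b : a * b != 0 -> D (a * b) = 0 -> D a = 0 by apply: (ker_factor dom char0 lndD).
have ker_r a b : a * b != 0 -> D (a * b) = 0 -> D b = 0 by rewrite mulrC; apply: ker_l.
have divide r n : weighted n r -> ~ dvd f r -> exists e u, [/\ D e = 0 /\ D u = 0,
    e != 0 /\ u != 0, exists d d', weighted d e /\ weighted d' u & phi r * phi e = phi u].
  move=> Gr fr; have [e [de [q [u [De [e0 Ge] eq Gu hu]]]]] :=
    graded_division dom char0 lndD homD f_homog Df DDf f_homog f0 Gr.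
  have Du : D u = 0.
    case: hu => [->|]; first exact: (lnd0 lndD).
    have -> : ddeg lndD f = 1%N by apply: ddeg_eq.
    by rewrite ltnS leqn0 => /eqP /ddeg0_ker.
  exists e, u; split=> //; last first.
  - have phif : phi f = 0 by apply/(quot_eq0 prime_f)/dvd_refl.
    by rewrite mulrC -rmorphM eq rmorphD rmorphM /= phif mulr0 add0r.
  - by exists de, (de + n)%N.
  split=> //; apply/eqP => u0; have : dvd f (e * r).
    by rewrite eq u0 addr0; apply/dvd_mull/dvd_refl.
  by case/f_prime => // /kernel_not_dvd; apply.
have hdenP d a : weighted d a -> ~ P a -> hden p (phi a).
  by move=> Ga nPa; split=> //; exists d; exists a.
have not_dvd r : phi r != 0 -> ~ dvd f r by move=> + /(quot_eq0 prime_f) e; rewrite e eqxx.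
pose S n := `[< exists F, [/\ weighted n F, D F = 0, F != 0 & P F] >].
have [ex|nex] := pselect (exists n, S n); last first.
  apply: (regular_point (quot_domain prime_f) (gpiece1 curve)) => n _ [r Gr ->] r0.
  have [e [u [[De Du] [e0 u0] [d [d' [Ge Gu]]] E]]] := divide r n Gr (not_dvd r r0).
  exists 0%N, (phi e), (phi u); rewrite expr0 mul1r; split=> //.
    by apply: (hdenP _ _ Ge) => Pe; apply: nex; exists d; apply/asboolP; exists e.
  by apply: (hdenP _ _ Gu) => Pu; apply: nex; exists d'; apply/asboolP; exists u.
case: (ex_minnP ex) => dF /asboolP[F [GF DF F0 PF]] dFmin.
have Fu : ~ invertible F by move/(prime_ideal_inv primeP).
have unit0 a : a != 0 -> weighted 0%N a -> invertible a.
  move=> a0 /weighted0[c ec]; rewrite ec; apply: (iota_inv (@mpolyC 3 k)).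
  by rewrite -(mpolyC_eq0 3) -ec.
have primeF : prime_elt F.
  have [_ _ ip] := mpoly_factorial k 3; apply: ip; split=> [|//|y z e]; first exact/eqP.
  have yz0 : y * z != 0 by rewrite -e.
  have Gyz : weighted dF (y * z) by rewrite -e.
  have Dyz : D (y * z) = 0 by rewrite -e.
  have [d1 [d2 [d12 Gy Gz]]] := homog_factor dom yz0 Gyz.
  have y0 : y != 0 by apply: contraNneq yz0 => ->; rewrite mul0r.
  have z0 : z != 0 by apply: contraNneq yz0 => ->; rewrite mulr0.
  have [Py|Pz] : P y \/ P z by apply: (prime_idealM primeP); rewrite -e.
    have /dFmin le : S d1 by apply/asboolP; exists y; split=> //; apply: ker_l Dyz.
    have d20 : d2 = 0%N by lia.
    by right; apply: unit0 => //; rewrite d20 in Gz.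
  have /dFmin le : S d2 by apply/asboolP; exists z; split=> //; apply: ker_r Dyz.
  have d10 : d1 = 0%N by lia.
  by left; apply: unit0 => //; rewrite d10 in Gy.
have [D' [e' [lndD' homD' ker' mod']]] := divide_derivation lndD homD D_neq0 GF primeF DF.
have dvdF g d : weighted d g -> D g = 0 -> P g -> dvd F g.
  move=> Gg Dg Pg; apply: contrapT => Fg.
  have Fh : ~ dvd F h by move/(prime_ideal_dvd primeP)/(_ PF).
  have [c c0 FE] := kernel_proportional k_char0 GF primeF lndD' (ker' _ DF) mod'
    Gg Gh (ker' _ Dg) (ker' _ Dh) Fg Fh.
  have PE := prime_ideal_dvd primeP FE PF; apply: ph.
  have : P (c%:MP * h ^+ d).
    rewrite (_ : _ * _ = g ^+ m - (g ^+ m - c%:MP * h ^+ d)); last by ring.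
    apply: prime_idealB => //; rewrite -(prednK m0) exprS; exact: prime_ideal_mulr.
  case/(prime_idealM primeP) => [|/(prime_ideal_exp primeP)] //.
  by move/(prime_ideal_inv primeP (iota_inv (@mpolyC 3 k) c0)).
have phiF0 : phi F != 0 by apply/eqP => /(quot_eq0 prime_f); apply: kernel_not_dvd.
have split_kernel g d : weighted d g -> D g = 0 -> g != 0 ->
    exists i a, g = F ^+ i * a /\ hden p (phi a).
  move=> Gg Dg g0; have [i [a [ea Fa]]] := norm_valuation nuP Fu F0 g0.
  have Fia0 : F ^+ i * a != 0 by rewrite -ea.
  have GFia : weighted d (F ^+ i * a) by rewrite -ea.
  have [d1 [d2 [_ _ Ga]]] := homog_factor dom Fia0 GFia.
  have Da : D a = 0 by apply: (ker_r (F ^+ i)) => //; rewrite -ea.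
  by exists i, a; split=> //; apply: (hdenP _ _ Ga) => /(dvdF _ _ Ga Da).
apply: (regular_point (quot_domain prime_f) (t := phi F) (dt := dF)); first by exists F.
move=> n _ [r Gr ->] r0.
have [e [u [[De Du] [e0 u0] [d [d' [Ge Gu]]] E]]] := divide r n Gr (not_dvd r r0).
have [l [e1' [ee he]]] := split_kernel _ _ Ge De e0.
have [i [u1 [eu hu]]] := split_kernel _ _ Gu Du u0.
rewrite ee eu !rmorphM !rmorphXn in E.
have FX j : phi F ^+ j != 0 := dom_exp_neq0 (quot_domain prime_f) j phiF0.
have [li|il] := leqP l i.
  exists (i - l)%N, (phi e1'), (phi u1); split=> //.
  apply: (dom_mulI (quot_domain prime_f) (FX l)).
  by rewrite mulrCA E [RHS]mulrA -exprD subnKC.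
have [_ []] := hu; apply: (prime_ideal_dvd primep (a := phi F)); last exact: PF.
exists (phi r * phi F ^+ (l - i).-1 * phi e1').
apply: (dom_mulI (quot_domain prime_f) (FX i)); rewrite -E.
have -> : l = (i + (l - i).-1.+1)%N by lia.
by rewrite exprD exprS addKn /=; ring.
Qed.

(** A prime factor [H] of a kernel element and another kernel element [h] both
    vanish at all singular points of the curve; but [D] acts on the curve [H = 0],
    where [h] vanishes at one point at most. *)
Lemma singular_unique_slice (p q : proj_point curve) :
  singular_point p -> singular_point q -> forall a, p a -> q a.
Proof.
move=> sp sq.
have [m [g [h [m0 [Gg Gh] [Dg Dh] [g0 h0] cop]]]] := kernel_pair_coprime k_char0 lndD homD.
have [nu nuP nu_homog] := weighted_norm k; have dom := @domR k.
have gu : ~ invertible g.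
  case=> b e; have b0 : b != 0.
    by apply/eqP => b0; move/eqP: e; rewrite b0 mulr0 eq_sym oner_eq0.
  have := nuP.1 _ _ g0 b0; rewrite e (nu_homog _ _ (oner_neq0 _) (gpiece1 weighted)).
  by rewrite (nu_homog _ _ g0 Gg); lia.
have [H irrH [g' eg]] := norm_irreducible_dvd nuP g0 gu.
have primeH : prime_elt H by have [_ _] := mpoly_factorial k 3; apply.
have [H0 Hu _] := primeH; have Hg0 : H * g' != 0 by rewrite -eg.
have GHg : weighted m (H * g') by rewrite -eg.
have [dH [_ [_ GH _]]] := homog_factor dom Hg0 GHg.
have DH : D H = 0.
  by apply: (ker_factor dom (char0R k_char0) lndD Hg0); rewrite -eg.
have dH0 : (0 < dH)%N.
  rewrite lt0n; apply/eqP => dH0; apply: Hu; rewrite dH0 in GH.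
  have [c ec] := weighted0 GH; rewrite ec; apply: (iota_inv (@mpolyC 3 k)).
  by rewrite -(mpolyC_eq0 3) -ec.
have Hh : ~ dvd H h by apply: cop => //; exists g'.
have [D' [e [lndD' homD' ker' mod']]] := divide_derivation lndD homD D_neq0 GH primeH DH.
apply: sub_on_quotient.
apply: (prime_over_unique k_char0 GH primeH lndD' homD' (ker' _ DH) mod'
  m0 Gh (ker' _ Dh) Hh (pull_ideal_prime p) (pull_ideal_homogeneous (p := p))
  (pull_ideal_relevant p) _ _ (pull_ideal_prime q) (pull_ideal_relevant q)).
- exact: singular_kernel sp dH0 GH DH.
- exact: singular_kernel sp m0 Gh Dh.
- exact: singular_kernel sq dH0 GH DH.
- exact: singular_kernel sq m0 Gh Dh.
Qed.

End Slice.

(** In both cases every singular point is the only point at infinity of an affine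
    line in a curve on which [D] acts. *)
Lemma no_derivation_of_small_degree : D (D f) = 0 ->
  ~ at_least_two_singular_points curve.
Proof.
move=> DDf [p [q [npq sp sq]]]; apply: npq => a.
have [Df|Df] := eqVneq (D f) 0.
  by split; apply: singular_unique_ker.
by split; apply: singular_unique_slice.
Qed.

End NoSmallDegree.

(** * Nagata's criterion for two prime elements *)

Section Nagata.
Variables (B S : comNzRingType) (j : {rmorphism B -> S}) (z w : B) (nu : B -> nat).
Hypotheses (domB : is_domain B) (nuP : additive_norm nu) (factS : factorial_domain S).
Hypotheses (jI : injective j) (prime_z : prime_elt z) (prime_w : prime_elt w).
(** Both rings have the same localization at [z * w]. *)
Hypothesis localizes : forall s, exists N b, s * j (z * w) ^+ N = j b.

Let domS : is_domain S. Proof. by case: factS. Qed.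

Lemma jX_neq0 b : b != 0 -> j b != 0.
Proof. by move=> b0; rewrite -(rmorph0 j) (inj_eq jI). Qed.

(** An element without factors [z] and [w] stays coprime to [z * w]. *)
Lemma saturated b N a c : ~ dvd z b -> ~ dvd w b -> (z * w) ^+ N * a = b * c ->
  exists2 c', c = (z * w) ^+ N * c' & a = b * c'.
Proof.
have [z0 _ pz] := prime_z; have [w0 _ pw] := prime_w.
move=> zb wb; elim: N a c => [|N IHN] a c e.
  by exists c; rewrite ?expr0 ?mul1r // -e expr0 mul1r.
have [//|[c1 ec1]] : dvd z b \/ dvd z c.
  by apply: pz; exists (w * ((z * w) ^+ N * a)); rewrite -e exprS; ring.
have e1 : w * ((z * w) ^+ N * a) = b * c1.
  by apply: (dom_mulI domB z0); rewrite [RHS]mulrCA -ec1 -e exprS; ring.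
have [//|[c2 ec2]] : dvd w b \/ dvd w c1.
  by apply: pw; exists ((z * w) ^+ N * a); rewrite -e1.
have e2 : (z * w) ^+ N * a = b * c2.
  by apply: (dom_mulI domB w0); rewrite e1 ec2; ring.
have [c' ec' ea] := IHN _ _ e2; exists c' => //.
by rewrite ec1 ec2 ec' exprS; ring.
Qed.

(** Some prime factor [s1] of [j b] is not a unit after inverting [z * w].
    Clearing the factors [z] and [w] in its numerator yields [b1] in [B] that
    divides exactly the elements divisible by [s1] in [S]; so [b1] divides [b],
    is associated to it, and is prime. *)
Lemma prime_off_zw b : irreducible_elt b -> ~ dvd z b -> ~ dvd w b -> prime_elt b.
Proof.
have [_ [nuS nuSP] ipS] := factS; have [z0 zu _] := prime_z; have [w0 wu _] := prime_w.
move=> [/eqP b0 bu bi] zb wb; have jt0 : j (z * w) != 0.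
  by apply: jX_neq0; apply: dom_mul_neq0.
have [u [s [uu si es]]] := norm_factorization nuSP (jX_neq0 b0).
have [s1 s1s s1t] : exists2 s1, s1 \in s & ~ dvd s1 (j (z * w)).
  apply: contrapT => h; apply: bu.
  have [N [s' es']] : exists N, dvd (\prod_(y <- s) y) (j (z * w) ^+ N).
    have {h} : forall y, y \in s -> dvd y (j (z * w)).
      by move=> y ys; apply: contrapT => h'; apply: h; exists y.
    elim: (s) => [_|y s' IHs' h]; first by exists 0%N; rewrite big_nil expr0; apply: dvd_refl.
    have [|N [c ec]] := IHs'; first by move=> x xs; apply: h; rewrite inE xs orbT.
    have [d ed] := h y (mem_head _ _); exists N.+1, (d * c).
    by rewrite big_cons exprS ec {1}ed; ring.
  have [v uv] := uu; have [M [c ec]] := localizes (v * s').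
  have [|c' _ ec'] := @saturated b (N + M) 1 c zb wb; last by exists c'; rewrite -ec'.
  apply: jI; rewrite !rmorphM rmorph1 mulr1 -ec es rmorphXn exprD es'.
  by rewrite -[X in X * _]mul1r -uv; ring.
have [s10 s1u s1P] := ipS _ (si _ s1s).
have [N [c1 ec1]] := localizes s1.
have c10 : c1 != 0.
  apply: contraTneq (dom_mul_neq0 domS s10 (dom_exp_neq0 domS N jt0)) => c10.
  by rewrite ec1 c10 rmorph0 eqxx.
have [i [c2 [ec2 zc2]]] := norm_valuation nuP zu z0 c10.
have c20 : c2 != 0 by apply: contraNneq c10 => e; rewrite ec2 e mulr0.
have [l [b1 [eb1 wb1]]] := norm_valuation nuP wu w0 c20.
have zb1 : ~ dvd z b1 by move=> h; apply: zc2; rewrite eb1; apply: dvd_mull.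
have lift c : dvd s1 (j c) -> dvd b1 c.
  case=> s2 ec; have [M [c3 ec3]] := localizes s2.
  have [|c' _ ->] := @saturated b1 (N + M) c (z ^+ i * w ^+ l * c3) zb1 wb1.
    apply: jI; transitivity (j (c1 * c3)); last by rewrite ec2 eb1; congr (j _); ring.
    by rewrite !rmorphM rmorphXn -ec1 -ec3 ec exprD; ring.
  by exists c'.
have s1b1 : dvd s1 (j b1).
  have : dvd s1 (j (z ^+ i * (w ^+ l * b1))).
    by rewrite -eb1 -ec2 -ec1; apply/dvd_mulr/dvd_refl.
  rewrite !rmorphM !rmorphXn; have ps1 := ipS _ (si _ s1s).
  case/s1P => [/(prime_dvd_exp ps1) h|].
    by case: s1t; rewrite rmorphM; apply: dvd_mulr.
  case/s1P => [/(prime_dvd_exp ps1) h|//].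
  by case: s1t; rewrite rmorphM; apply: dvd_mull.
have s1b : dvd s1 (j b).
  by rewrite es; apply: dvd_mull; rewrite (big_rem s1) //=; apply/dvd_mulr/dvd_refl.
have [c ebc] := lift _ s1b.
have b1u : ~ invertible b1.
  case=> d ed; apply: s1u; have [x ex] := s1b1; exists (x * j d).
  by rewrite mulrA -ex -rmorphM ed rmorph1.
have [//|[c' cc']] := bi _ _ ebc.
split=> // x y; have div a : dvd s1 (j a) -> dvd b a.
  by move/lift => [d ->]; exists (c' * d); rewrite ebc mulrA -[b1 * _ * _]mulrA cc' mulr1.
case=> d exy; have : dvd s1 (j x * j y).
  by rewrite -rmorphM exy rmorphM; apply: dvd_mulr.
by case/s1P => /div; [left | right].
Qed.

Lemma nagata : factorial_domain B.
Proof.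
split=> //; first by exists nu.
have assoc p b : prime_elt p -> irreducible_elt b -> dvd p b -> prime_elt b.
  move=> pp bi pb; have [p0 pu pP] := pp; have [u uu eb] := dvd_irreducible pu bi pb.
  have [/eqP b0 bu _] := bi; split=> // x y bxy; case: uu => v uv.
  have div a : dvd p a -> dvd b a.
    by case=> d ->; exists (v * d); rewrite eb; transitivity (u * v * (p * d)); [rewrite uv mul1r | ring].
  by case/(dvd_trans pb)/pP: bxy => /div; [left | right].
move=> b bi; have [zb|zb] := pselect (dvd z b); first exact: assoc zb.
have [wb|wb] := pselect (dvd w b); first exact: assoc wb.
exact: prime_off_zw.
Qed.

End Nagata.

(** * The cyclic cover *)

Section Presentation.
Variables (k : closedFieldType) (f : {mpoly k[3]}) (n : nat).
Hypothesis n_gt0 : (0 < n)%N.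
Local Notation R := {mpoly k[3]}.
Local Notation B := (cyclic_cover n f).
Local Notation h := ('X^n + f%:P).

Definition to_cover (p : {poly R}) : B := in_qpoly h p.

Lemma to_cover_is_zmod_morphism : zmod_morphism to_cover.
Proof. by move=> p q; apply: (raddfB (in_qpoly h)). Qed.
Lemma to_cover_is_monoid_morphism : monoid_morphism to_cover.
Proof. by split; [apply: in_qpoly1 | apply: in_qpolyM]. Qed.
HB.instance Definition _ := GRing.isZmodMorphism.Build {poly R} B
  to_cover to_cover_is_zmod_morphism.
HB.instance Definition _ := GRing.isMonoidMorphism.Build {poly R} B
  to_cover to_cover_is_monoid_morphism.

Definition cst : {rmorphism R -> B} := to_cover \o polyC.
Definition W : B := to_cover 'X.

Lemma size_cover_gen : size h = n.+1.
Proof.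
rewrite size_polyDl size_polyXn // ltnS.
exact: leq_trans (size_polyC_leq1 f) n_gt0.
Qed.

Lemma cover_mk_monic : mk_monic h = h.
Proof. exact: mk_monic_cyclic_cover. Qed.

Definition rep (b : B) : {poly R} := let q : {poly %/ h} := b in q.

Lemma size_cover (b : B) : (size (rep b) <= n)%N.
Proof.
have : (size (rep b) < size (mk_monic h))%N := size_mk_monic b.
by rewrite cover_mk_monic size_cover_gen.
Qed.

Lemma to_coverK (b : B) : to_cover (rep b) = b.
Proof.
apply: val_inj; rewrite /= Pdiv.CommonRing.rmodp_small //; exact: size_mk_monic.
Qed.

Lemma to_cover_small (p : {poly R}) : (size p <= n)%N ->
  rep (to_cover p) = p.
Proof. by move=> sp; rewrite /rep in_qpoly_small // cover_mk_monic size_cover_gen. Qed.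

Lemma to_cover_poly (r : nat -> R) m :
  to_cover (\poly_(i < m) r i) = \sum_(i < m) cst (r i) * W ^+ i.
Proof.
rewrite poly_def rmorph_sum; apply: eq_bigr => i _.
by rewrite -mul_polyC rmorphM rmorphXn.
Qed.

Definition cover_coef (b : B) (i : nat) : R := (rep b)`_i.

Lemma cover_expand b : b = \sum_(i < n) cst (cover_coef b i) * W ^+ i.
Proof.
rewrite -to_cover_poly -[LHS]to_coverK; congr to_cover; apply/polyP => i.
rewrite coef_poly /cover_coef; case: ltnP => // ni; rewrite nth_default //.
exact: leq_trans (size_cover b) ni.
Qed.

Lemma cover_coef_sum (r : nat -> R) i : (i < n)%N ->
  cover_coef (\sum_(i < n) cst (r i) * W ^+ i) i = r i.
Proof.
move=> ltin; rewrite -to_cover_poly /cover_coef to_cover_small ?size_poly //.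
by rewrite coef_poly ltin.
Qed.

Lemma cover_coef_mono r i l : (i < n)%N -> (l < n)%N ->
  cover_coef (cst r * W ^+ i) l = if l == i then r else 0.
Proof.
move=> ltin ltln.
have -> : cst r * W ^+ i = \sum_(l < n) cst (if l == i :> nat then r else 0) * W ^+ l.
  rewrite (bigD1 (Ordinal ltin)) //= eqxx big1 ?addr0 // => l' /eqP/eqP.
  by rewrite -val_eqE /= => /negbTE ->; rewrite rmorph0 mul0r.
by rewrite (@cover_coef_sum (fun l => if l == i then r else 0)).
Qed.

Lemma W_exp : W ^+ n = - cst f.
Proof.
apply/eqP; rewrite -addr_eq0; apply/eqP.
have -> : W ^+ n + cst f = to_cover h by rewrite rmorphD rmorphXn.
by apply: val_inj; rewrite /= cover_mk_monic Pdiv.RingMonic.rmodpp // -cover_mk_monic monic_mk_monic.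
Qed.

Section Lift.
Variables (C : comNzRingType) (g : {rmorphism R -> C}) (c : C).
Hypothesis gc : c ^+ n = - g f.

Definition cover_lift (b : B) : C :=
  (map_poly g (rep b)).[c].

Lemma cover_liftE p : cover_lift (to_cover p) = (map_poly g p).[c].
Proof.
rewrite /cover_lift /= cover_mk_monic.
rewrite {2}(@Pdiv.RingMonic.rdivp_eq _ h _ p); last first.
  by rewrite -cover_mk_monic monic_mk_monic.
rewrite rmorphD rmorphM hornerD hornerM rmorphD /= map_polyXn map_polyC /=.
by rewrite !hornerE gc addNr mulr0 add0r.
Qed.

Lemma cover_lift_is_zmod_morphism : zmod_morphism cover_lift.
Proof.
move=> a b; rewrite -[a]to_coverK -[b]to_coverK -rmorphB !cover_liftE.
by rewrite rmorphB hornerD hornerN.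
Qed.
Lemma cover_lift_is_monoid_morphism : monoid_morphism cover_lift.
Proof.
split=> [|a b]; first by rewrite -(rmorph1 to_cover) cover_liftE rmorph1 hornerC.
rewrite -[a]to_coverK -[b]to_coverK -rmorphM !cover_liftE.
by rewrite rmorphM hornerM.
Qed.
Definition cover_rmorphism : {rmorphism B -> C} :=
  HB.pack cover_lift
    (GRing.isZmodMorphism.Build B C cover_lift cover_lift_is_zmod_morphism)
    (GRing.isMonoidMorphism.Build B C cover_lift cover_lift_is_monoid_morphism).

Lemma cover_lift_cst r : cover_lift (cst r) = g r.
Proof. by rewrite cover_liftE map_polyC hornerC. Qed.

Lemma cover_lift_W : cover_lift W = c.
Proof. by rewrite cover_liftE map_polyX hornerX. Qed.

End Lift.

Lemma cover_in_alg c : in_alg B c = cst c%:MP.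
Proof.
rewrite /cst /= -[c%:MP%:P]alg_polyC /to_cover in_qpolyZ in_qpoly1; by [].
Qed.

End Presentation.

(** * The cyclic cover inside a polynomial ring *)

Definition degU (m : 'X_{1..3}) : nat := m ord_max.
Lemma degU_0 : degU 0%MM = 0%N. Proof. exact: mnm0E. Qed.
Lemma degU_D : {morph degU : m1 m2 / (m1 + m2)%MM >-> (m1 + m2)%N}.
Proof. by move=> m1 m2; apply: mnmDE. Qed.
HB.instance Definition _ := isMeasure.Build 3 degU degU_0 degU_D.

Section Dehomogenize.
Variable k : closedFieldType.
Local Notation R := {mpoly k[3]}.
Local Notation weighted := (weighted k).

Definition gradedU : grading R := mpoly_grading k degU.

Definition dehom (r : R) : R := r \mPo [tuple 'X_0; 'X_1; 1].

Lemma gradedU_X (m : 'X_{1..3}) : gradedU (degU m) ('X_[m] : R).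
Proof. by apply/dhomogP => m'; rewrite msuppX inE => /eqP ->. Qed.

Lemma gradedU_C c : gradedU 0%N (c%:MP : R).
Proof.
apply/dhomogP => m; rewrite msuppC; case: ifP => // _.
by rewrite inE => /eqP ->; apply: degU_0.
Qed.

Lemma homogenize c d (r : R) : weighted d r ->
  r \mPo [tuple c ^+ 3 * 'X_0; c ^+ 2 * 'X_1; c] = c ^+ d * dehom r.
Proof.
move=> Gr; rewrite /dehom !comp_mpolyEX mulr_sumr [LHS]big_seq [RHS]big_seq.
apply: eq_bigr => m mr; rewrite -scalerAr; congr (_ *: _).
have <- : wt321 m = d := dhomog_mf Gr mr; rewrite wt321E !comp_mpolyX !big_ord_recl !big_ord0 !(tnth_nth 0) /wtX /=.
rewrite expr1n !mulr1 addn0 (exprMn _ (c ^+ 3)) (exprMn _ (c ^+ 2)) -!exprM.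
rewrite [c ^+ (_ + _)]exprD [c ^+ (_ + _)]exprD /bump /= (mulnC 3%N) (mulnC 2%N).
by rewrite [(_ * (3 - (1 + (1 + 0))))%N]muln1; ring.
Qed.

Let flat (m : 'X_{1..3}) : 'X_{1..3} :=
  [multinom nth 0%N [:: m 0%R; m 1%R; 0%N] i | i < 3].

Lemma dehomE r : dehom r = \sum_(m <- msupp r) r@_m *: 'X_[flat m].
Proof.
rewrite /dehom comp_mpolyEX; apply: eq_bigr => m _; congr (_ *: _).
rewrite comp_mpolyX [RHS]mpolyXE_id !big_ord_recl !big_ord0 !(tnth_nth 0) /=.
rewrite !mnmE /= expr1n expr0 !mulr1.
by have -> : lift ord0 ord0 = 1%R :> 'I_3 by apply: val_inj.
Qed.

Lemma dehom_piece r : gradedU 0%N (dehom r).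
Proof.
rewrite dehomE; apply: gpiece_sum => m _; rewrite -mul_mpolyC.
have flat0 : degU (flat m) = 0%N by rewrite /degU mnmE.
by have Gm := gradedU_X (flat m); rewrite flat0 in Gm; apply: (gpieceM (gradedU_C _) Gm).
Qed.

(** Setting the last variable to [1] loses nothing on a homogeneous polynomial:
    the degree determines its exponent. *)
Lemma dehom_eq0 r d : weighted d r -> dehom r = 0 -> r = 0.
Proof.
move=> Gr r0; apply/mpolyP => m; rewrite mcoeff0.
have [wm|wm] := eqVneq (wt321 m) d; last exact: weighted_coeff Gr wm.
have := congr1 (mcoeff (flat m)) r0; rewrite dehomE mcoeff0 raddf_sum /= => <-.
have flatE m' : m' \in msupp r -> (flat m' == flat m) = (m' == m).
  move=> m'r; apply/eqP/eqP => [e|-> //]; apply/mnmP => i.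
  have wm' : wt321 m' = d := dhomog_mf Gr m'r.
  have e0 : m' 0%R = m 0%R.
    by have := congr1 (fun u : 'X_{1..3} => u ord0) e; rewrite !mnmE.
  have e1 : m' 1%R = m 1%R.
    by have := congr1 (fun u : 'X_{1..3} => u (lift ord0 ord0)) e; rewrite !mnmE.
  have e2 : m' 2%:R = m 2%:R by move: wm wm'; rewrite /wt321 e0 e1; lia.
  case: i => [[|[|[|//]]] lt].
  - by rewrite (_ : Ordinal lt = 0%R) //; apply: val_inj.
  - by rewrite (_ : Ordinal lt = 1%R) //; apply: val_inj.
  - by rewrite (_ : Ordinal lt = 2%:R) //; apply: val_inj.
have term m' : m' \in msupp r ->
    (r@_m' *: 'X_[flat m'] : R)@_(flat m) = r@_m' * (m' == m)%:R.
  by move=> m'r; rewrite mcoeffZ mcoeffX flatE.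
rewrite big_seq (eq_bigr _ term) -big_seq.
have [mr|mr] := boolP (m \in msupp r); last first.
  rewrite (memN_msupp_eq0 mr) big_seq big1 // => m' m'r.
  by rewrite (negbTE (_ : m' != m)) ?mulr0 //; apply: contraNneq mr => <-.
rewrite (bigD1_seq m) ?msupp_uniq //= eqxx mulr1 big1 ?addr0 // => m' /negbTE ->.
by rewrite mulr0.
Qed.

End Dehomogenize.

Section FractionField.
Local Open Scope quotient_scope.

Lemma fraction_quotient (R : idomainType) (z : {fraction R}) :
  exists a b, b != 0 /\ z = tofrac a / tofrac b.
Proof.
elim/quotW: z => x; exists (\n_x), (\d_x); have d0 := denom_ratioP x; split=> //.
have e0 : tofrac \d_x != 0 by rewrite tofrac_eq0.
apply: (mulIf e0); rewrite divfK //; unlock FracField.tofrac.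
rewrite -[LHS]FracField.pi_mul; apply/eqmodP => /=.
rewrite /FracField.mulf /= !numden_Ratio ?oner_eq0 ?mulf_neq0 ?oner_neq0 //=.
rewrite [X in is_true X]FracField.equivfE /= !numden_Ratio ?oner_eq0 ?mulf_neq0 ?oner_neq0 //=.
by rewrite !mulr1 mulrC.
Qed.

Lemma div_cancel (F : fieldType) (x y u w : F) : u != 0 -> w != 0 -> y != 0 ->
  x / y = (x * u * w) / (y * w * u).
Proof. by move=> u0 w0 y0; field; rewrite u0 w0 y0. Qed.

End FractionField.

Section CoverRing.
Variables (k : closedFieldType) (f : {mpoly k[3]}) (n : nat).
Hypotheses (n_ge2 : (2 <= n)%N) (n_not3 : ~~ (3 %| n)%N).
Hypotheses (f_homog : f \is 9.-homog for wt321) (irr_f : irreducible_elt f).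
Local Notation R := {mpoly k[3]}.
Local Notation weighted := (weighted k).
Local Notation B := (cyclic_cover n f).

Let n_gt0 : (0 < n)%N := ltnW n_ge2.
Local Notation cst := (cst f n).
Local Notation W := (W f n).

Let coprime_n9 : coprime n 9.
Proof. by rewrite (_ : 9 = 3 ^ 2)%N // coprimeXr // coprime_sym prime_coprime. Qed.

Lemma bezout_9 : exists ab, (n * ab.2 = (9 * ab.1).+1)%N.
Proof.
have /(coprimeP 9 n_gt0)[[u1 u2] /= e] := coprime_n9.
by exists (u2, u1) => /=; lia.
Qed.

Let al := (projT1 (cid bezout_9)).1.
Let be := (projT1 (cid bezout_9)).2.
Let al_be : (n * be = (9 * al).+1)%N.
Proof. by rewrite /al /be; case: cid. Qed.

Local Notation U := ('X_ord_max : R).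
Local Notation vv := (- dehom f).
Let zz : R := U ^+ n * vv ^+ al.
Let ww : R := U ^+ 9 * vv ^+ be.

Definition subst : {rmorphism R -> R} :=
  comp_mpoly [tuple zz ^+ 3 * 'X_0; zz ^+ 2 * 'X_1; zz].

Lemma substE d r : weighted d r -> subst r = zz ^+ d * dehom r.
Proof. exact: homogenize. Qed.

(** With [x / z ^ 3] and [y / z ^ 2] as coordinates, [W ^ n / z ^ 9] is minus
    the dehomogenization of [f]; as [n] and [9] are coprime, [z] and [W] are
    monomials in it and in one new variable [U]. *)
Lemma ww_exp : ww ^+ n = - subst f.
Proof.
rewrite (substE f_homog) -mulrN /ww /zz (exprMn _ (U ^+ 9)) (exprMn _ (U ^+ n)).
by rewrite -!exprM (mulnC be) al_be exprSr mulrA (mulnC 9%N n) (mulnC al 9%N).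
Qed.

Definition embed : {rmorphism B -> R} := cover_rmorphism n_gt0 ww_exp.

Lemma embed_cst r : embed (cst r) = subst r.
Proof. exact: (cover_lift_cst n_gt0 ww_exp). Qed.

Lemma embed_W : embed W = ww.
Proof. exact: (cover_lift_W n_gt0 ww_exp). Qed.

Let f0 : f != 0. Proof. by case: irr_f => /eqP. Qed.

Let vv0 : vv != 0.
Proof. by rewrite oppr_eq0; apply: contraNneq f0 => /(dehom_eq0 f_homog) ->. Qed.

Let U0 : U != 0.
Proof.
apply/eqP => /(congr1 (mcoeff U_(ord_max))); rewrite mcoeffXU eqxx mcoeff0.
by move/eqP; rewrite oner_eq0.
Qed.

Let zz0 : zz != 0. Proof. by rewrite mulf_neq0 ?expf_neq0. Qed.
Let ww0 : ww != 0. Proof. by rewrite mulf_neq0 ?expf_neq0. Qed.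

Local Notation gradedU := (gradedU k).

Lemma UV_piece a b : gradedU a (U ^+ a * vv ^+ b).
Proof.
have GU : gradedU 1%N U.
  by have := gradedU_X k U_(ord_max); rewrite /degU mnm1E eqxx.
have := gpieceX a GU; rewrite mul1n => GUa.
have := gpieceX b (gpieceN (dehom_piece f)); rewrite mul0n => GVb.
by have := gpieceM GUa GVb; rewrite addn0.
Qed.

Lemma embed_mono d r i : weighted d r ->
  embed (cst r * W ^+ i) = zz ^+ d * dehom r * ww ^+ i.
Proof. by move=> Gr; rewrite rmorphM rmorphXn embed_cst embed_W (substE Gr). Qed.

Lemma embed_mono_piece d r i : weighted d r ->
  gradedU (n * d + 9 * i)%N (embed (cst r * W ^+ i)).
Proof.
move=> Gr; rewrite (embed_mono _ Gr); apply: gpieceM; last by apply/gpieceX/UV_piece.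
have := gpieceM (gpieceX d (UV_piece n al)) (dehom_piece r).
by rewrite addn0.
Qed.

(** Since [n] is prime to [9], the degree of a monomial of the cover determines
    both its exponent of [W] and the degree of its coefficient. *)
Lemma cover_degree_inj i d i' d' : (i < n)%N -> (i' < n)%N ->
  (n * d + 9 * i = n * d' + 9 * i')%N -> i = i' /\ d = d'.
Proof.
have main a b c e : (a <= b)%N -> (b < n)%N -> (n * c + 9 * a = n * e + 9 * b)%N ->
    a = b.
  move=> ab bn E; have : (n %| 9 * (b - a))%N.
    have -> : (9 * (b - a) = n * c - n * e)%N by lia.
    by rewrite -mulnBr dvdn_mulr.
  rewrite Gauss_dvdr // => /dvdnP[[|q] eq]; first by lia.
  by move: eq; rewrite mulSn; lia.
move=> iN iN' E; have ii : i = i'.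
  by case: (leqP i i') => le; [apply: main E | apply/esym/(main _ _ d' d) => //; lia].
split=> //; apply/eqP; rewrite -(eqn_pmul2l n_gt0); apply/eqP.
by move: E; rewrite ii; lia.
Qed.

Definition cover_term (b : B) i d : B := cst (comp weighted (cover_coef b i) d) * W ^+ i.

Lemma cover_terms (b : B) : exists N, (forall i d, (i < n)%N -> (N <= d)%N ->
    comp weighted (cover_coef b i) d = 0) /\
  b = \sum_(i < n) \sum_(d < N) cover_term b i d.
Proof.
have [N NP] := choice (fun i => comp_bound weighted (cover_coef b i)).
pose M := \max_(i < n) N i.
have le (i : 'I_n) : (N i <= M)%N by apply: (leq_bigmax i).
exists M; split=> [i d ltin Md|].
  by apply: (NP i d _).1; apply: leq_trans Md; apply: (le (Ordinal ltin)).
rewrite {1}(cover_expand n_gt0 b); apply: eq_bigr => i _.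
by rewrite {1}(NP i M (le i)).2 rmorph_sum mulr_suml.
Qed.

Lemma comp_terms (F : nat -> nat -> R) N i d :
  (forall i d, (i < n)%N -> gradedU (n * d + 9 * i)%N (F i d)) ->
  (i < n)%N -> (d < N)%N ->
  comp gradedU (\sum_(i < n) \sum_(d < N) F i d) (n * d + 9 * i) = F i d.
Proof.
move=> GF ltin ltdN; rewrite comp_sum (bigD1 (Ordinal ltin)) //=.
rewrite comp_sum (bigD1 (Ordinal ltdN)) //= comp_gpieceE; last exact: GF.
rewrite big1 => [|d' /eqP dd]; last first.
  rewrite (comp_homog _ (GF _ _ ltin)); case: eqP => // /(cover_degree_inj ltin ltin)[_ e].
  by case: dd; apply: val_inj.
rewrite big1 ?addr0 // => i' /eqP ii; rewrite comp_sum big1 // => d' _.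
rewrite (comp_homog _ (GF _ _ (ltn_ord i'))); case: eqP => // /(cover_degree_inj ltin (ltn_ord i'))[e _].
by case: ii; apply: val_inj.
Qed.

(** The exponents of [U] separate the monomials [cst r * W ^+ i] with [r]
    homogeneous, on each of which the map is a dehomogenization up to a nonzero
    factor. *)
Lemma embed_eq0 (b : B) : embed b = 0 -> b = 0.
Proof.
move=> e; have [N [N0 eb]] := cover_terms b.
have GF i d : (i < n)%N -> gradedU (n * d + 9 * i)%N (embed (cover_term b i d)).
  by move=> _; apply: embed_mono_piece; apply: comp_gpiece.
rewrite eb big1 // => i _; rewrite big1 // => d _.
have := comp_terms GF (ltn_ord i) (ltn_ord d).
have -> : \sum_(i < n) \sum_(d < N) embed (cover_term b i d) = embed b.
  by rewrite [in RHS]eb rmorph_sum; apply: eq_bigr => i' _; rewrite rmorph_sum.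
rewrite e comp0 /cover_term; have Gc := comp_gpiece weighted (cover_coef b i) d.
rewrite (embed_mono i Gc) => /esym/eqP; rewrite !mulf_eq0 !expf_eq0.
rewrite (negbTE zz0) (negbTE ww0) !andbF orbF /= => /eqP /(dehom_eq0 Gc) ->.
by rewrite rmorph0 mul0r.
Qed.

Lemma embed_inj : injective embed.
Proof.
move=> a b /eqP; rewrite -subr_eq0 -rmorphB => /eqP /embed_eq0 /eqP.
by rewrite subr_eq0 => /eqP.
Qed.

Lemma cover_domain : is_domain B.
Proof.
move=> a b e; have /eqP : embed a * embed b = 0 by rewrite -rmorphM e rmorph0.
by rewrite mulf_eq0 => /orP[] /eqP /embed_eq0; [left | right].
Qed.

(** ** The grading of the cover *)

Definition cover_piece d (b : B) : Prop := gradedU d (embed b).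

Lemma cover_piece0 d : cover_piece d 0.
Proof. by rewrite /cover_piece rmorph0; apply: gpiece0. Qed.
Lemma cover_pieceB d a b : cover_piece d a -> cover_piece d b -> cover_piece d (a - b).
Proof. by rewrite /cover_piece rmorphB; apply: gpieceB. Qed.
Lemma cover_piece1 : cover_piece 0 1.
Proof. by rewrite /cover_piece rmorph1; apply: gpiece1. Qed.
Lemma cover_pieceM d e a b :
  cover_piece d a -> cover_piece e b -> cover_piece (d + e)%N (a * b).
Proof. by rewrite /cover_piece rmorphM; apply: gpieceM. Qed.
Lemma cover_piece_mono d r i : weighted d r -> cover_piece (n * d + 9 * i)%N (cst r * W ^+ i).
Proof. exact: embed_mono_piece. Qed.

Lemma cover_piece_span a : exists m (c : nat -> B),
  (forall i, cover_piece i (c i)) /\ a = \sum_(i < m) c i.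
Proof.
have [N [_ ea]] := cover_terms a; pose M := (n * N + 9 * n).+1.
exists M, (fun e => \sum_(i < n) \sum_(d < N | (n * d + 9 * i)%N == e) cover_term a i d).
split=> [e|].
  rewrite /cover_piece rmorph_sum; apply: gpiece_sum => i _.
  rewrite rmorph_sum; apply: gpiece_sum => d /eqP <-.
  by apply: embed_mono_piece; apply: comp_gpiece.
rewrite exchange_big {1}ea; apply: eq_bigr => i _ /=.
under [RHS]eq_bigr => e _ do rewrite big_mkcond /=.
rewrite exchange_big; apply: eq_bigr => d _ /=.
have lt : (n * d + 9 * i < M)%N.
  have : (n * d <= n * N)%N by rewrite leq_mul2l ltnW ?orbT.
  by have := ltn_ord i; rewrite /M; lia.
rewrite (bigD1 (Ordinal lt)) //= eqxx big1 ?addr0 // => e.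
by rewrite -val_eqE /= eq_sym => /negbTE ->.
Qed.

Lemma cover_piece_direct m (c : nat -> B) : (forall i, cover_piece i (c i)) ->
  \sum_(i < m) c i = 0 -> forall i, (i < m)%N -> c i = 0.
Proof.
move=> cP e i im; apply: embed_eq0; apply: (gpiece_direct (n := m) (g := gradedU) (c := fun l => embed (c l))) im.
  by move=> l; apply: cP.
by rewrite -rmorph_sum e rmorph0.
Qed.

Definition cover_grading : grading B :=
  Grading cover_piece0 cover_pieceB cover_piece1 cover_pieceM
    cover_piece_span cover_piece_direct.

(** The terms [cst r * W ^+ i] with [r] homogeneous have distinct degrees, so only
    one of them occurs. *)
Lemma cover_homog e (b : B) : cover_grading e b -> b != 0 ->
  exists i d r, [/\ (i < n)%N, weighted d r, b = cst r * W ^+ i & (n * d + 9 * i)%N = e].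
Proof.
move=> Gb b0; have [N [N0 eb]] := cover_terms b.
have GF i d : (i < n)%N -> gradedU (n * d + 9 * i)%N (embed (cover_term b i d)).
  by move=> _; apply: embed_mono_piece; apply: comp_gpiece.
have esum : \sum_(i < n) \sum_(d < N) embed (cover_term b i d) = embed b.
  by rewrite [in RHS]eb rmorph_sum; apply: eq_bigr => i' _; rewrite rmorph_sum.
have termE (i : 'I_n) (d : 'I_N) : (n * d + 9 * i)%N != e -> cover_term b i d = 0.
  move=> ne; apply: embed_eq0; rewrite -(comp_terms GF (ltn_ord i) (ltn_ord d)).
  have Gb' : gradedU e (embed b) := Gb.
  by rewrite esum (comp_homog _ Gb') (negbTE ne).
have [i [d ide]] : exists (i : 'I_n) (d : 'I_N), (n * d + 9 * i)%N = e.
  apply: contrapT => h; move/eqP: b0; apply; rewrite eb big1 // => i _.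
  by rewrite big1 // => d _; apply: termE; apply/eqP => E; apply: h; exists i, d.
exists i, d, (comp weighted (cover_coef b i) d); split=> //; first exact: comp_gpiece.
rewrite {1}eb (bigD1 i) //= (bigD1 d) //= big1 => [|d' dd]; last first.
  apply: termE; apply: contra_neq dd => E; apply: val_inj.
  by have [_ ee] := cover_degree_inj (ltn_ord i) (ltn_ord i) (etrans E (esym ide)).
rewrite big1 ?addr0 // => i' ii; rewrite big1 // => d' _.
apply: termE; apply: contra_neq ii => E; apply: val_inj.
by have [ee _] := cover_degree_inj (ltn_ord i') (ltn_ord i) (etrans E (esym ide)).
Qed.

(** ** Factoriality of the cover *)

Definition at_z0 (r : R) : R := r \mPo [tuple 'X_0; 'X_1; 0].

Lemma dvd_z r : dvd U r <-> at_z0 r = 0.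
Proof.
have at_z0U : at_z0 U = 0 by rewrite /at_z0 comp_mpolyXU.
split=> [[c ->]|r0]; first by rewrite /at_z0 rmorphM /= -/(at_z0 U) at_z0U mul0r.
suff : dvd U (r - at_z0 r) by rewrite r0 subr0.
elim/mpoly_subring_ind: r {r0} => [c|i|p q Tp Tq|p q Tp Tq].
- by rewrite /at_z0 comp_mpolyC subrr; apply: dvd0.
- rewrite /at_z0 comp_mpolyXU; case: i => [[|[|[|//]]] lt] /=.
  + rewrite (_ : Ordinal lt = 0%R) ?subrr; first exact: dvd0.
    exact: val_inj.
  + rewrite (_ : Ordinal lt = 1%R) ?subrr; first exact: dvd0.
    exact: val_inj.
  + rewrite subr0 (_ : Ordinal lt = ord_max); first exact: dvd_refl.
    exact: val_inj.
- rewrite /at_z0 rmorphD /= (_ : _ - _ = (p - at_z0 p) + (q - at_z0 q)).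
    exact: dvd_add.
  by rewrite /at_z0; ring.
- rewrite /at_z0 rmorphM /= (_ : _ - _ = p * (q - at_z0 q) + (p - at_z0 p) * at_z0 q).
    by apply: dvd_add; [apply: dvd_mull | apply: dvd_mulr].
  by rewrite /at_z0; ring.
Qed.

Lemma prime_U : prime_elt U.
Proof.
split=> //; first case=> c e.
  have /dvd_z : dvd U 1 by exists c.
  by rewrite /at_z0 rmorph1 => /eqP; rewrite oner_eq0.
move=> a b /dvd_z; rewrite /at_z0 rmorphM => /eqP; rewrite mulf_eq0.
by case/orP => /eqP ?; [left | right]; apply/dvd_z.
Qed.

Lemma cst_dvd s r i : (i < n)%N -> dvd (cst s) (cst r * W ^+ i) -> dvd s r.
Proof.
move=> ltin [c ec]; exists (cover_coef c i).
have := cover_coef_mono f n_gt0 r ltin ltin; rewrite eqxx ec => <-.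
rewrite -(@cover_coef_sum _ f _ n_gt0 (fun j => s * cover_coef c j) i ltin); congr cover_coef.
rewrite {1}(cover_expand n_gt0 c) mulr_sumr; apply: eq_bigr => j _.
by rewrite rmorphM mulrA.
Qed.

Lemma W_dvd r : dvd W (cst r) -> dvd f r.
Proof.
case=> c ec; exists (- cover_coef c n.-1).
have := cover_coef_mono f n_gt0 r n_gt0 n_gt0; rewrite eqxx expr0 mulr1 ec => <-.
pose g j := if j is j'.+1 then cover_coef c j' else - (f * cover_coef c n.-1).
have mulW (a : nat -> R) m : W * (\sum_(j < m.+1) cst (a j) * W ^+ j) =
    cst (a m) * W ^+ m.+1 + \sum_(j < m) cst (a j) * W ^+ j.+1.
  rewrite mulr_sumr big_ord_recr addrC; congr (_ + _).
    by apply: eq_bigr => j _; rewrite mulrCA -exprS.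
  by rewrite mulrCA -exprS.
have sum0 (a : nat -> R) m : \sum_(j < m.+1) cst (a j) * W ^+ j =
    cst (a 0%N) + \sum_(j < m) cst (a j.+1) * W ^+ j.+1.
  by rewrite big_ord_recl expr0 mulr1.
have sumE (F : nat -> B) : \sum_(j < n) F j = \sum_(j < n.-1.+1) F j.
  by rewrite prednK.
have -> : W * c = \sum_(j < n) cst (g j) * W ^+ j.
  have Wn : W ^+ n.-1.+1 = - cst f by rewrite prednK // (W_exp f n_gt0).
  have ecn : c = \sum_(j < n.-1.+1) cst (cover_coef c j) * W ^+ j.
    exact: etrans (cover_expand n_gt0 c) (sumE (fun j => cst (cover_coef c j) * W ^+ j)).
  apply: etrans (congr1 (fun b => W * b) ecn) _; rewrite mulW.
  apply: etrans _ (esym (sumE (fun j => cst (g j) * W ^+ j))); rewrite sum0 Wn.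
  congr (_ + _); rewrite [g 0%N]/(- (f * cover_coef c n.-1)) (rmorphN cst).
  by rewrite (rmorphM cst) mulrN mulrC.
by rewrite (@cover_coef_sum _ f _ n_gt0 g 0%N n_gt0) /= mulrN.
Qed.

Local Notation CG := cover_grading.

Lemma cover_noninvertible d b : CG d b -> (0 < d)%N -> b != 0 -> ~ invertible b.
Proof.
move=> Gb d0 b0 [c e]; have bc0 : b * c != 0 by rewrite e oner_neq0.
have Gbc : CG 0%N (b * c) by rewrite e; apply: gpiece1.
have [d1 [d2 [d12 Gb' _]]] := homog_factor cover_domain bc0 Gbc.
by have := gpiece_uniq b0 Gb Gb'; lia.
Qed.

Let z : B := cst U.

Lemma embed_z : embed z = zz.
Proof. by rewrite embed_cst /subst /= comp_mpolyXU. Qed.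

Let weighted_U : weighted 1%N U := weighted_XU k ord_max.

Lemma z_piece : CG n z.
Proof.
have := cover_piece_mono 0 weighted_U; rewrite expr0 mulr1 muln1 muln0 addn0.
by [].
Qed.

Lemma W_piece : CG 9%N W.
Proof.
have := cover_piece_mono 1 (gpiece1 weighted); rewrite rmorph1 mul1r expr1.
by rewrite muln0 add0n muln1.
Qed.

Let z_neq0 : z != 0.
Proof. by apply: contraNneq zz0 => e; rewrite -embed_z e rmorph0. Qed.

Let W_neq0 : W != 0.
Proof. by apply: contraNneq ww0 => e; rewrite -embed_W e rmorph0. Qed.

Lemma mono_mul r i r' i' : (i < n)%N -> (i' < n)%N ->
  exists s l, [/\ (l < n)%N, cst r * W ^+ i * (cst r' * W ^+ i') = cst s * W ^+ l
    & s = r * r' \/ s = - (r * r' * f)].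
Proof.
move=> ltin ltin'; have [lt|ge] := ltnP (i + i') n.
  by exists (r * r'), (i + i')%N; split=> //; [rewrite rmorphM exprD; ring | left].
exists (- (r * r' * f)), (i + i' - n)%N; split; [by lia | | by right].
transitivity (cst (r * r') * (W ^+ n * W ^+ (i + i' - n))).
  by rewrite -exprD subnKC // rmorphM exprD; ring.
by rewrite (W_exp f n_gt0) rmorphN !rmorphM; ring.
Qed.

Hypothesis z_ndvd_f : ~ dvd U f.

(** Products of homogeneous elements are again monomials in [W], up to a factor
    [f]; so primality descends to that of the variable in the polynomial ring,
    which does not divide [f]. *)
Lemma prime_z : prime_elt z.
Proof.
apply: (homog_prime z_piece z_neq0); first exact: cover_noninvertible z_piece n_gt0 z_neq0.
move=> d e a b Ga Gb; have [->|a0] := eqVneq a 0; first by left; apply: dvd0.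
have [->|b0] := eqVneq b 0; first by right; apply: dvd0.
have [i [d1 [r [ltin _ -> _]]]] := cover_homog Ga a0.
have [i' [d2 [r' [ltin' _ -> _]]]] := cover_homog Gb b0.
have [s [l [ltln -> hs]]] := mono_mul r r' ltin ltin'.
have [_ _ pU] := prime_U; move/(cst_dvd ltln) => Us.
have Ur : dvd U (r * r').
  case: hs => [<- // |es]; move: Us; rewrite es => /dvd_opp; rewrite opprK.
  by case/pU.
have div x y : dvd U x -> dvd z (cst x * y).
  by case=> c ->; exists (cst c * y); rewrite rmorphM mulrA.
by case/pU: Ur => /div; [left | right].
Qed.

(** Only monomials without [W] have to be tested, and [W] divides [cst r] exactly
    when [f] divides [r]. *)
Lemma prime_W : prime_elt W.
Proof.
apply: (homog_prime W_piece W_neq0); first exact: cover_noninvertible W_piece _ W_neq0.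
move=> d e a b Ga Gb; have [->|a0] := eqVneq a 0; first by left; apply: dvd0.
have [->|b0] := eqVneq b 0; first by right; apply: dvd0.
have [[|i] [d1 [r [ltin _ -> _]]]] := cover_homog Ga a0; last first.
  by left; exists (cst r * W ^+ i); rewrite exprS mulrCA.
have [[|i'] [d2 [r' [ltin' _ -> _]]]] := cover_homog Gb b0; last first.
  by right; exists (cst r' * W ^+ i'); rewrite exprS mulrCA.
rewrite !expr0 !mulr1 -rmorphM => /W_dvd.
have [_ _ ip] := mpoly_factorial k 3; have [_ _ pf] := ip _ irr_f.
have div x : dvd f x -> dvd W (cst x).
  case=> c ->; exists (- (W ^+ n.-1 * cst c)).
  by rewrite mulrN mulrA -exprS (prednK n_gt0) (W_exp f n_gt0) mulNr opprK rmorphM.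
by case/pf => /div; [left | right].
Qed.

(** Inverting [z * W] makes the embedding surjective onto the localized
    polynomial ring: the images of [z] and [W] are monomials in [U] and [vv] whose
    exponents form a matrix of determinant one, so [U] is a monomial in them. *)
Lemma cover_localizes s : exists N b, s * embed (z * W) ^+ N = embed b.
Proof.
elim/mpoly_subring_ind: s => [c|i|p q [N [a ea]] [M [b eb]]|p q [N [a ea]] [M [b eb]]].
- exists 0%N, (cst c%:MP); rewrite embed_cst expr0 mulr1 /subst /=.
  by rewrite comp_mpolyC.
- have ezW : embed (z * W) = zz * ww by rewrite rmorphM embed_z embed_W.
  rewrite ezW; case: i => [[|[|[|//]]] lt].
  + exists 3%N, (cst 'X_0 * W ^+ 3); rewrite rmorphM rmorphXn embed_cst embed_W.
    rewrite /subst /= comp_mpolyXU /= (_ : Ordinal lt = 0%R); last exact: val_inj.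
    by ring.
  + exists 2%N, (cst 'X_1 * W ^+ 2); rewrite rmorphM rmorphXn embed_cst embed_W.
    rewrite /subst /= comp_mpolyXU /= (_ : Ordinal lt = 1%R); last exact: val_inj.
    by ring.
  + exists al, (z ^+ be * z ^+ al); rewrite (_ : Ordinal lt = ord_max); last exact: val_inj.
    rewrite rmorphM !rmorphXn embed_z exprMn mulrCA [RHS]mulrC; congr (_ * _).
    rewrite /zz /ww (exprMn _ (U ^+ 9)) (exprMn _ (U ^+ n)) -!exprM al_be.
    by rewrite exprS mulrA (mulnC al be).
- exists (N + M)%N, (a * (z * W) ^+ M + b * (z * W) ^+ N).
  rewrite rmorphD (rmorphM embed a) (rmorphM embed b) !(rmorphXn embed) -ea -eb exprD.
  by ring.
- exists (N + M)%N, (a * b).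
  by rewrite rmorphM -ea -eb exprD; ring.
Qed.

Lemma cover_factorial : factorial_domain B.
Proof.
have [nu nuP _] : exists2 nu, additive_norm nu &
    forall d (b : B), b != 0 -> CG d b -> nu b = d.
  apply: (graded_norm cover_domain) => b b0 /cover_homog/(_ b0).
  move=> [i [d [r [_ Gr eb deg]]]]; have [i0 d0] : i = 0%N /\ d = 0%N.
    by move: deg => /eqP; rewrite addn_eq0 !muln_eq0 (gtn_eqF n_gt0) /= => /andP[/eqP ? /eqP ?].
  rewrite d0 in Gr; have [c ec] := weighted0 Gr; rewrite i0 expr0 mulr1 ec in eb.
  have c0 : c != 0 by apply: contraNneq b0 => c0; rewrite eb c0 mpolyC0 rmorph0.
  by exists (cst (c^-1)%:MP); rewrite eb -rmorphM -mpolyCM divff // mpolyC1 rmorph1.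
exact: (nagata cover_domain nuP (mpoly_factorial k 3) embed_inj prime_z prime_W
  cover_localizes).
Qed.

(** ** Rationality of the cover *)

Lemma cover_finitely_generated : finitely_generated B.
Proof.
pose b (i : 'I_4) : B := if unlift ord_max i is Some i' then cst 'X_i' else W.
pose ev : {rmorphism {mpoly k[4]} -> B} := mmap (in_alg B) b.
exists 4%N, b => a; suff [q ->] : exists q, a = ev q by exists q.
have gen r : exists q, cst r = ev q.
  elim/mpoly_subring_ind: r => [c|i|p q [p' ep] [q' eq]|p q [p' ep] [q' eq]].
  - exists c%:MP; rewrite /ev /= mmapC; exact: esym (cover_in_alg f n c).
  - by exists 'X_(lift ord_max i); rewrite /ev /= mmapX mmap1U /b liftK.
  - by exists (p' + q'); rewrite !rmorphD ep eq.
  - by exists (p' * q'); rewrite !rmorphM ep eq.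
have [q qP] := choice (fun i => gen (cover_coef a i)).
exists (\sum_(i < n) q i * 'X_ord_max ^+ i); rewrite rmorph_sum.
rewrite {1}(cover_expand n_gt0 a); apply: eq_bigr => i _.
rewrite rmorphM rmorphXn -qP; congr (_ * _ ^+ _).
by rewrite /ev /= mmapX mmap1U /b unlift_none.
Qed.

Lemma cover_rational : is_rational B.
Proof.
split; [exact: cover_domain | exact: cover_finitely_generated |].
pose F : fieldType := {fraction R}.
pose j : {rmorphism B -> F} := (@tofrac R) \o embed.
have jI : injective j.
  by move=> a b /eqP; rewrite /j /= tofrac_eq => /eqP /embed_inj.
exists F, j; split.
  split=> // q; have [s [s' [s'0 ->]]] := fraction_quotient q.
  have [N [a ea]] := cover_localizes s; have [M [b eb]] := cover_localizes s'.
  have t0 : embed (z * W) != 0 by rewrite rmorphM embed_z embed_W mulf_neq0.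
  exists (a * (z * W) ^+ M), (b * (z * W) ^+ N).
  have b0 : b != 0.
    apply: contraTneq (mulf_neq0 s'0 (expf_neq0 M t0)) => b0.
    by rewrite eb b0 rmorph0 eqxx.
  have zW0 : z * W != 0 by apply: contraNneq t0 => ->; rewrite rmorph0.
  split; first by apply: (dom_mul_neq0 cover_domain b0); apply: (dom_exp_neq0 cover_domain).
  have jE c m e : m * embed (z * W) ^+ e = embed c -> j c = tofrac m * j (z * W) ^+ e.
    move=> E; apply: etrans (congr1 (@tofrac R) (esym E)) _.
    apply: etrans (rmorphM (@tofrac R) _ _) _; congr (_ * _).
    exact: (rmorphXn (@tofrac R)).
  have T0 : j (z * W) != 0 by rewrite -(rmorph0 j) (inj_eq jI).
  have sF0 : tofrac s' != 0 :> F by rewrite tofrac_eq0.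
  rewrite !(rmorphM j) !(rmorphXn j) (jE _ _ _ ea) (jE _ _ _ eb).
  exact: div_cancel (expf_neq0 N T0) (expf_neq0 M T0) sF0.
have scal c : (j \o in_alg B) c = tofrac (c%:MP : R).
  apply: etrans (congr1 (fun b => tofrac (embed b)) (cover_in_alg f n c)) _.
  by rewrite embed_cst /subst /= comp_mpolyC.
pose t (i : 'I_3) : F := tofrac ('X_i : R).
have evE (q : R) : mmap (j \o in_alg B) t q = tofrac q.
  rewrite /mmap [in RHS](mpolyE q) rmorph_sum; apply: eq_bigr => m _.
  rewrite scal -mul_mpolyC rmorphM; congr (_ * _).
  by rewrite /mmap1 mpolyXE_id rmorph_prod; apply: eq_bigr => i _; rewrite rmorphXn.
exists 3%N, t; split=> [q|q]; first by rewrite evE => /eqP; rewrite tofrac_eq0 => /eqP.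
have [a [b [b0 ->]]] := fraction_quotient q; exists a, b.
by rewrite !evE tofrac_eq0.
Qed.

End CoverRing.

(** * The highest homogeneous component of a derivation *)

Section TopComponent.
Variables (A : comNzRingType) (G : grading A) (D : A -> A) (E : nat).
Hypothesis lndD : lnd D.
Hypothesis D_bounded : forall m a m', G m a -> (m + E < m')%N -> comp G (D a) m' = 0.

Let DD : forall a b, D (a + b) = D a + D b. Proof. by case: lndD. Qed.
Let DM : forall a b, D (a * b) = D a * b + a * D b. Proof. by case: lndD. Qed.

Section Drop.
(** [D] raises degrees by at most [E - delta]. *)
Variable delta : nat.
Hypothesis D_drop : forall m a m', G m a -> comp G (D a) m' != 0 ->
  (m' + delta <= m + E)%N.

Definition top_piece m a : A :=
  if (delta <= m + E)%N then comp G (D a) (m + E - delta) else 0.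

Lemma top_piece0 m : top_piece m 0 = 0.
Proof. by rewrite /top_piece (lnd0 lndD) comp0 if_same. Qed.

Lemma top_pieceD m a b : top_piece m (a + b) = top_piece m a + top_piece m b.
Proof. by rewrite /top_piece DD compD; case: ifP; rewrite ?addr0. Qed.

Let bound a := projT1 (cid (comp_bound G a)).

Definition top_der a : A := \sum_(m < bound a) top_piece m (comp G a m).

Lemma top_derE a M : (bound a <= M)%N ->
  top_der a = \sum_(m < M) top_piece m (comp G a m).
Proof.
move=> le; apply: (@sum_widen _ (fun m => top_piece m (comp G a m))) => // m.
by rewrite /bound; case: cid => N /= NP /NP[-> _]; apply: top_piece0.
Qed.

Lemma top_derD a b : top_der (a + b) = top_der a + top_der b.
Proof.
pose M := maxn (bound (a + b)) (maxn (bound a) (bound b)).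
rewrite !(@top_derE _ M) ?leq_max ?leqnn ?orbT // -big_split.
by apply: eq_bigr => m _; rewrite compD top_pieceD.
Qed.

Lemma top_der0 : top_der 0 = 0.
Proof. by rewrite /top_der big1 // => m _; rewrite comp0 top_piece0. Qed.

Lemma top_der_homog m a : G m a -> top_der a = top_piece m a.
Proof.
move=> Ga; pose M := maxn (bound a) m.+1.
rewrite (@top_derE _ M) ?leq_maxl //; have lt : (m < M)%N by rewrite leq_maxr.
rewrite (bigD1 (Ordinal lt)) //= comp_gpieceE // big1 ?addr0 // => i.
by rewrite -val_eqE /= (comp_homog _ Ga) => /negbTE ->; apply: top_piece0.
Qed.

Lemma top_der_sum (I : Type) (r : seq I) (P : pred I) (F : I -> A) :
  top_der (\sum_(i <- r | P i) F i) = \sum_(i <- r | P i) top_der (F i).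
Proof. by elim/big_rec2: _ => [|i x y _ <-]; rewrite ?top_der0 ?top_derD. Qed.

Lemma top_derM_homog m l a b : G m a -> G l b ->
  top_der (a * b) = top_der a * b + a * top_der b.
Proof.
move=> Ga Gb; rewrite (top_der_homog (gpieceM Ga Gb)) (top_der_homog Ga) (top_der_homog Gb).
rewrite /top_piece DM compD (mulrC (D a)) (comp_homogM _ _ Ga) (comp_homogM _ _ Gb).
case: (leqP delta (m + E)) => le1; case: (leqP delta (l + E)) => le2.
- rewrite !ifT; try lia.
  rewrite (_ : m + l + E - delta - l = m + E - delta)%N; last lia.
  rewrite (_ : m + l + E - delta - m = l + E - delta)%N; last lia.
  by rewrite (mulrC b).
- rewrite ifT; last lia.
  rewrite [in RHS]mulr0 addr0 ifT; last lia.
  rewrite ifF; last lia.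
  by rewrite addr0 (mulrC b) (_ : m + l + E - delta - l = m + E - delta)%N //; lia.
- rewrite ifT; last lia.
  rewrite mul0r add0r ifF; last lia.
  rewrite ifT; last lia.
  by rewrite add0r (_ : m + l + E - delta - m = l + E - delta)%N //; lia.
- rewrite mul0r mulr0 addr0; case: ifP => // le3.
  rewrite ifF; last lia.
  by rewrite ifF ?addr0 //; lia.
Qed.

Lemma top_derM a b : top_der (a * b) = top_der a * b + a * top_der b.
Proof.
have [N /(_ N (leqnn N))[_ ea]] := comp_bound G a.
have [M /(_ M (leqnn M))[_ eb]] := comp_bound G b.
rewrite ea eb !top_der_sum big_distrlr !top_der_sum.
rewrite !big_distrlr -big_split; apply: eq_bigr => i _ /=.
rewrite top_der_sum -big_split; apply: eq_bigr => j _ /=.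
by apply: top_derM_homog; apply: comp_gpiece.
Qed.

(** The iterates of the highest component are the extreme components of the
    iterates. *)
Lemma iter_top_der m a N : G m a ->
  [/\ forall m', (m' + N * delta = m + N * E)%N ->
        iter N top_der a = comp G (iter N D a) m',
      forall m', (m + N * E < m' + N * delta)%N -> comp G (iter N D a) m' = 0
    & (m + N * E < N * delta)%N -> iter N top_der a = 0].
Proof.
move=> Ga; elim: N => [|N [IH1 IH2 IH3]].
  split=> [m'|m'|]; rewrite ?mul0n ?addn0 //=.
    by move=> ->; rewrite comp_gpieceE.
  by rewrite (comp_homog _ Ga) => lt; rewrite gtn_eqF.
set c := iter N D a in IH1 IH2; rewrite !iterS -/c.
have [M hM] := comp_bound G c; have [_ ec] := hM _ (leqnn M).
have compDc m' : comp G (D c) m' = \sum_(l < M) comp G (D (comp G c l)) m'.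
  by rewrite {1}ec (lnd_sum lndD) comp_sum.
have term l m' : comp G (D (comp G c l)) m' != 0 ->
    (m' + delta <= l + E)%N /\ (l + N * delta <= m + N * E)%N.
  move=> n0; split; first by apply: D_drop n0; apply: comp_gpiece.
  rewrite leqNgt; apply/negP => /IH2 c0; move: n0.
  by rewrite c0 (lnd0 lndD) comp0 eqxx.
have high m' : (m + N.+1 * E < m' + N.+1 * delta)%N -> comp G (D c) m' = 0.
  move=> lt; rewrite compDc big1 // => l _; apply/eqP; apply: contrapT => /negP.
  by move/term => []; move: lt; rewrite !mulSn; lia.
have extreme l : (l + N * delta = m + N * E)%N -> iter N top_der a = comp G c l.
  exact: IH1.
have low : (m + N * E < N * delta)%N -> top_der (iter N top_der a) = 0.
  by move/IH3 ->; apply: top_der0.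
split=> [m' em||lt]; [|exact: high|].
  have [le|lt] := leqP E (m' + delta)%N; last first.
    rewrite low; last by move: em; rewrite !mulSn; lia.
    rewrite compDc big1 // => l _; apply/eqP; apply: contrapT => /negP /term [].
    by move: em; rewrite !mulSn; lia.
  have [l el] : exists l, (l + E = m' + delta)%N by exists (m' + delta - E)%N; rewrite subnK.
  have lN : (l + N * delta = m + N * E)%N by move: em; rewrite !mulSn; lia.
  have -> : comp G (D c) m' = comp G (D (comp G c l)) m'.
    have other (i : 'I_M) : (i : nat) != l -> comp G (D (comp G c i)) m' = 0.
      move=> il; apply/eqP; apply: contrapT => /negP /term [].
      by move/eqP: il; lia.
    rewrite compDc; have [lM|Ml] := ltnP l M.
      have off (i : 'I_M) : true && (i != Ordinal lM) -> comp G (D (comp G c i)) m' = 0.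
        by move=> /eqP il; apply: other; apply/eqP => e; apply/il/val_inj.
      by rewrite (bigD1 (Ordinal lM)) // big1 //= addr0.
    rewrite big1 => [|i _]; last by apply: other; have := ltn_ord i; lia.
    by rewrite (hM _ Ml).1 (lnd0 lndD) comp0.
  rewrite (extreme _ lN) (top_der_homog (comp_gpiece G c l)) /top_piece ifT; last by lia.
  by rewrite el addnK.
have [lt'|ge] := ltnP (m + N * E) (N * delta); first exact: low.
have lN : (m + N * E - N * delta + N * delta = m + N * E)%N by rewrite subnK.
rewrite (extreme _ lN) (top_der_homog (comp_gpiece G c _)) /top_piece ifF //.
by move: lt; rewrite !mulSn; lia.
Qed.

Lemma top_der_iter0 N : iter N top_der 0 = 0.
Proof. by elim: N => //= N ->; apply: top_der0. Qed.

Lemma top_der_lnd : lnd top_der.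
Proof.
split=> [||a]; [exact: top_derD | exact: top_derM |].
have [M /(_ M (leqnn M))[_ ->]] := comp_bound G a.
have iterD' N b c : iter N top_der (b + c) = iter N top_der b + iter N top_der c.
  by elim: N => //= N ->; rewrite top_derD.
elim: M => [|M [N1 e1]]; first by exists 0%N; rewrite big_ord0.
have [_ _ /(_ (comp G a M))[N2 e2]] := lndD.
have [P1 P2 P3] := iter_top_der N2 (comp_gpiece G a M).
have {P1 P2 P3}e2' : iter N2 top_der (comp G a M) = 0.
  have [lt|ge] := ltnP (M + N2 * E) (N2 * delta); first exact: P3.
  by rewrite (P1 (M + N2 * E - N2 * delta)%N) ?subnK // e2 comp0.
have iterS0 N1' N2' b : iter N1' top_der b = 0 -> iter (N2' + N1') top_der b = 0.
  by move=> e; rewrite iterD e top_der_iter0.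
exists (N1 + N2)%N; rewrite big_ord_recr iterD' (iterS0 _ _ _ e2') addr0.
by rewrite addnC (iterS0 _ _ _ e1).
Qed.

Lemma top_der_homog_der : homog_der top_der G E delta.
Proof.
move=> m a Ga; rewrite (top_der_homog Ga) /top_piece; case: ifP => [le _|]; last by rewrite eqxx.
by exists (m + E - delta)%N; rewrite ?subnK //; apply: comp_gpiece.
Qed.

End Drop.

(** Taking the drop as small as possible makes the highest component nonzero. *)
Lemma top_derivation : (exists a, D a != 0) -> exists T e2,
  [/\ lnd T, homog_der T G E e2 & exists a, T a != 0].
Proof.
case=> a0 Da0.
pose P delta := `[< exists m a m', [/\ G m a, (m' + delta)%N = (m + E)%N & comp G (D a) m' != 0] >].
have exP : exists delta, P delta.
  have [M /(_ M (leqnn M))[_ ea]] := comp_bound G a0.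
  have [i Di] : exists i, D (comp G a0 i) != 0.
    apply/not_existsP => h; move/eqP: Da0; apply; rewrite ea (lnd_sum lndD).
    by rewrite big1 // => i _; apply: contrapT => nz; case: (h i); apply/eqP.
  have [m' [n0 _]] := top_exists G Di.
  exists (i + E - m')%N; apply/asboolP; exists i, (comp G a0 i), m'; split=> //.
    exact: comp_gpiece.
  rewrite subnKC // leqNgt; apply/negP => lt; move: n0.
  by rewrite (D_bounded (comp_gpiece G a0 i) lt) eqxx.
case: (ex_minnP exP) => delta /asboolP[m [a [m' [Ga em n0]]]] dmin.
have drop l b l' : G l b -> comp G (D b) l' != 0 -> (l' + delta <= l + E)%N.
  move=> Gb nb; have le : (l' <= l + E)%N.
    by rewrite leqNgt; apply/negP => lt; move: nb; rewrite (D_bounded Gb lt) eqxx.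
  have /dmin : P (l + E - l')%N; last by lia.
  by apply/asboolP; exists l, b, l'; rewrite subnKC.
exists (top_der delta), delta; split.
- exact: top_der_lnd.
- exact: top_der_homog_der.
- exists a; rewrite (top_der_homog _ Ga) /top_piece ifT -em ?leq_addl //.
  by rewrite addnK.
Qed.

End TopComponent.

(** * Derivations of the cyclic cover *)

Section CoverDerivation.
Variables (k : closedFieldType) (k_char0 : [pchar k] =i pred0).
Variables (f : {mpoly k[3]}) (n : nat).
Hypotheses (n_ge2 : (2 <= n)%N) (n_not3 : ~~ (3 %| n)%N).
Hypotheses (f_homog : f \is 9.-homog for wt321) (irr_f : irreducible_elt f).
Local Notation R := {mpoly k[3]}.
Local Notation weighted := (weighted k).
Local Notation B := (cyclic_cover n f).
Local Notation cst := (cst f n).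
Local Notation W := (W f n).
Local Notation CG := (cover_grading n_ge2 n_not3 f_homog irr_f).

Let n_gt0 : (0 < n)%N := ltnW n_ge2.
Let domB : is_domain B := cover_domain n_ge2 n_not3 f_homog irr_f.
Let char0B : char_zero B := char_zero_ext k_char0 (scalars cst).

Lemma cst_piece d r : weighted d r -> CG (n * d)%N (cst r).
Proof.
move=> Gr; have := cover_piece_mono n_ge2 n_not3 f_homog 0 Gr.
by rewrite expr0 mulr1 muln0 addn0.
Qed.

Lemma mono_inj r s i : (i < n)%N -> cst r * W ^+ i = cst s * W ^+ i -> r = s.
Proof.
move=> ltin e; have := cover_coef_mono f n_gt0 r ltin ltin.
by rewrite e (cover_coef_mono f n_gt0 s ltin ltin) eqxx.
Qed.

Section Derivation.
Variable D : B -> B.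
Hypothesis lndD : lnd D.

Let DD : forall a b, D (a + b) = D a + D b. Proof. by case: lndD. Qed.
Let DM : forall a b, D (a * b) = D a * b + a * D b. Proof. by case: lndD. Qed.

Lemma lnd_scalar c : D (cst c%:MP) = 0.
Proof.
have [->|c0] := eqVneq c 0; first by rewrite mpolyC0 rmorph0 (lnd0 lndD).
exact/(ker_invertible domB char0B lndD)/(iota_inv (scalars cst)).
Qed.

(** The degree shifts on the finitely many generators bound all others. *)
Lemma cover_lnd_bounded : exists E, forall m a m',
  CG m a -> (m + E < m')%N -> comp CG (D a) m' = 0.
Proof.
have [NX NXP] := choice (fun i : 'I_3 => comp_bound CG (D (cst 'X_i))).
have [NW NWP] := comp_bound CG (D W).
pose E := (NW + \sum_i NX i)%N; exists E.
pose T m b := CG m b /\ forall m', (m + E < m')%N -> comp CG (D b) m' = 0.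
have T1 : T 0%N 1.
  by split=> [|m' _]; rewrite ?(lnd1 lndD) ?comp0 //; apply: gpiece1.
have TM m l a b : T m a -> T l b -> T (m + l)%N (a * b).
  move=> [Ga Ta] [Gb Tb]; split=> [|m' lt]; first exact: gpieceM.
  rewrite DM compD (mulrC (D a)) (comp_homogM _ _ Ga) (comp_homogM _ _ Gb).
  rewrite Ta ?Tb ?mulr0 ?if_same ?addr0 //; lia.
have TX m a i : T m a -> T (m * i)%N (a ^+ i).
  move=> Ta; elim: i => [|i IHi]; first by rewrite muln0 expr0.
  by rewrite mulnS exprS; apply: TM.
have TD m a b : T m a -> T m b -> T m (a + b).
  move=> [Ga Ta] [Gb Tb]; split=> [|m' lt]; first exact: gpieceD.
  by rewrite DD compD Ta ?Tb ?addr0.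
have T0 m : T m 0.
  by split=> [|m' _]; rewrite ?(lnd0 lndD) ?comp0 //; apply: gpiece0.
have TC c : T 0%N (cst c%:MP).
  split=> [|m' _]; last by rewrite lnd_scalar comp0.
  by have := cst_piece (weightedC c); rewrite muln0.
have TXi i : T (n * wtX i)%N (cst 'X_i).
  split=> [|m' lt]; first exact/cst_piece/weighted_XU.
  apply: (NXP i m' _).1; have : (NX i <= \sum_i NX i)%N by rewrite (bigD1 i) //= leq_addr.
  by move: lt; rewrite /E; lia.
have TW : T 9%N W.
  split=> [|m' lt]; first exact: W_piece.
  by apply: (NWP m' _).1; move: lt; rewrite /E; lia.
have Tmono m : T (n * wt321 m)%N (cst 'X_[m]).
  have -> : (n * wt321 m = \sum_i n * wtX i * m i)%N.
    by rewrite wt321E big_distrr; apply: eq_bigr => i _ /=; ring.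
  rewrite mpolyXE_id (rmorph_prod cst).
  elim/big_rec2: _ => [|i b e _ Tb] //; apply: TM => //.
  rewrite (rmorphXn cst); exact/TX/TXi.
have Tcst d r : weighted d r -> T (n * d)%N (cst r).
  move=> Gr; rewrite [r]mpolyE rmorph_sum big_seq.
  apply: (big_ind (T (n * d)%N)) => [||m mr]; [exact: T0 | exact: TD|].
  rewrite -mul_mpolyC rmorphM; have <- : wt321 m = d := dhomog_mf Gr mr.
  exact: (TM _ _ _ _ (TC _) (Tmono _)).
move=> m a m' Ga; have [->|a0] := eqVneq a 0; first by rewrite (lnd0 lndD) comp0.
have [i [d [r [_ Gr -> <-]]]] := cover_homog Ga a0.
by apply: (TM _ _ _ _ (Tcst _ _ Gr) (TX _ _ i TW)).2.
Qed.

Variables (e1 e2 : nat).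
Hypotheses (homD : homog_der D CG e1 e2) (D_neq0 : exists a, D a != 0).

Lemma kerW_cst : (forall r, D (cst r) = 0) -> D W = 0 -> False.
Proof.
move=> Dc DW; have [a /eqP] := D_neq0; apply.
rewrite (cover_expand n_gt0 a) (lnd_sum lndD) big1 // => i _.
by apply: (ker_mul lndD) => //; apply: (ker_exp lndD).
Qed.

Let W_neq0 : W != 0.
Proof.
apply/eqP => W0; have /eqP : (1 : R) = 0 by apply: (mono_inj n_ge2); rewrite expr1 W0 !mulr0.
by rewrite oner_eq0.
Qed.

Let WX_neq0 i : W ^+ i != 0. Proof. exact: dom_exp_neq0. Qed.

Lemma lnd_W_exp : D (W ^+ n) = - D (cst f).
Proof. by rewrite (W_exp f n_gt0) (lndN lndD). Qed.

Lemma lnd_W_ker : D (cst f) = 0 -> D W = 0.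
Proof.
move=> Df; apply: (ker_factor domB char0B lndD (b := W ^+ n.-1)).
  by rewrite -exprS.
by rewrite -exprS prednK // lnd_W_exp Df oppr0.
Qed.

Lemma lnd_cst_neq0 : exists d r, weighted d r /\ D (cst r) != 0.
Proof.
apply: contrapT => h; have Dhom d r : weighted d r -> D (cst r) = 0.
  by move=> Gr; apply/eqP; apply: contrapT => /negP Dr; apply: h; exists d, r.
have Dc r : D (cst r) = 0.
  have [N /(_ N (leqnn N))[_ ->]] := comp_bound weighted r.
  by rewrite rmorph_sum (lnd_sum lndD) big1 // => i _; apply/Dhom/comp_gpiece.
by apply: (kerW_cst Dc); apply/lnd_W_ker/Dc.
Qed.

(** The degree of a homogeneous element determines its exponent of [W], so the
    exponent in [D (cst r)] is the same for all [r]. *)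
Lemma lnd_restrict : exists i0 E1 E2 (der : R -> R), [/\ (i0 < n)%N,
    forall r, D (cst r) = cst (der r) * W ^+ i0,
    homog_der der weighted E1 E2 & exists r, der r != 0].
Proof.
have shape d r : weighted d r -> D (cst r) != 0 -> exists i d' s,
    [/\ (i < n)%N, weighted d' s, D (cst r) = cst s * W ^+ i
      & (n * d' + 9 * i + e2 = n * d + e1)%N].
  move=> Gr Dr; have [m' em Gm'] := homD (cst_piece Gr) Dr.
  have [i [d' [s [ltin Gs es ed]]]] := cover_homog Gm' Dr.
  by exists i, d', s; rewrite ed.
have [d0 [r0 [Gr0 Dr0]]] := lnd_cst_neq0.
have [i0 [d0' [s0 [lti0 Gs0 es0 ed0]]]] := shape _ _ Gr0 Dr0.
pose der r := cover_coef (D (cst r)) i0.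
have mono d r : weighted d r -> D (cst r) != 0 -> exists d' s,
    [/\ weighted d' s, D (cst r) = cst s * W ^+ i0 & (d' + d0 = d + d0')%N].
  move=> Gr Dr; have [i [d' [s [ltin Gs es ed]]]] := shape _ _ Gr Dr.
  have E : (n * (d' + d0) + 9 * i = n * (d + d0') + 9 * i0)%N.
    by rewrite !mulnDr; lia.
  have [ii dd] := cover_degree_inj n_ge2 n_not3 f_homog irr_f ltin lti0 E.
  by exists d', s; rewrite -ii.
have derE r s : D (cst r) = cst s * W ^+ i0 -> der r = s.
  by rewrite /der => ->; rewrite (cover_coef_mono f n_gt0 s lti0 lti0) eqxx.
have Dder r : D (cst r) = cst (der r) * W ^+ i0.
  suff [s es] : exists s, D (cst r) = cst s * W ^+ i0 by rewrite (derE _ _ es).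
  have [N /(_ N (leqnn N))[_ ->]] := comp_bound weighted r.
  elim: N => [|N [s es]]; first by exists 0; rewrite big_ord0 !rmorph0 mul0r (lnd0 lndD).
  have [t et] : exists t, D (cst (comp weighted r N)) = cst t * W ^+ i0.
    have [z|nz] := eqVneq (D (cst (comp weighted r N))) 0.
      by exists 0; rewrite z rmorph0 mul0r.
    by have [_ [t [_ et _]]] := mono _ _ (comp_gpiece weighted r N) nz; exists t.
  have add a b : D (cst a) = cst s * W ^+ i0 -> D (cst b) = cst t * W ^+ i0 ->
      D (cst (a + b)) = cst (s + t) * W ^+ i0.
    by move=> ea eb; rewrite (rmorphD cst) DD ea eb (rmorphD cst) mulrDl.
  exists (s + t); have -> : \sum_(i < N.+1) comp weighted r i =
      \sum_(i < N) comp weighted r i + comp weighted r N by rewrite big_ord_recr.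
  exact: add es et.
exists i0, d0', d0, der; split=> // [d r Gr nz|].
  have Dr : D (cst r) != 0.
    apply: contraNneq nz => z; apply/eqP/derE.
    by rewrite z rmorph0 mul0r.
  by have [d' [s [Gs es ed]]] := mono _ _ Gr Dr; exists d'; rewrite ?(derE _ _ es).
exists r0; rewrite (derE _ _ es0); apply: contraNneq Dr0 => s00.
by rewrite es0 s00 rmorph0 mul0r.
Qed.

Section Restriction.
Variables (i0 : nat) (der : R -> R).
Hypotheses (lti0 : (i0 < n)%N) (Dder : forall r, D (cst r) = cst (der r) * W ^+ i0).

Lemma restriction_eq0 r : D (cst r) = 0 -> der r = 0.
Proof. by rewrite Dder => e; apply: (mono_inj lti0); rewrite e rmorph0 mul0r. Qed.

Lemma restriction_lnd : lnd der.
Proof.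
split=> [a b|a b|r].
- by apply: (mono_inj lti0); rewrite -Dder !(rmorphD cst) DD !Dder mulrDl.
- by apply: (mono_inj lti0); rewrite -Dder (rmorphM cst) DM !Dder (rmorphD cst) !(rmorphM cst); ring.
have [N] := ubnP (ddeg lndD (cst r)); elim: N r => // N IHN r; rewrite ltnS => le.
have [z|nz] := eqVneq (D (cst r)) 0; first by exists 1%N; apply: restriction_eq0.
have c0 : cst (der r) != 0 by apply: contraNneq nz => z; rewrite Dder z mul0r.
have [|M eM] := IHN (der r); last by exists M.+1; rewrite iterSr.
apply: leq_trans le; rewrite (ddeg_lnd lndD nz) Dder.
by rewrite (ddegM domB char0B lndD c0 (WX_neq0 i0)) ltnS leq_addr.
Qed.

(** If [D W <> 0], a homogeneous local slice must be a multiple of [W], so [W]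
    has degree [1] and [W ^ n = - f] has degree [n]. Comparing degrees modulo
    [n] gives [i0 = n - 1], which leaves degree [0] for the restriction of [D]
    evaluated at [f]. *)
Lemma restriction_f : der (der f) = 0.
Proof.
have [Df|Df] := eqVneq (D (cst f)) 0.
  by rewrite (restriction_eq0 Df); apply: restriction_eq0; rewrite rmorph0 (lnd0 lndD).
have DW : D W != 0.
  by apply: contraNneq Df => DW; rewrite -oppr_eq0 -lnd_W_exp (ker_exp lndD).
have inj := cover_degree_inj n_ge2 n_not3 f_homog irr_f.
have [m1 em1 Gm1] := homD (W_piece n_ge2 n_not3 f_homog irr_f) DW.
have [j1 [du [u [ltj1 Gu eu ed1]]]] := cover_homog Gm1 DW.
have j10 : j1 = 0%N.
  case: j1 eu {ltj1 ed1} => // j1 eu; case/eqP: DW; apply: (lnd_dvd domB char0B lndD).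
  by exists (cst u * W ^+ j1); rewrite eu exprS mulrCA.
have [l [Ds DDs]] := local_slice_exists lndD DW.
have s0 : iter l D W != 0 by apply: contraNneq Ds => ->; rewrite (lnd0 lndD).
have [ms ems Gs] := homog_iter lndD homD (W_piece n_ge2 n_not3 f_homog irr_f) s0.
set s := iter l D W in Ds DDs s0 Gs.
have [j [dg [g [ltj Gg es eds]]]] := cover_homog Gs s0.
have [m2 em2 Gm2] := homD Gs Ds.
have [j2 [dt [t [ltj2 Gt et ed2]]]] := cover_homog Gm2 Ds.
have j20 : j2 = 0%N.
  case: j2 et {ltj2 ed2} => // j2 et; case/eqP: DW.
  apply: (ker_factor domB char0B lndD (b := cst t * W ^+ j2)).
    by rewrite mulrCA -exprS -et.
  by rewrite mulrCA -exprS -et.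
have jE : j = 1%N.
  have E : (n * (dg + du) + 9 * j = n * dt + 9 * 1)%N.
    by move: ed1 ed2 eds em1 em2; rewrite j10 j20 !mulnDr; lia.
  by have [] := inj _ _ _ _ ltj n_ge2 E.
have degW : ddeg lndD W = 1%N.
  have g0 : cst g != 0 by apply: contraNneq s0 => z; rewrite es z mul0r.
  have : ddeg lndD s = 1%N by apply: ddeg_eq.
  rewrite es jE expr1 (ddegM domB char0B lndD g0 W_neq0).
  by rewrite (ddeg_lnd lndD DW) addnS => -[/eqP]; rewrite addn_eq0 => /andP[_ /eqP ->].
have i0E : i0.+1 = n.
  apply/eqP; rewrite eqn_leq lti0 leqNgt; apply/negP => lt.
  have [m3 em3 Gm3] := homD (cst_piece f_homog) Df.
  have [i3 [d3 [r3 [lti3 Gr3 er3 ed3]]]] := cover_homog Gm3 Df.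
  have i3E : i3 = i0.
    have [//|ne] := eqVneq i3 i0; case/eqP: Df; suff r30 : r3 = 0 by rewrite er3 r30 rmorph0 mul0r.
    have := cover_coef_mono f n_gt0 r3 lti3 lti3; rewrite -er3 Dder eqxx.
    by rewrite (cover_coef_mono f n_gt0 _ lti0 lti3) (negbTE ne).
  have E : (n * d3 + 9 * i0.+1 = n * (9 + du) + 9 * 0)%N.
    by move: ed3 em3 ed1 em1; rewrite j10 i3E !mulnDr; lia.
  by have [] := inj _ _ _ _ lt n_gt0 E.
have N1 : (-1 : B) != 0 by rewrite oppr_eq0 oner_neq0.
have degf : ddeg lndD (cst f) = n.
  have -> : cst f = -1 * W ^+ n by rewrite (W_exp f n_gt0) mulN1r opprK.
  rewrite (ddegM domB char0B lndD N1 (WX_neq0 n)) (ddegX domB char0B lndD _ W_neq0) degW.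
  by rewrite ddeg_ker ?mul1n // (lndN lndD) (lnd1 lndD) oppr0.
have df0 : cst (der f) != 0 by apply: contraNneq Df => z; rewrite Dder z mul0r.
apply: restriction_eq0; apply: (@ddeg0_ker _ _ lndD).
have := ddeg_lnd lndD Df; rewrite degf Dder (ddegM domB char0B lndD df0 (WX_neq0 i0)).
rewrite (ddegX domB char0B lndD _ W_neq0) degW mul1n -addnS i0E -[LHS]add0n.
by move/addIn.
Qed.

End Restriction.
End Derivation.

(** The highest component of a nonzero derivation is homogeneous and restricts,
    up to a power of [W], to a derivation of the polynomial ring under which [f]
    has degree at most one. *)
Lemma cover_lnd_eq0 (D : B -> B) : at_least_two_singular_points (quot_grading f_homog) ->
  lnd D -> forall b, D b = 0.
Proof.
move=> sing lndD b; apply/eqP; apply: contrapT => /negP Db.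
have [E bound] := cover_lnd_bounded lndD.
have [T [e2 [lndT homT T0]]] := top_derivation lndD bound (ex_intro _ b Db).
have [i0 [E1 [E2 [der [lti0 Tder homder der0]]]]] := lnd_restrict lndT homT T0.
have lnd_der := restriction_lnd lndT lti0 Tder.
exact: (no_derivation_of_small_degree k_char0 irr_f lnd_der homder der0
  (restriction_f lndT homT lti0 Tder) sing).
Qed.

End CoverDerivation.

(** * Rigidity, rationality and factoriality of the cover *)

Theorem theorem1p2 (k : closedFieldType) (k_char0 : [pchar k] =i pred0)
  (f : {mpoly k[3]}) (f_homog : f \is 9.-homog for wt321)
  (C1 : irreducible_elt f)
  (C2 : at_least_two_singular_points (quot_grading f_homog))
  (C3 : exists p q : k, [/\ p != 0, q != 0 &
     f \mPo [tuple 'X_0; 'X_1; 0 : {mpoly k[3]}] =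
       'X_0 * (p *: 'X_0 ^+ 2 + q *: 'X_1 ^+ 3)])
  (n : nat) (n_ge2 : (2 <= n)%N) (n_not3 : ~~ (3 %| n)%N) :
  [/\ is_rigid (cyclic_cover n f), is_rational (cyclic_cover n f)
    & is_ufd (cyclic_cover n f)].
Proof.
have z_ndvd_f : ~ dvd ('X_ord_max : {mpoly k[3]}) f.
  move/dvd_z; rewrite /at_z0; have [p [q [p0 _ ->]]] := C3.
  (* the coefficient of x ^ 3 in f(x, y, 0) is p *)
  move/(congr1 (mcoeff (U_(0%R) + U_(0%R) *+ 2)%MM)); rewrite mulrC mcoeffMX mcoeff0.
  rewrite mcoeffD !mcoeffZ !mpolyXn !mcoeffX eqxx mulr1 (_ : (_ == _) = false) ?mulr0 ?addr0.
    by apply/eqP.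
  by apply/eqP => /mnmP /(_ 0%R); rewrite !mulmnE !mnm1E.
have dom := cover_domain n_ge2 n_not3 f_homog C1.
split; last 1 first.
- exact/factorial_is_ufd/(cover_factorial n_ge2 n_not3 f_homog C1).
- split=> // [p|D [linD leibD] nilD].
    rewrite !inE; apply/negP => /andP[p_prime /eqP p0].
    have := char_zero_ext k_char0 (scalars (cst f n)) p.-1.
    by rewrite prednK ?prime_gt0 // p0 eqxx.
  apply: (cover_lnd_eq0 k_char0 n_ge2 n_not3 C1 C2); split=> // a b.
  by have := linD 1 a b; rewrite !scale1r.
- exact: cover_rational.
Qed.
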